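(* Let $T>0$ and let $(B^H_t)_{t\in[0,T]}$ be a one-dimensional fractional Brownian motion with Hurst parameter $H\in(\frac12,1)$. For any $x\in\mathbb R$, the functional $$\xi(x)=\int_0^T\delta(x-B^H_s)\,dB^H_s$$ is an element of the Sobolev-Watanabe space $\mathbb D^{-\alpha,2}$ for every $\alpha>\frac32-\frac1{2H}$.
   Context: $B^H$ is the centered Gaussian process starting from zero with covariance $R^H(t,s)=\frac12(t^{2H}+s^{2H}-|t-s|^{2H})$. Its canonical Hilbert space $\mathcal H_H$ is the closure of the span of the indicators $1_{[0,t]}$, $t\in[0,T]$, under $\langle1_{[0,t]},1_{[0,s]}\rangle_{\mathcal H_H}=R^H(t,s)$. $I_n$ is the multiple Wiener-Itô integral of order $n$ with respect to $B^H$, with $\mathbf E[I_n(f)I_n(g)]=n!\langle f,g\rangle_{\mathcal H_H^{\otimes n}}$ for symmetric $f,g$. $\delta$ is the Dirac delta, understood as a generalized random variable through the chaos expansion $\delta(x-B^H_s)=\sum_{n\ge0}a^x_n(s)I_n(1_{[0,s]}^{\otimes n})$, where $a^x_n(s)=s^{-nH}p_{s^{2H}}(x)H_n(x/s^H)$, $p_\sigma(x)=\frac1{\sqrt{2\pi\sigma}}e^{-x^2/(2\sigma)}$ (variance $\sigma$), and $H_n(x)=\frac{(-1)^n}{n!}e^{x^2/2}\frac{d^n}{dx^n}e^{-x^2/2}$. The integral is the divergence (Skorohod) integral with respect to $B^H$, which on chaos expansions gives $$\xi(x)=\sum_{n\ge0}I_{n+1}\left(\big(a^x_n(s)1_{[0,s]}^{\otimes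 n}(\cdot)\big)^\sim\right),$$ where $(\cdot)^\sim$ denotes symmetrization in the $n+1$ variables $(s,t_1,\dots,t_n)$. For $\beta\in\mathbb R$, a formal sum $F=\sum_{n\ge0}I_n(f_n)$ with symmetric $f_n\in\mathcal H_H^{\otimes n}$ belongs to $\mathbb D^{\beta,2}$ if and only if $\sum_{n\ge0}(1+n)^\beta\,n!\,\|f_n\|^2_{\mathcal H_H^{\otimes n}}<\infty$.
   Formalization: For x = 0 the claim fails, because the first-order kernel is a multiple of s^{-H}, which is not in the canonical Hilbert space; the formal theorem asserts that ξ(x) exists and lies in the Sobolev-Watanabe space only for x ≠ 0. *)

(* Defs.v *)
From HB Require Import structures.
From mathcomp Require Import all_boot all_order all_algebra all_fingroup.
From mathcomp Require Import all_classical all_reals all_analysis.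

Set Implicit Arguments.
Unset Strict Implicit.
Unset Printing Implicit Defensive.

Import Order.TTheory GRing.Theory Num.Theory.
Import numFieldNormedType.Exports.

Local Open Scope classical_set_scope.
Local Open Scope ring_scope.

(** * Points of [R^n] as functions ['I_n -> R] *)

Definition fcons (R : Type) n (s : R) (u : 'I_n -> R) : 'I_n.+1 -> R :=
  fun i => if unlift ord0 i is Some j then u j else s.

Definition ftail (R : Type) n (u : 'I_n.+1 -> R) : 'I_n -> R :=
  fun i => u (lift ord0 i).

Definition fdrop (R : Type) n (j : 'I_n.+1) (u : 'I_n.+1 -> R) : 'I_n -> R :=
  fun i => u (lift j i).

Definition in_box (R : realType) (T : R) n (u : 'I_n -> R) : Prop :=
  forall i, 0 <= u i <= T.

(* Iterated Lebesgue integral over [0,T]^n; it is only applied to nonnegative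
   integrands, where it is the n-dimensional integral by Tonelli. *)
Fixpoint box_integral (R : realType) (T : R) (n : nat) {struct n} :
    (('I_n -> R) -> \bar R) -> \bar R :=
  match n with
  | 0 => fun F => F (fun=> 0)
  | m.+1 => fun F => (\int[@lebesgue_measure R]_(s in `[0%R, T])
                        box_integral T (fun u : 'I_m -> R => F (fcons s u)))%E
  end.

Definition symmetrize (R : realType) n (f : ('I_n -> R) -> R) (u : 'I_n -> R)
    : R :=
  (n`!%:R)^-1 * \sum_(sigma : 'S_n) f (fun i => u (sigma i)).

(** * Fractional Brownian motion *)

Definition fbm_cov (R : realType) (H t s : R) : R :=
  2^-1 * (t `^ (2 * H) + s `^ (2 * H) - `|t - s| `^ (2 * H)).

(* [normal_prob m 0] is not the Dirac mass at [m], so degenerate laws are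
   treated apart. *)
Definition gaussian_law (R : realType) d (Omega : measurableType d)
    (P : probability Omega R) (X : Omega -> R) : Prop :=
  exists m sigma : R,
    (sigma = 0 /\ {ae P, forall w, X w = m}) \/
    (0 < sigma /\
     forall A : set R, measurable A -> P (X @^-1` A) = normal_prob m sigma A).

Record fbm (R : realType) d (Omega : measurableType d)
    (P : probability Omega R) (H T : R) (B : R -> {RV P >-> R}) : Prop := Fbm {
  fbm_gaussian : forall l : seq (R * R),
    (forall c, c \in l -> 0 <= c.2 <= T) ->
    gaussian_law P (fun w => \sum_(c <- l) c.1 * B c.2 w) ;
  fbm_start : {ae P, forall w, B 0 w = 0} ;
  fbm_centered : forall t, 0 <= t <= T -> ('E_P[B t] = 0)%E ;
  fbm_covariance : forall t s, 0 <= t <= T -> 0 <= s <= T ->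
    covariance P (B t) (B s) = (fbm_cov H t s)%:E }.

(** * Tensor powers of the canonical Hilbert space *)

(* The list of the pairs (c, t) encodes the n-variable step function
   \sum c 1_[0,t_0] (x) ... (x) 1_[0,t_(n-1)]. *)
Definition step (R : realType) n : Type := seq (R * ('I_n -> R)).

Definition step_fun (R : realType) n (g : step R n) (u : 'I_n -> R) : R :=
  \sum_(c <- g) c.1 * \prod_(i < n) \1_(`[0, c.2 i]%classic : set R) (u i).

Definition step_sub (R : realType) n (g h : step R n) : step R n :=
  g ++ [seq (- c.1, c.2) | c <- h].

Definition step_perm (R : realType) n (sigma : 'S_n) (g : step R n)
    : step R n :=
  [seq (c.1, fun i => c.2 (sigma i)) | c <- g].

Definition step_ip (R : realType) (H : R) n (g h : step R n) : R :=
  \sum_(c <- g) \sum_(e <- h)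
    c.1 * e.1 * \prod_(i < n) fbm_cov H (c.2 i) (e.2 i).

Definition step_norm2 (R : realType) (H : R) n (g : step R n) : R :=
  step_ip H g g.

(* Elements of the completion are Cauchy sequences of step functions, up to
   [tensor_eq]; for n = 1 this is the canonical Hilbert space of B^H itself. *)
Record tensor (R : realType) (H T : R) (n : nat) : Type := Tensor {
  approx :> nat -> step R n ;
  approx_in_box : forall k i, (i < size (approx k))%N ->
    in_box T (nth (0, fun=> 0) (approx k) i).2 ;
  approx_cauchy : forall e : R, 0 < e -> exists N : nat,
    forall k l, (N <= k)%N -> (N <= l)%N ->
      step_norm2 H (step_sub (approx k) (approx l)) < e }.

Definition tensor_norm2 (R : realType) (H T : R) n (f : tensor H T n) : R :=
  limn (fun k => step_norm2 H (f k)).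

Definition tensor_symmetric (R : realType) (H T : R) n (f : tensor H T n)
    : Prop :=
  forall sigma : 'S_n,
    (fun k => step_norm2 H (step_sub (step_perm sigma (f k)) (f k))) @ \oo
      --> (0 : R).

(* For H > 1/2, R^H(t,s) = H(2H-1) \int_0^t \int_0^s |u-v|^(2H-2) dv du, so the
   scalar product of step functions is
     \int \int f(u) g(v) \prod_i H(2H-1) |u_i-v_i|^(2H-2) dv du,
   and it extends to the functions f with [abs_norm2 H T f < +oo]. *)
Definition abs_norm2 (R : realType) (H T : R) n (f : ('I_n -> R) -> R)
    : \bar R :=
  box_integral T (fun u : 'I_n -> R => box_integral T (fun v : 'I_n -> R =>
    (`|f u| * `|f v| *
     \prod_(i < n) (H * (2 * H - 1) * `|u i - v i| `^ (2 * H - 2)))%:E)).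

(* The element [phi] of the completion is the function [f]: its step functions
   converge to [f] in the norm above, which dominates that of the completion;
   [phi] is therefore unique up to null sequences. *)
Definition represents (R : realType) (H T : R) n (phi : tensor H T n)
    (f : ('I_n -> R) -> R) : Prop :=
  (fun k => abs_norm2 H T (fun u => f u - step_fun (phi k) u)) @ \oo
    --> (0%E : \bar R).

(** * Multiple Wiener-Ito integrals *)

(* I_n(1_[0,t_0] (x) ... (x) 1_[0,t_(n-1)]), by the product formula
   I_1(h) I_(n+1)(g) = I_(n+2)(h (x) g) + \sum_j I_n(<h, g>_j),
   with <h, g>_j the contraction of [h] with the j-th variable of [g]; for
   t_0 = ... = t_(n-1) = t it equals n! t^(nH) H_n(B_t / t^H). *)
Fixpoint elementary_integral (R : realType) (Omega : Type) (H : R)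
    (B : R -> Omega -> R) (w : Omega) (n : nat) {struct n} :
    ('I_n -> R) -> R :=
  match n with
  | 0 => fun=> 1
  | p.+1 => fun t =>
      B (t ord0) w * elementary_integral H B w (ftail t) -
      (match p return ('I_p -> R) -> R with
       | 0 => fun=> 0
       | q.+1 => fun r => \sum_(j < q.+1)
           fbm_cov H (t ord0) (r j) * elementary_integral H B w (fdrop j r)
       end) (ftail t)
  end.

Definition step_integral (R : realType) (Omega : Type) (H : R)
    (B : R -> Omega -> R) n (g : step R n) (w : Omega) : R :=
  \sum_(c <- g) c.1 * elementary_integral H B w c.2.

(* [I n f] is the L^2 limit of the integrals of the step functions defining
   [f]. *)
Definition multiple_integral (R : realType) d (Omega : measurableType d)
    (P : probability Omega R) (H T : R) (B : R -> {RV P >-> R})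
    (I : forall n, tensor H T n -> {RV P >-> R}) : Prop :=
  forall n (f : tensor H T n),
    (fun k => 'E_P[(fun w =>
       (I n f w - step_integral H (fun t => B t : Omega -> R) (f k) w) ^+ 2)%R]%E)
      @ \oo --> (0%E : \bar R).

(** * Formal chaos expansions and Sobolev-Watanabe spaces *)

(* The formal sum \sum_n F_n, with F_n in the n-th chaos, is the sequence of its
   components. *)
Definition chaos_expansion (R : realType) d (Omega : measurableType d)
    (P : probability Omega R) (H T : R)
    (I : forall n, tensor H T n -> {RV P >-> R})
    (F : nat -> {RV P >-> R}) (f : forall n, tensor H T n) : Prop :=
  forall n, {ae P, forall w, F n w = I n (f n) w}.

Definition sobolev_watanabe (R : realType) d (Omega : measurableType d)
    (P : probability Omega R) (H T : R)
    (I : forall n, tensor H T n -> {RV P >-> R}) (beta : R)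
    : set (nat -> {RV P >-> R}) :=
  [set F | exists f : forall n, tensor H T n,
     [/\ forall n, tensor_symmetric (f n), chaos_expansion I F f &
      (\sum_(0 <= n <oo)
         ((1 + n%:R) `^ beta * n`!%:R * tensor_norm2 (f n))%:E < +oo)%E] ].

(** * The Skorohod integral of the Dirac delta *)

(* [sigma] is the variance. *)
Definition heat_kernel (R : realType) (sigma x : R) : R :=
  (Num.sqrt (2 * pi * sigma))^-1 * expR (- (x ^+ 2 / (2 * sigma))).

Definition hermite (R : realType) (n : nat) (x : R) : R :=
  (-1) ^+ n / n`!%:R * expR (x ^+ 2 / 2) *
  derive1n n (fun y : R => expR (- (y ^+ 2 / 2))) x.

Definition delta_coef (R : realType) (H x : R) (n : nat) (s : R) : R :=
  s `^ (- (n%:R * H)) * heat_kernel (s `^ (2 * H)) x *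
  hermite n (x / s `^ H).

(* The n-th kernel of delta(x - B^H_s), as a function on [0,T]^n. *)
Definition delta_kernel (R : realType) (H x : R) (n : nat) (s : R)
    (u : 'I_n -> R) : R :=
  delta_coef H x n s * \prod_(i < n) \1_(`[0, s]%classic : set R) (u i).

(* The kernels of the Skorohod integral of the process with value
   \sum_n I_n(g n s) at time s. *)
Definition skorohod_kernel (R : realType)
    (g : forall n, R -> ('I_n -> R) -> R) (n : nat) : ('I_n -> R) -> R :=
  match n with
  | 0 => fun=> 0
  | m.+1 => symmetrize (fun u : 'I_m.+1 -> R => g m (u ord0) (ftail u))
  end.

(* The formal sums equal to the Skorohod integral of delta(x - B^H) on [0,T];
   any two of them have almost surely equal components.  For x = 0 there is
   none: the kernel of order one is then s |-> (2 pi)^(-1/2) s^(-H), which is not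
   in the canonical Hilbert space since \int \int (u v)^(-H) |u-v|^(2H-2) dv du
   diverges at the origin. *)
Definition skorohod_delta (R : realType) d (Omega : measurableType d)
    (P : probability Omega R) (H T : R)
    (I : forall n, tensor H T n -> {RV P >-> R}) (x : R)
    : set (nat -> {RV P >-> R}) :=
  [set F | exists f : forall n, tensor H T n,
     (forall n, represents (f n) (skorohod_kernel (delta_kernel H x) (n:=n))) /\
     chaos_expansion I F f].

(* Main.v *)
Require Import Defs.
From HB Require Import structures.
From mathcomp Require Import all_boot all_order all_algebra all_fingroup.
From mathcomp Require Import all_classical all_reals all_analysis.
From mathcomp Require Import measurable_realfun.
From mathcomp Require Import ring lra zify.

(* For x <> 0 the kernel f_N of order N = n + 1 is the symmetrization of
   a_n(s) 1_[0,s]^n, a bounded function and a pointwise limit of bounded step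
   functions on grids, so that it is represented in the N-th tensor power.  Its
   norm is at most that of [abs_norm2], where f_N is dominated by the average
   of the N functions |a_n(u_i)| 1(u_k <= u_i for all k).  A pair of equal
   functions contributes the integral of |a_n(s) a_n(t)| R(s,t)^n against the
   density |s - t|^(2H-2), and only a fraction 1/N of the pairs are equal; in
   the other pairs, integrating the density in the two adapted variables leaves
   the integral of |a_n(s) a_n(t)| R(s,t)^(n-1).
   - An energy estimate for Hermite functions, decreasing in |y|, gives
     |a_n(s)| s^((n-1)H) = O((n! sqrt n)^(-1/2)).
   - R(s,t) <= (1 - c |s - t|^(2H)) (s t)^H, and the (n-1)-th power of the first
     factor has integral O(n^(-1/(2H))).
   Hence N! |f_N|^2 = O(N^(1/2 - 1/(2H))), which is summable against
   (1 + N)^(-alpha) when alpha > 3/2 - 1/(2H).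
   For x = 0 the kernel of order one is a multiple of s^(-H).  Even after
   subtraction of a bounded function, its energy near the origin diverges like
   the integral of 1/s, so that no sequence of step functions converges to it. *)

Set Implicit Arguments.
Unset Strict Implicit.
Unset Printing Implicit Defensive.

Import Order.TTheory GRing.Theory Num.Theory.
Import numFieldNormedType.Exports.

Local Open Scope classical_set_scope.
Local Open Scope ring_scope.

(** * Iterated integrals *)

(** No Cauchy-Schwarz inequality is proved for [abs_norm2]. Two comparisons with the L^1 norm on the
    box replace it. The density |u - v|^(2H-2) is bounded below off the diagonal, so convergence in
    [abs_norm2] implies L^1 convergence. It is also integrable in v, uniformly in u, so a scalar
    product with one bounded factor is controlled by the L^1 norm of the other. Hence the importance
    of bounded kernels, which x <> 0 provides: a_n(s) tends to 0 at s = 0 by Gaussian decay. The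
    condition x <> 0 acts a second time in the norms. The coefficient a_n(s) carries s^(-(n+1)H),
    but only the power n - 1 of R(s,t), hence of (s t)^H, is left to compensate it. The Hermite
    estimate is therefore proved with the weight 5 + y^2, where y = x / s^H: the term y^2 supplies
    the missing factor s^(-2H), at the cost of x^(-4) in the squared norm. The coefficients enter
    only through absolute values. The factor n^(-1/(2H)) comes from the covariance alone, and since
    1/(2H) < 1 it dominates the 1/N of the pairs of equal functions. *)

Section restricted_tonelli.
Local Open Scope ereal_scope.
Context d1 d2 (T1 : measurableType d1) (T2 : measurableType d2) (R : realType).

Lemma measurable_integral_param (m2 : {sigma_finite_measure set T2 -> \bar R})
    (D : set T2) (f : T1 -> T2 -> \bar R) :
  measurable D -> measurable_fun setT (fun z : T1 * T2 => f z.1 z.2) ->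
  (forall x y, 0 <= f x y) ->
  measurable_fun setT (fun x => \int[m2]_(y in D) f x y).
Proof.
move=> mD mf f0.
rewrite [X in measurable_fun _ X](_ : _ = fubini_F m2
    ((fun z => f z.1 z.2) \_ (setT `*` D))); last first.
  apply/funext => x; rewrite integral_mkcond /fubini_F; apply: eq_integral => y _.
  by rewrite /patch !in_setX in_setT.
apply: measurable_fun_fubini_tonelli_F.
  by apply/(measurable_restrictT _ _).1; [exact: measurableX|exact: measurable_funTS].
by move=> z; apply: erestrict_ge0.
Qed.

Lemma tonelli_restrict (m1 : {sigma_finite_measure set T1 -> \bar R})
    (m2 : {sigma_finite_measure set T2 -> \bar R}) (D1 : set T1) (D2 : set T2)
    (f : T1 -> T2 -> \bar R) :
  measurable D1 -> measurable D2 ->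
  measurable_fun setT (fun z : T1 * T2 => f z.1 z.2) -> (forall x y, 0 <= f x y) ->
  \int[m1]_(x in D1) \int[m2]_(y in D2) f x y =
  \int[m2]_(y in D2) \int[m1]_(x in D1) f x y.
Proof.
move=> mD1 mD2 mf f0.
pose g := (fun z => f z.1 z.2) \_ (D1 `*` D2).
transitivity (\int[m1]_x \int[m2]_y g (x, y)).
  rewrite integral_mkcond; apply: eq_integral => x _.
  rewrite /patch; case: ifPn => xD.
    rewrite integral_mkcond; apply: eq_integral => y _.
    by rewrite /g /patch in_setX xD.
  rewrite integral0_eq// => y _; rewrite /g /patch in_setX (negbTE xD)//.
transitivity (\int[m2]_y \int[m1]_x g (x, y)).
  apply: fubini_tonelli.
    by apply/(measurable_restrictT _ _).1; [exact: measurableX|exact: measurable_funTS].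
  by move=> z; apply: erestrict_ge0.
rewrite [RHS]integral_mkcond; apply: eq_integral => y _.
rewrite /patch; case: ifPn => yD.
  rewrite [RHS]integral_mkcond; apply: eq_integral => x _.
  by rewrite /g /patch in_setX yD andbT.
by rewrite integral0_eq// => x _; rewrite /g /patch in_setX (negbTE yD) andbF.
Qed.

End restricted_tonelli.

(** Up to conversion [fcons] is the case [i = ord0], so that the lemmas on [finsert] apply to the
    recursive step of [box_integral]. *)
Definition finsert (R : Type) n (i : 'I_n.+1) (s : R) (u : 'I_n -> R) :
    'I_n.+1 -> R :=
  fun k => if unlift i k is Some j then u j else s.

Lemma finsertE (R : Type) n (i : 'I_n.+1) (s : R) (u : 'I_n -> R) :
  finsert i s u i = s.
Proof. by rewrite /finsert unlift_none. Qed.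

Lemma finsert_lift (R : Type) n (i : 'I_n.+1) (s : R) (u : 'I_n -> R) j :
  finsert i s u (lift i j) = u j.
Proof. by rewrite /finsert liftK. Qed.

Lemma in_box_finsert (R : realType) (T : R) n (i : 'I_n.+1) s (u : 'I_n -> R) :
  0 <= s <= T -> in_box T u -> in_box T (finsert i s u).
Proof. by move=> hs hu k; rewrite /finsert; case: unliftP => [j _|_//]. Qed.

Section box_integral_theory.
Context (R : realType) (T : R).
Notation mu := (@lebesgue_measure R).
Notation D := ([set` `[0%R, T]] : set R).

(* Measurability of a function of [u : 'I_n -> R] and a parameter, expressed by
   composition with all measurable families: ['I_n -> R] carries no
   sigma-algebra. *)
Definition pmeasurable d (Z : measurableType d) n
    (F : Z -> ('I_n -> R) -> \bar R) : Prop :=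
  forall d' (Y : measurableType d') (h : Y -> Z) (g : Y -> 'I_n -> R),
    measurable_fun setT h -> (forall i, measurable_fun setT (g ^~ i)) ->
    measurable_fun setT (fun y => F (h y) (g y)).

Definition bmeasurable n (F : ('I_n -> R) -> \bar R) : Prop :=
  forall d' (Y : measurableType d') (g : Y -> 'I_n -> R),
    (forall i, measurable_fun setT (g ^~ i)) ->
    measurable_fun setT (fun y => F (g y)).

Lemma measurable_finsert d (Y : measurableType d) n (i : 'I_n.+1) (s : Y -> R)
    (g : Y -> 'I_n -> R) :
  measurable_fun setT s -> (forall j, measurable_fun setT (g ^~ j)) ->
  forall k, measurable_fun setT (fun y => finsert i (s y) (g y) k).
Proof. by move=> ms mg k; rewrite /finsert; case: unliftP. Qed.

Let mD : measurable D. Proof. exact: measurable_itv. Qed.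

Local Open Scope ereal_scope.

Lemma bmeasurable_param d (Z : measurableType d) n
    (F : Z -> ('I_n -> R) -> \bar R) z : pmeasurable F -> bmeasurable (F z).
Proof. by move=> mF d' Y g mg; apply: (mF _ _ (cst z)). Qed.

Lemma pmeasurable_finsert n (F : ('I_n.+1 -> R) -> \bar R) i :
  bmeasurable F -> pmeasurable (fun (s : R) u => F (finsert i s u)).
Proof. by move=> mF d' Y h g mh mg; apply: mF; apply: measurable_finsert. Qed.

Lemma box_integral_ge0 n (F : ('I_n -> R) -> \bar R) :
  (forall u, 0 <= F u) -> 0 <= box_integral T F.
Proof.
elim: n F => [|n IH] F F0 //=.
by apply: integral_ge0 => s _; exact: IH.
Qed.

Lemma measurable_box_integral n d (Z : measurableType d)
    (F : Z -> ('I_n -> R) -> \bar R) :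
  (forall z u, 0 <= F z u) -> pmeasurable F ->
  measurable_fun setT (fun z => box_integral T (F z)).
Proof.
elim: n d Z F => [|n IH] d Z F F0 mF /=.
  by apply: (mF _ _ id) => // i; exact: measurable_cst.
apply: measurable_integral_param => //; last first.
  by move=> z s; apply: box_integral_ge0.
apply: (IH _ _ (fun p : Z * R => fun u => F p.1 (fcons p.2 u))) => //.
move=> d' Y h g mh mg; apply: mF; first exact: measurableT_comp.
by apply: (@measurable_finsert _ _ _ ord0) => //; exact: measurableT_comp.
Qed.

Lemma pmeasurable_box n (F : ('I_n.+1 -> R) -> \bar R) i :
  (forall u, 0 <= F u) -> bmeasurable F ->
  measurable_fun setT (fun s : R => box_integral T (fun u => F (finsert i s u))).
Proof.
move=> F0 mF; apply: measurable_box_integral => //.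
exact: pmeasurable_finsert.
Qed.

(** The excluded hyperplanes are null sets. They must be excluded for the covariance density: its
    value at 0 is 0 by the convention on [powR], so that its lower bound fails on the diagonal. *)
Lemma le_box_integral_off n (c : 'I_n -> R) (F G : ('I_n -> R) -> \bar R) :
  (forall u, 0 <= F u) -> (forall u, 0 <= G u) ->
  bmeasurable F -> bmeasurable G ->
  (forall u, in_box T u -> (forall i, u i != c i) -> F u <= G u) ->
  box_integral T F <= box_integral T G.
Proof.
elim: n c F G => [|n IH] c F G F0 G0 mF mG FG /=.
  by apply: FG => -[].
apply: ae_ge0_le_integral => //.
- by move=> s _; apply: box_integral_ge0.
- by apply: measurable_funTS; exact: (@pmeasurable_box _ _ ord0).
- by move=> s _; apply: box_integral_ge0.
- by apply: measurable_funTS; exact: (@pmeasurable_box _ _ ord0).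
exists [set c ord0]; split => //; first exact: lebesgue_measure_set1.
move=> s /= /not_implyP[sD]; apply: contra_notP => /eqP sc.
apply: (IH (fun i => c (lift ord0 i))) => //.
- exact: (bmeasurable_param _ (pmeasurable_finsert _ mF)).
- exact: (bmeasurable_param _ (pmeasurable_finsert _ mG)).
move=> u hu uc; apply: FG; first by apply: (@in_box_finsert _ _ _ ord0).
by move=> i; rewrite /fcons; case: unliftP => [j ->|->].
Qed.

Lemma le_box_integral n (F G : ('I_n -> R) -> \bar R) :
  (forall u, 0 <= F u) -> (forall u, 0 <= G u) ->
  bmeasurable F -> bmeasurable G ->
  (forall u, in_box T u -> F u <= G u) ->
  box_integral T F <= box_integral T G.
Proof.
move=> F0 G0 mF mG FG.
by apply: (@le_box_integral_off _ (fun=> 0%R)) => // u hu _; exact: FG.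
Qed.

Lemma eq_box_integral n (F G : ('I_n -> R) -> \bar R) :
  (forall u, in_box T u -> F u = G u) -> box_integral T F = box_integral T G.
Proof.
elim: n F G => [|n IH] F G FG /=; first by apply: FG => -[].
apply: eq_integral => s; rewrite inE => sD; apply: IH => u hu.
by apply: FG; apply: (@in_box_finsert _ _ _ ord0).
Qed.

Lemma box_integralD n (F G : ('I_n -> R) -> \bar R) :
  (forall u, 0 <= F u) -> (forall u, 0 <= G u) ->
  bmeasurable F -> bmeasurable G ->
  box_integral T (fun u => F u + G u) = box_integral T F + box_integral T G.
Proof.
elim: n F G => [|n IH] F G F0 G0 mF mG //=.
rewrite -ge0_integralD//.
- apply: eq_integral => s _; rewrite IH//.
  + exact: (bmeasurable_param _ (pmeasurable_finsert _ mF)).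
  + exact: (bmeasurable_param _ (pmeasurable_finsert _ mG)).
- by move=> s _; apply: box_integral_ge0.
- by apply: measurable_funTS; exact: (@pmeasurable_box _ _ ord0).
- by move=> s _; apply: box_integral_ge0.
- by apply: measurable_funTS; exact: (@pmeasurable_box _ _ ord0).
Qed.

Lemma box_integralZe n (k : \bar R) (F : ('I_n -> R) -> \bar R) :
  0 <= k -> (forall u, 0 <= F u) -> bmeasurable F ->
  box_integral T (fun u => k * F u) = k * box_integral T F.
Proof.
move=> k0; elim: n F => [|n IH] F F0 mF //=.
rewrite -ge0_integralZl//.
- apply: eq_integral => s _; rewrite IH//.
  exact: (bmeasurable_param _ (pmeasurable_finsert _ mF)).
- by apply: measurable_funTS; exact: (@pmeasurable_box _ _ ord0).
- by move=> s _; apply: box_integral_ge0.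
Qed.

Lemma box_integralZl n (k : R) (F : ('I_n -> R) -> \bar R) :
  (0 <= k)%R -> (forall u, 0 <= F u) -> bmeasurable F ->
  box_integral T (fun u => k%:E * F u) = k%:E * box_integral T F.
Proof. by move=> k0; apply: box_integralZe; rewrite lee_fin. Qed.

Lemma box_integral0 n : box_integral T (fun _ : 'I_n -> R => 0) = 0.
Proof. by elim: n => //= n IH; apply: integral0_eq => s _. Qed.

Lemma bmeasurable_sum n I (r : seq I) (F : I -> ('I_n -> R) -> \bar R) :
  (forall i, bmeasurable (F i)) -> bmeasurable (fun u => \sum_(i <- r) F i u).
Proof. by move=> mF d Y g mg; apply: emeasurable_sum => i; exact: mF. Qed.

Lemma box_integral_sum n I (r : seq I) (F : I -> ('I_n -> R) -> \bar R) :
  (forall i u, 0 <= F i u) -> (forall i, bmeasurable (F i)) ->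
  box_integral T (fun u => \sum_(i <- r) F i u) =
  \sum_(i <- r) box_integral T (F i).
Proof.
move=> F0 mF; elim: r => [|i r IH].
  rewrite big_nil -[RHS](box_integral0 n); apply: eq_box_integral => u _.
  by rewrite big_nil.
rewrite big_cons -IH -box_integralD//.
- by apply: eq_box_integral => u _; rewrite big_cons.
- by move=> u; apply: sume_ge0.
- exact: bmeasurable_sum.
Qed.

Lemma box_integral_integral n (F : R -> ('I_n -> R) -> \bar R) :
  (forall s u, 0 <= F s u) -> pmeasurable F ->
  box_integral T (fun u => \int[mu]_(s in D) F s u) =
  \int[mu]_(s in D) box_integral T (F s).
Proof.
elim: n F => [|n IH] F F0 mF //=.
transitivity (\int[mu]_(s in D) \int[mu]_(y in D)
    box_integral T (fun u : 'I_n -> R => F y (fcons s u))).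
  apply: eq_integral => s _; apply: (IH (fun y u => F y (fcons s u))) => //.
  move=> d' Y h g mh mg; apply: mF => //.
  by apply: (@measurable_finsert _ _ _ ord0).
apply: tonelli_restrict => //; last by move=> x y; exact: box_integral_ge0.
apply: (measurable_box_integral (F := fun p : R * R => fun u => F p.2 (fcons p.1 u))) => //.
move=> d' Y h g mh mg; apply: mF => //; first exact: measurableT_comp.
by apply: (@measurable_finsert _ _ _ ord0) => //; exact: measurableT_comp.
Qed.

Definition bmeasurable2 n m (F : ('I_n -> R) -> ('I_m -> R) -> \bar R) : Prop :=
  forall d' (Y : measurableType d') (g : Y -> 'I_n -> R) (h : Y -> 'I_m -> R),
    (forall i, measurable_fun setT (g ^~ i)) ->
    (forall i, measurable_fun setT (h ^~ i)) ->
    measurable_fun setT (fun y => F (g y) (h y)).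

Lemma bmeasurable2_box n m (F : ('I_n -> R) -> ('I_m -> R) -> \bar R) :
  (forall u v, 0 <= F u v) -> bmeasurable2 F ->
  bmeasurable (fun u => box_integral T (F u)).
Proof.
move=> F0 mF d Y g mg; apply: (measurable_box_integral (F := fun y => F (g y))) => //.
move=> d' Y' h g' mh mg'; apply: mF => // i.
by apply: (measurableT_comp (f := (fun y => g y i)) (g := h)).
Qed.

Lemma box_integral_swap n m (F : ('I_n -> R) -> ('I_m -> R) -> \bar R) :
  (forall u v, 0 <= F u v) -> bmeasurable2 F ->
  box_integral T (fun u => box_integral T (F u)) =
  box_integral T (fun v => box_integral T (F ^~ v)).
Proof.
elim: n F => [|n IH] F F0 mF //=.
transitivity (\int[mu]_(s in D) box_integral T (fun v =>
    box_integral T (fun u : 'I_n -> R => F (fcons s u) v))).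
  apply: eq_integral => s _; apply: (IH (fun u => F (fcons s u))) => //.
  move=> d' Y g h mg mh; apply: mF => //.
  by apply: (@measurable_finsert _ _ _ ord0).
rewrite -(box_integral_integral (F := fun s v => box_integral T (fun u => F (fcons s u) v)))//.
  by move=> s u; apply: box_integral_ge0.
move=> d Y h g mh mg.
apply: (measurable_box_integral (F := fun y u => F (fcons (h y) u) (g y))) => //.
move=> d' Y' h' g' mh' mg'; apply: mF.
  by apply: (@measurable_finsert _ _ _ ord0) => //; exact: measurableT_comp.
by move=> i; apply: (measurableT_comp (f := (fun y => g y i)) (g := h')).
Qed.

(** By induction the chosen coordinate comes second, and Tonelli exchanges it with the first. *)
Lemma box_integral_finsert n (i : 'I_n.+1) (F : ('I_n.+1 -> R) -> \bar R) :
  (forall u, 0 <= F u) -> bmeasurable F ->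
  box_integral T F =
  \int[mu]_(s in D) box_integral T (fun u => F (finsert i s u)).
Proof.
elim: n i F => [|n IH] i F F0 mF.
  by rewrite ord1.
case: (unliftP ord0 i) => [i' ->|->//].
transitivity (\int[mu]_(s in D) \int[mu]_(s' in D)
    box_integral T (fun u => F (fcons s (finsert i' s' u)))).
  apply: eq_integral => s _; apply: (IH i' (fun u => F (fcons s u))) => //.
  exact: (bmeasurable_param _ (@pmeasurable_finsert _ _ ord0 mF)).
pose G (s s' : R) := box_integral T (fun u => F (fcons s (finsert i' s' u))).
have mG : measurable_fun setT (fun z : R * R => G z.1 z.2).
  apply: (measurable_box_integral (F := fun p : R * R => fun u =>
    F (fcons p.1 (finsert i' p.2 u)))) => //.
  move=> d' Y h g mh mg; apply: mF => //.
  apply: (@measurable_finsert _ _ _ ord0) => //; first exact: measurableT_comp.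
  by apply: measurable_finsert => //; exact: measurableT_comp.
have G0 x y : 0 <= G x y by exact: box_integral_ge0.
transitivity (\int[mu]_(s' in D) \int[mu]_(s in D) G s s').
  exact: (tonelli_restrict mu mu mD mD mG G0).
apply: eq_integral => s' _ /=; apply: eq_integral => s _.
apply: eq_box_integral => u _; congr (F _); apply/funext => k.
rewrite /fcons /finsert.
case: (unliftP (lift ord0 i') k) => [k' ->|->].
  case: (unliftP ord0 k') => [k'' ->|->].
    have -> : lift (lift ord0 i') (lift ord0 k'') = lift ord0 (lift i' k'').
      by apply/val_inj; exact: bumpS.
    by rewrite !liftK.
  have -> : lift (lift ord0 i') ord0 = ord0 :> 'I_n.+2 by apply/val_inj.
  by rewrite unlift_none.
by rewrite liftK unlift_none.
Qed.

(** The coordinate [j] that [s] sends to [ord0] is integrated first on the right; the rest of [s] is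
    a permutation [t0] of the other coordinates, to which the induction applies. *)
Lemma box_integral_perm n (s : 'S_n) (F : ('I_n -> R) -> \bar R) :
  (forall u, 0 <= F u) -> bmeasurable F ->
  box_integral T (fun u => F (fun i => u (s i))) = box_integral T F.
Proof.
elim: n s F => [|n IH] s F F0 mF.
  by congr (F _).
pose j := (s^-1)%g ord0.
have sj : s j = ord0 by rewrite /j permKV.
have sl k : unlift ord0 (s (lift j k)) != None.
  case: unliftP => //; rewrite -sj => /perm_inj/esym/eqP.
  by rewrite (negbTE (neq_lift _ _)).
pose t0 k := odflt k (unlift ord0 (s (lift j k))).
have t0E k : lift ord0 (t0 k) = s (lift j k).
  by rewrite /t0; case: unliftP (sl k) => // j' ->.
have t0inj : injective t0.
  by move=> k l kl; apply/(@lift_inj _ j)/(@perm_inj _ s); rewrite -!t0E kl.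
rewrite [RHS](box_integral_finsert j)//=; apply: eq_integral => x _.
rewrite -[RHS](IH (perm t0inj))//; last first.
  exact: (bmeasurable_param _ (pmeasurable_finsert _ mF)).
apply: eq_box_integral => u _; congr (F _); apply/funext => k.
rewrite /finsert; case: (unliftP j k) => [k' ->|->]; last first.
  by rewrite sj /fcons unlift_none.
by rewrite -t0E /fcons liftK permE.
Qed.

Lemma measure_box1 : (0 <= T)%R -> mu D = T%:E.
Proof.
move=> T0; have /= := lebesgue_measure_itv `[0%R, T]; rewrite lte_fin => ->.
case: ltgtP T0 => // [T0 _|<- _ //]; exact: sube0.
Qed.

Lemma box_integral_cst n (c : R) : (0 <= T)%R ->
  box_integral T (fun _ : 'I_n -> R => c%:E) = (c * T ^+ n)%:E.
Proof.
move=> T0; elim: n => [|n IH] /=; first by rewrite expr0 mulr1.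
rewrite (eq_integral (cst (c * T ^+ n)%:E))//.
transitivity ((c * T ^+ n)%:E * mu D); first exact: integral_cst.
by rewrite measure_box1// -EFinM exprSr mulrA.
Qed.

Lemma box_integral_cvg0 n (F : nat -> ('I_n -> R) -> \bar R) (M : R) :
  (0 <= T)%R -> (forall k u, 0 <= F k u) -> (forall k, bmeasurable (F k)) ->
  (forall k u, in_box T u -> F k u <= M%:E) ->
  (forall u, in_box T u -> F ^~ u @ \oo --> 0) ->
  (fun k => box_integral T (F k)) @ \oo --> 0.
Proof.
move=> T0; elim: n F M => [|n IH] F M F0 mF FM Fc /=.
  by apply: Fc => -[].
pose M' := (`|M| * T ^+ n)%R.
have FM' k s : (0 <= s <= T)%R ->
    box_integral T (fun u : 'I_n -> R => F k (fcons s u)) <= M'%:E.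
  move=> hs; rewrite -(@box_integral_cst n `|M|%R)//; apply: le_box_integral => //.
    exact: (bmeasurable_param _ (@pmeasurable_finsert _ _ ord0 (mF k))).
  move=> u hu; apply: (le_trans (FM _ _ _)); last by rewrite lee_fin ler_norm.
  exact: (@in_box_finsert _ _ _ ord0).
have [] // := @dominated_convergence _ _ R mu D mD
  (fun k s => box_integral T (fun u : 'I_n -> R => F k (fcons s u))) (cst 0) (cst M'%:E).
- by move=> k; apply: measurable_funTS; exact: (@pmeasurable_box _ _ ord0).
- apply: aeW => s sD; apply: (IH _ M) => //.
  + by move=> k; exact: (bmeasurable_param _ (@pmeasurable_finsert _ _ ord0 (mF k))).
  + by move=> k u hu; apply: FM; exact: (@in_box_finsert _ _ _ ord0).
  + by move=> u hu; apply: Fc; exact: (@in_box_finsert _ _ _ ord0).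
- apply/integrableP; split => //.
  rewrite (_ : \int[_]_(x in _) _ = `|M'|%:E * mu D); last exact: integral_cst.
  by rewrite measure_box1// -EFinM ltry.
- apply: aeW => s k sD; rewrite gee0_abs//; last exact: box_integral_ge0.
  exact: FM'.
move=> _ _; rewrite integral0_eq//.
Qed.

End box_integral_theory.

(** * The covariance density *)

Section improper_FTC.
Context (R : realType).
Notation mu := (@lebesgue_measure R).
Implicit Types f F : R -> R.

(** The integrand may blow up at both ends, where only the primitive is continuous: the usual
    theorem holds on inner intervals, and monotone convergence passes to their union. *)
Lemma ge0_FTC_open f F (a b : R) : a < b ->
  (forall x, 0 <= f x) ->
  (forall x, x \in `]a, b[ -> {for x, continuous f}) ->
  (forall x, x \in `[a, b] -> {for x, continuous F}) ->
  (forall x, x \in `]a, b[ -> is_derive x 1 F (f x)) ->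
  (\int[mu]_(x in `[a, b]) (f x)%:E = (F b - F a)%:E)%E.
Proof.
move=> ab f0 fc Fc dF.
(* The shift by 3 keeps every inner interval nondegenerate, since 3 e_k <= b - a. *)
pose e k := (b - a) / k.+3%:R.
pose I k : set R := `[a + e k, b - e k]%classic.
have e0 k : 0 < e k by rewrite divr_gt0 ?subr_gt0// ltr0n.
have e3 k : e k *+ 3 <= b - a.
  rewrite -mulr_natr /e -mulrA; apply: ler_piMr; first by rewrite subr_ge0 ltW.
  by rewrite mulrC ler_pdivrMr ?ltr0n// mul1r ler_nat.
have e3' k : a + e k < b - e k.
  by have := e3 k; have := e0 k; rewrite mulrS mulr2n; lra.
have Isub k x : x \in `[a + e k, b - e k] -> x \in `]a, b[.
  rewrite !in_itv/= => /andP[h1 h2]; have := e0 k => h3; apply/andP; split; lra.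
have ecvg : e k @[k --> \oo] --> (0 : R).
  rewrite -(mulr0 (b - a)); apply: cvgMr.
  have := @cvg_harmonic R; rewrite -(cvg_shiftn 2); apply: cvg_trans.
  by apply: near_eq_cvg; apply: nearW => k /=; rewrite addn2.
have mfo : measurable_fun `]a, b[ f.
  apply: open_continuous_measurable_fun; first exact: interval_open.
  by move=> x; rewrite inE/= => /fc.
rewrite integral_itv_bndoo; last exact/measurable_EFinP.
have IU : \bigcup_k I k = `]a, b[%classic.
  apply/seteqP; split=> [x [k _]|x].
    exact: Isub.
  rewrite /= in_itv/= => /andP[ax xb].
  have : \forall k \near \oo, e k < Num.min (x - a) (b - x).
    apply: (cvgr_lt 0) => //; by rewrite lt_min !subr_gt0 ax xb.
  move=> [k _ /(_ k (leqnn k))]/=; rewrite lt_min => /andP[h1 h2].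
  by exists k => //; rewrite /I/= in_itv/=; apply/andP; split; lra.
have mI k : measurable_fun (I k) (EFin \o f).
  apply/measurable_EFinP; apply: measurable_funS mfo => // x; exact: Isub.
have h1 : (fun k => \int[mu]_(x in I k) (f x)%:E)%E @ \oo -->
    (\int[mu]_(x in `]a, b[) (f x)%:E)%E.
  rewrite -IU; apply: ge0_nondecreasing_set_cvg_integral => //.
  - move=> k l kl; rewrite subsetEset => x; rewrite /I/= !in_itv/= => /andP[h1 h2].
    have : e l <= e k.
      rewrite /e; apply: ler_wpM2l; first by rewrite subr_ge0 ltW.
      by rewrite lef_pV2 ?posrE ?ltr0n// ler_nat.
    by move=> h3; apply/andP; split; lra.
  - by move=> k; exact: measurable_itv.
  - by move=> k x _; rewrite lee_fin.
have h2 : (fun k => \int[mu]_(x in I k) (f x)%:E)%E @ \oo --> (F b - F a)%:E.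
  have -> : (fun k => \int[mu]_(x in I k) (f x)%:E)%E =
      (fun k => (F (b - e k) - F (a + e k))%:E).
    apply/funext => k; rewrite (continuous_FTC2 (F := F) (e3' k)).
    - by rewrite EFinB.
    - apply: continuous_in_subspaceT => x /[!inE] /Isub; exact: fc.
    - have dd x : x \in `[a + e k, b - e k] -> derivable F x 1.
        by move=> /Isub /dF [].
      split.
      + by move=> x xk; apply: dd; exact: subset_itv_oo_cc xk.
      + apply: cvg_at_right_filter; apply: Fc; apply: subset_itv_oo_cc; apply: (Isub k).
        by rewrite in_itv/= lexx ltW.
      + apply: cvg_at_left_filter; apply: Fc; apply: subset_itv_oo_cc; apply: (Isub k).
        by rewrite in_itv/= lexx ltW.
    - move=> x xk; rewrite derive1E; apply: derive_val; apply: dF.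
      by apply: (Isub k); exact: subset_itv_oo_cc xk.
  apply: cvg_EFin; first by apply: nearW.
  apply: cvgB.
    apply: continuous_cvg; first by apply: Fc; rewrite in_itv/= lexx ltW.
    by rewrite -[X in _ --> X]subr0; apply: cvgB => //; exact: cvg_cst.
  apply: continuous_cvg; first by apply: Fc; rewrite in_itv/= lexx ltW.
  by rewrite -[X in _ --> X]addr0; apply: cvgD => //; exact: cvg_cst.
exact: (cvg_unique _ h1 h2).
Qed.

(** The singularity [c] may lie inside the interval, which is then cut there; the continuity of [F]
    at [c] makes the two increments add up. *)
Lemma ge0_FTC_off f F (a b c : R) : a <= b -> measurable_fun setT f ->
  (forall x, 0 <= f x) ->
  (forall x, x != c -> {for x, continuous f}) ->
  (forall x, x \in `[a, b] -> {for x, continuous F}) ->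
  (forall x, x \in `]a, b[ -> x != c -> is_derive x 1 F (f x)) ->
  (\int[mu]_(x in `[a, b]) (f x)%:E = (F b - F a)%:E)%E.
Proof.
rewrite le_eqVlt => /predU1P[<-|ab] mf f0 fc Fc dF.
  by rewrite set_itv1 integral_set1 subrr.
have [cab|cab] := boolP (c \in `]a, b[); last first.
  have nc x : x \in `]a, b[ -> x != c by apply: contraTneq => ->.
  by apply: ge0_FTC_open => // x xab; [exact/fc/nc|exact/dF/nc].
move: (cab); rewrite in_itv/= => /andP[ac cb].
have -> : `[a, b]%classic = `[a, c]%classic `|` `]c, b]%classic :> set R.
  by apply/itv_bndbnd_setU; rewrite bnd_simp ltW.
rewrite ge0_integral_setU//=; last 3 first.
- by apply/measurable_EFinP; exact: measurable_funTS.
- by move=> x _; rewrite lee_fin.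
- apply/disj_setPS => x [] /=; rewrite !in_itv/= => /andP[_ xc] /andP[cx _].
  by move: xc; rewrite leNgt cx.
rewrite integral_itv_obnd_cbnd; last by apply/measurable_EFinP; exact: measurable_funTS.
have I1 : (\int[mu]_(x in `[a, c]) (f x)%:E = (F c - F a)%:E)%E.
  apply: ge0_FTC_open => // x; rewrite in_itv/= => /andP[h1 h2].
  - by apply: fc; rewrite lt_eqF.
  - by apply: Fc; rewrite in_itv/= h1 (le_trans h2)// ltW.
  - by apply: dF; rewrite ?lt_eqF// in_itv/= h1 (lt_trans h2).
have I2 : (\int[mu]_(x in `[c, b]) (f x)%:E = (F b - F c)%:E)%E.
  apply: ge0_FTC_open => // x; rewrite in_itv/= => /andP[h1 h2].
  - by apply: fc; rewrite gt_eqF.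
  - by apply: Fc; rewrite in_itv/= h2 (le_trans _ h1)// ltW.
  - by apply: dF; rewrite ?gt_eqF// in_itv/= h2 (lt_trans _ h1).
rewrite I1 I2.
by rewrite -EFinD; congr EFin; ring.
Qed.

Lemma continuous_norm_powR_neq0 (p z : R) : z != 0 ->
  {for z, continuous (fun x => `|x| `^ p)}.
Proof.
move=> z0; have := @continuous_comp R R R (fun x : R => `|x|) (fun x : R => x `^ p) z.
apply; first exact: norm_continuous.
apply/differentiable_continuous/derivable1_diffP/derivable_powR.
by rewrite in_itv/= andbT normr_gt0.
Qed.

Lemma continuous_norm_powR (p z : R) : 0 < p ->
  {for z, continuous (fun x => `|x| `^ p)}.
Proof.
move=> p0; have [->|z0] := eqVneq z 0.
  apply/cvgrPdist_lt => e e0; near=> x.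
  rewrite normr0 powR0 ?gt_eqF// sub0r normrN ger0_norm ?powR_ge0//.
  rewrite [ltRHS](_ : e = (e `^ p^-1) `^ p); last first.
    by rewrite -powRrM mulVf ?gt_eqF// powRr1// ltW.
  apply: gt0_ltr_powR; rewrite ?nnegrE ?powR_ge0//.
  near: x; exists (e `^ p^-1); first by rewrite /= powR_gt0.
  by move=> x /=; rewrite sub0r normrN.
exact: continuous_norm_powR_neq0.
Unshelve. all: by end_near. Qed.

Lemma near_sg (z : R) : z != 0 -> \forall x \near z, Num.sg x = Num.sg z.
Proof.
move=> z0; exists `|z|; first by rewrite /= normr_gt0.
move=> x /= h; move: z0 h; rewrite neq_lt => /orP[z0|z0] h.
- by rewrite !ltr0_sg//; move: h; rewrite (ltr0_norm z0) ltr_norml => /andP[]; lra.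
- by rewrite !gtr0_sg//; move: h; rewrite (gtr0_norm z0) ltr_norml => /andP[]; lra.
Qed.

Lemma near_norm (z : R) : z != 0 -> \forall x \near z, `|x| = Num.sg z * x.
Proof. by move=> z0; near=> x; rewrite normrEsg; congr (_ * _); near: x; exact: near_sg.
Unshelve. all: by end_near. Qed.

Lemma is_derive_norm_powR (p z : R) : z != 0 ->
  is_derive z 1 (fun x => `|x| `^ p) (p * (Num.sg z * `|z| `^ (p - 1))).
Proof.
move=> z0.
apply: (@near_eq_is_derive _ _ _ (fun x => (Num.sg z * x) `^ p)).
  near=> x; congr (_ `^ p); apply/esym; near: x; exact: near_norm.
have z1 : 0 < Num.sg z * z by rewrite -normrEsg normr_gt0.
have h : is_derive z 1 (fun x => Num.sg z * x) (Num.sg z).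
  by apply: is_derive_eq; exact: mulr1.
have := is_derive1_comp (f := fun x : R => x `^ p) (is_derive1_powR p z1) h.
by rewrite -normrEsg -mulrA [_ * Num.sg z]mulrC.
Unshelve. all: by end_near. Qed.

(** The odd power function: for p > 0 a primitive of p |z|^(p-1) that is continuous across the
    singularity at 0. *)
Definition sgpow (p z : R) : R := Num.sg z * `|z| `^ p.

Lemma is_derive_sgpow (p z : R) : z != 0 ->
  is_derive z 1 (sgpow p) (p * `|z| `^ (p - 1)).
Proof.
move=> z0; apply: (@near_eq_is_derive _ _ _ (fun x => Num.sg z * `|x| `^ p)).
  near=> x; rewrite /sgpow; congr (_ * _); apply/esym; near: x; exact: near_sg.
have h := is_derive_norm_powR p z0.
have sg2 : Num.sg z * Num.sg z = 1 by rewrite -expr2 sqr_sg z0.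
apply: is_derive_eq; rewrite /GRing.scale/= -[RHS]mul1r -sg2; ring.
Unshelve. all: by end_near. Qed.

Lemma continuous_sgpow (p z : R) : 0 < p -> {for z, continuous (sgpow p)}.
Proof.
move=> p0; have [->|z0] := eqVneq z 0; last first.
  apply/differentiable_continuous/derivable1_diffP.
  by have [] := is_derive_sgpow p z0.
have h := @continuous_norm_powR p 0 p0.
apply/cvgrPdist_lt => e e0; move/cvgrPdist_lt : h => /(_ _ e0).
apply: filterS => x; rewrite /sgpow normr0 powR0 ?gt_eqF// sgr0 mul0r !sub0r !normrN.
by rewrite normrM; apply: le_lt_trans; rewrite ler_piMl//; case: sgrP; rewrite ?normr0 ?normr1 ?normrN1.
Qed.

Lemma sgpow_ge0 (p z : R) : 0 <= z -> p != 0 -> sgpow p z = z `^ p.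
Proof.
rewrite /sgpow le_eqVlt => /predU1P[<-|z0] p0; first by rewrite sgr0 mul0r powR0.
by rewrite gtr0_sg// mul1r gtr0_norm.
Qed.

Lemma sgpowN (p z : R) : sgpow p (- z) = - sgpow p z.
Proof. by rewrite /sgpow sgrN normrN mulNr. Qed.

Lemma is_derive_comp_shift (F : R -> R) (dF c x : R) :
  is_derive (x - c) 1 F dF -> is_derive x 1 (fun y => F (y - c)) dF.
Proof.
move=> h; have h1 : is_derive x 1 (fun y : R => y - c) 1.
  by apply: is_derive_eq; exact: subr0.
by have := is_derive1_comp (f := F) (g := fun y : R => y - c) h h1; rewrite mulr1.
Qed.

Lemma is_derive_comp_reflect (F : R -> R) (dF c x : R) :
  is_derive (c - x) 1 F dF -> is_derive x 1 (fun y => F (c - y)) (- dF).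
Proof.
move=> h; have h1 : is_derive x 1 (fun y : R => c - y) (- 1).
  by apply: is_derive_eq; rewrite add0r mul1r.
by have := is_derive1_comp (f := F) (g := fun y : R => c - y) h h1; rewrite mulrN1.
Qed.

Lemma continuous_comp_shift (F : R -> R) (c x : R) :
  {for x - c, continuous F} -> {for x, continuous (fun y => F (y - c))}.
Proof.
move=> h; have := @continuous_comp R R R (fun y : R => y - c) F x.
by apply => //; apply: cvgB; [exact: cvg_id|exact: cvg_cst].
Qed.

Lemma continuous_comp_reflect (F : R -> R) (c x : R) :
  {for c - x, continuous F} -> {for x, continuous (fun y => F (c - y))}.
Proof.
move=> h; have := @continuous_comp R R R (fun y : R => c - y) F x.
by apply => //; apply: cvgB; [exact: cvg_cst|exact: cvg_id].
Qed.

End improper_FTC.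

Section covariance_density.
Context (R : realType) (H : R) (hH : 1 / 2 < H < 1).
Notation mu := (@lebesgue_measure R).

(** The mixed second derivative of [fbm_cov] off the diagonal, as a function of the difference of
    its arguments. *)
Definition cov_density (z : R) : R := H * (2 * H - 1) * `|z| `^ (2 * H - 2).
Notation phi := cov_density.

Let H0 : 0 < H. Proof. by case/andP: hH; lra. Qed.
Let H1 : H < 1. Proof. by case/andP: hH; lra. Qed.
Let p0 : 0 < 2 * H - 1. Proof. by case/andP: hH; lra. Qed.

Lemma cov_density_ge0 z : 0 <= phi z.
Proof. by rewrite /phi !mulr_ge0 ?powR_ge0// ltW. Qed.

Lemma measurable_cov_density : measurable_fun setT phi.
Proof.
apply: measurable_funM; first exact: measurable_cst.
by apply: (measurableT_comp (f := fun x : R => x `^ (2 * H - 2))).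
Qed.

Lemma integral_cov_density (u s : R) : 0 <= s ->
  (\int[mu]_(v in `[0%R, s]) (phi (u - v))%:E =
   (H * (sgpow (2 * H - 1) u - sgpow (2 * H - 1) (u - s)))%:E)%E.
Proof.
move=> s0; pose F v := - H * sgpow (2 * H - 1) (u - v).
have Fder x : x != u -> is_derive x 1 F (phi (u - x)).
  move=> xu; have ux : u - x != 0 by rewrite subr_eq0 eq_sym.
  have h := is_derive_comp_reflect (is_derive_sgpow (2 * H - 1) ux).
  apply: is_derive_eq; rewrite /GRing.scale/= /phi mulrNN mulrA; congr (_ * _ `^ _); ring.
rewrite (_ : H * _ = F s - F 0); last by rewrite /F subr0; ring.
apply: (@ge0_FTC_off _ _ _ _ _ u) => //.
- apply: (measurableT_comp measurable_cov_density).
  by apply: measurable_funB => //; exact: measurable_cst.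
- by move=> v; exact: cov_density_ge0.
- move=> x xu; apply: (continuous_comp_reflect (F := phi)).
  apply: cvgM; first exact: cvg_cst.
  by apply: continuous_norm_powR_neq0; rewrite subr_eq0 eq_sym.
- move=> x _; apply: cvgM; first exact: cvg_cst.
  exact/(continuous_comp_reflect (F := sgpow (2 * H - 1)))/continuous_sgpow.
Qed.

Lemma integral2_cov_density (t s : R) : 0 <= t -> 0 <= s ->
  (\int[mu]_(u in `[0%R, t]) \int[mu]_(v in `[0%R, s]) (phi (u - v))%:E =
   (fbm_cov H t s)%:E)%E.
Proof.
move=> t0 s0.
pose F u := 2^-1 * (`|u| `^ (2 * H) - `|u - s| `^ (2 * H)).
pose f u := H * (sgpow (2 * H - 1) u - sgpow (2 * H - 1) (u - s)).
have fE u : (\int[mu]_(v in `[0%R, s]) (phi (u - v))%:E = (f u)%:E)%E.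
  exact: integral_cov_density.
under eq_integral do rewrite fE.
have fc x : {for x, continuous f}.
  apply: cvgM; first exact: cvg_cst.
  by apply: cvgB; [exact: continuous_sgpow|
    exact/(continuous_comp_shift (F := sgpow (2 * H - 1)))/continuous_sgpow].
have H20 : 0 < 2 * H by rewrite mulr_gt0.
rewrite (_ : fbm_cov H t s = F t - F 0); last first.
  rewrite /F /fbm_cov !sub0r normrN normr0 powR0 ?gt_eqF// (ger0_norm t0) (ger0_norm s0); ring.
apply: (@ge0_FTC_off _ _ _ _ _ s) => //.
- by apply: continuous_measurable_fun => x; exact: fc.
- move=> u; rewrite -lee_fin -fE; apply: integral_ge0 => v _.
  by rewrite lee_fin cov_density_ge0.
- move=> x _; apply: cvgM; first exact: cvg_cst.
  apply: cvgB; first exact: continuous_norm_powR.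
  exact/(continuous_comp_shift (F := fun x => `|x| `^ (2 * H)))/continuous_norm_powR.
move=> x; rewrite in_itv/= => /andP[x0 _] xs.
have h1 := is_derive_norm_powR (2 * H) (lt0r_neq0 x0).
have xs0 : x - s != 0 by rewrite subr_eq0.
have h2 := is_derive_comp_shift (is_derive_norm_powR (2 * H) xs0).
apply: is_derive_eq; rewrite /GRing.scale/= /f /sgpow; by field.
Qed.

Lemma integral_cov_density_le (T u : R) : 0 <= u <= T ->
  (\int[mu]_(v in `[0%R, T]) (phi (u - v))%:E <= (2 * H * T `^ (2 * H - 1))%:E)%E.
Proof.
move=> /andP[u0 uT]; have T0 := le_trans u0 uT.
rewrite integral_cov_density// lee_fin.
have -> : 2 * H * T `^ (2 * H - 1) =
    H * (T `^ (2 * H - 1) + T `^ (2 * H - 1)) by ring.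
apply: ler_wpM2l; first exact: ltW.
rewrite -sgpowN opprB.
have hp z : 0 <= z <= T -> sgpow (2 * H - 1) z <= T `^ (2 * H - 1).
  move=> /andP[z0 zT]; rewrite sgpow_ge0 ?gt_eqF//.
  by rewrite ge0_ler_powR ?nnegrE// ltW.
by apply: lerD; apply: hp; rewrite ?u0// subr_ge0 uT lerBlDr lerDl.
Qed.

Lemma cov_density_ge (T z : R) : z != 0 -> `|z| <= T ->
  phi T <= phi z.
Proof.
move=> z0 zT; rewrite /phi; apply: ler_wpM2l; first by rewrite mulr_ge0// ltW.
have z1 : 0 < `|z| by rewrite normr_gt0.
have T0 : 0 < T by exact: lt_le_trans zT.
rewrite (gtr0_norm T0).
have -> : 2 * H - 2 = - (2 - 2 * H) by ring.
rewrite !powRN lef_pV2 ?posrE ?powR_gt0//.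
by apply: ge0_ler_powR; rewrite ?nnegrE// ?(ltW T0)//; have := H1; lra.
Qed.

End covariance_density.

(** * Energies of functions on the box *)

Section product_integrals.
Context (R : realType) (T : R).
Notation mu := (@lebesgue_measure R).
Notation D := ([set` `[0%R, T]] : set R).

Definition rmeasurable n (f : ('I_n -> R) -> R) : Prop :=
  forall d (Y : measurableType d) (g : Y -> 'I_n -> R),
    (forall i, measurable_fun setT (g ^~ i)) ->
    measurable_fun setT (fun y => f (g y)).

Lemma measurable_indic_itv d (Y : measurableType d) (a g : Y -> R) :
  measurable_fun setT a -> measurable_fun setT g ->
  measurable_fun setT (fun y => \1_(`[0, a y]%classic : set R) (g y) : R).
Proof.
move=> ma mg.
pose A := [set y : Y | 0 <= g y] `&` [set y | g y <= a y].
rewrite [X in measurable_fun _ X](_ : _ = \1_A).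
  apply: measurable_indic; rewrite -[A]setTI; apply: measurableI => //.
  rewrite /A; apply: measurableI.
    rewrite -[X in measurable X]setTI.
    by apply: (measurable_fun_le (f := cst 0)).
  rewrite -[X in measurable X]setTI.
  exact: measurable_fun_le.
apply/funext => y; rewrite !indicE; congr (_ _)%:R.
apply/idP/idP; rewrite !inE /A /= in_itv/=; first by move=> /andP[].
by case=> -> ->.
Qed.

Lemma indic_itv_ge0 (a x : R) : 0 <= (\1_(`[0, a]%classic : set R) x : R).
Proof. by rewrite indicE. Qed.

Lemma box_integral2_finsert n (i j : 'I_n.+1)
    (F : ('I_n.+1 -> R) -> ('I_n.+1 -> R) -> \bar R) :
  (forall u v, 0 <= F u v)%E -> bmeasurable2 F ->
  (box_integral T (fun u => box_integral T (F u)) =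
  \int[mu]_(s in D) \int[mu]_(s' in D) box_integral T (fun u =>
    box_integral T (fun v => F (finsert i s u) (finsert j s' v))))%E.
Proof.
move=> F0 mF.
rewrite (box_integral_finsert _ i)//; last 2 first.
- by move=> u; exact: box_integral_ge0.
- exact: bmeasurable2_box.
apply: eq_integral => s _.
rewrite -(box_integral_integral T (F := fun s' u => box_integral T
    (fun v => F (finsert i s u) (finsert j s' v))))//; last 2 first.
- by move=> s' u; exact: box_integral_ge0.
- move=> d Y h g mh mg; apply: (measurable_box_integral T
    (F := fun y v => F (finsert i s (g y)) (finsert j (h y) v))) => //.
  move=> d' Y' h' g' mh' mg'; apply: mF.
    apply: measurable_finsert => // k.
    exact: (measurableT_comp (f := fun y => g y k) (g := h')).
  by apply: measurable_finsert => //; exact: measurableT_comp.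
apply: eq_box_integral => u _; apply: box_integral_finsert => //.
by move=> d Y g mg; apply: mF.
Qed.

(** The integrand couples u_i with v_i only, so the first coordinates of u and v are pulled out
    together and the double integral factorizes. *)
Lemma box_integral2_prod n (h : 'I_n -> R -> R -> R) (r : 'I_n -> R) :
  (forall i s t, 0 <= h i s t) ->
  (forall i, measurable_fun setT (fun z : R * R => h i z.1 z.2)) ->
  (forall i, \int[mu]_(s in D) \int[mu]_(t in D) (h i s t)%:E = (r i)%:E)%E ->
  box_integral T (fun u => box_integral T (fun v =>
    (\prod_(i < n) h i (u i) (v i))%:E)) = (\prod_(i < n) r i)%:E.
Proof.
elim: n h r => [|n IH] h r h0 mh hr.
  by rewrite /= !big_ord0.
have mprod m (f : 'I_m -> 'I_n.+1) : bmeasurable2 (fun u v : 'I_m -> R =>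
    (\prod_(i < m) h (f i) (u i) (v i))%:E).
  move=> d Y g g' mg mg'; apply/measurable_EFinP.
  apply: measurable_prod => i _.
  exact: (measurableT_comp (mh (f i)) (measurable_fun_pair (mg i) (mg' i))).
rewrite (box_integral2_finsert ord0 ord0); last 2 first.
- by move=> u v; rewrite lee_fin prodr_ge0.
- exact: (mprod n.+1 id).
rewrite big_ord_recl EFinM -hr [RHS]muleC.
have r0 : 0 <= \prod_(i < n) r (lift ord0 i).
  apply: prodr_ge0 => i _; rewrite -lee_fin -hr.
  by apply: integral_ge0 => s _; apply: integral_ge0 => t _; rewrite lee_fin.
rewrite -ge0_integralZl_EFin//; last 2 first.
- by move=> s _; apply: integral_ge0 => t _; rewrite lee_fin.
- apply: measurable_funTS; apply: measurable_integral_param => //.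
    by apply/measurable_EFinP; exact: mh.
  by move=> s t; rewrite lee_fin.
apply: eq_integral => s _.
rewrite -ge0_integralZl_EFin//; last 2 first.
- by move=> t _; rewrite lee_fin.
- apply: measurable_funTS; apply/measurable_EFinP.
  exact: (measurableT_comp (mh ord0) (measurable_fun_pair (measurable_cst s) (@measurable_id _ _ setT))).
apply: eq_integral => t _.
rewrite -(IH (fun i => h (lift ord0 i)) (fun i => r (lift ord0 i)))// muleC.
have mp := mprod n (lift ord0).
rewrite -box_integralZl//; last 2 first.
- by move=> u; apply: box_integral_ge0 => v; rewrite lee_fin prodr_ge0.
- by apply: bmeasurable2_box => // u v; rewrite lee_fin prodr_ge0.
apply: eq_box_integral => u _; rewrite -box_integralZl//; last 2 first.
- by move=> v; rewrite lee_fin prodr_ge0.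
- by move=> d Y g mg; apply: mp.
apply: eq_box_integral => v _; rewrite -EFinM big_ord_recl; congr (_ * _)%:E.
  by rewrite !finsertE.
by apply: eq_bigr => i _; rewrite !finsert_lift.
Qed.

End product_integrals.

Section abs_inner_product.
Context (R : realType) (H T : R) (hH : 1 / 2 < H < 1) (hT : 0 < T).
Notation mu := (@lebesgue_measure R).
Notation D := ([set` `[0%R, T]] : set R).

(** The same expression as the product in [abs_norm2], so that [abs_ip H T f f] is convertible to
    [abs_norm2 H T f]. *)
Definition weight n (u v : 'I_n -> R) : R :=
  \prod_(i < n) (H * (2 * H - 1) * `|u i - v i| `^ (2 * H - 2)).

Lemma weight_ge0 n (u v : 'I_n -> R) : 0 <= weight u v.
Proof. by apply: prodr_ge0 => i _; exact: (cov_density_ge0 hH). Qed.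

Lemma measurable_weight n d (Y : measurableType d) (g h : Y -> 'I_n -> R) :
  (forall i, measurable_fun setT (g ^~ i)) ->
  (forall i, measurable_fun setT (h ^~ i)) ->
  measurable_fun setT (fun y => weight (g y) (h y)).
Proof.
move=> mg mh; apply: measurable_prod => i _.
apply: (measurableT_comp (measurable_cov_density H)).
exact: measurable_funB.
Qed.

(* The absolute values make it dominate [step_ip] on step functions. *)
Definition abs_ip n (f g : ('I_n -> R) -> R) : \bar R :=
  box_integral T (fun u => box_integral T (fun v =>
    (`|f u| * `|g v| * weight u v)%:E)).

(** Intermediate between the convergence given by [represents] and the bounds on cross terms,
    through [abs_l1_sq] and [abs_ip_bounded]. *)
Definition abs_l1 n (f : ('I_n -> R) -> R) : \bar R :=
  box_integral T (fun u => `|f u|%:E).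

Implicit Types n : nat.

Lemma rmeasurable_abs n (f : ('I_n -> R) -> R) :
  rmeasurable f -> rmeasurable (fun u => `|f u|).
Proof. by move=> mf d Y g mg; apply: measurableT_comp => //; exact: mf. Qed.

Lemma rmeasurableB n (f g : ('I_n -> R) -> R) :
  rmeasurable f -> rmeasurable g -> rmeasurable (fun u => f u - g u).
Proof. by move=> mf mg d Y h mh; apply: measurable_funB; [exact: mf|exact: mg]. Qed.

Lemma bmeasurable_abs n (f : ('I_n -> R) -> R) :
  rmeasurable f -> bmeasurable (fun u => `|f u|%:E).
Proof. by move=> mf d Y g mg; apply/measurable_EFinP; exact: (rmeasurable_abs mf). Qed.

Lemma bmeasurable2_abs_ip n (f g : ('I_n -> R) -> R) :
  rmeasurable f -> rmeasurable g ->
  bmeasurable2 (fun u v => (`|f u| * `|g v| * weight u v)%:E).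
Proof.
move=> mf mg d Y h k mh mk; apply/measurable_EFinP; apply: measurable_funM.
  by apply: measurable_funM; [exact: (rmeasurable_abs mf)|exact: (rmeasurable_abs mg)].
exact: measurable_weight.
Qed.

Lemma abs_ip_integrand_ge0 n (f g : ('I_n -> R) -> R) u v :
  (0 <= (`|f u| * `|g v| * weight u v)%:E)%E.
Proof. by rewrite lee_fin !mulr_ge0// weight_ge0. Qed.

Hint Resolve abs_ip_integrand_ge0 : core.

Lemma abs_ip_ge0 n (f g : ('I_n -> R) -> R) : (0 <= abs_ip f g)%E.
Proof. by apply: box_integral_ge0 => u; exact: box_integral_ge0. Qed.

Lemma abs_l1_ge0 n (f : ('I_n -> R) -> R) : (0 <= abs_l1 f)%E.
Proof. by apply: box_integral_ge0 => u; rewrite lee_fin. Qed.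

Lemma bmeasurable2_fix n m (F : ('I_n -> R) -> ('I_m -> R) -> \bar R) u :
  bmeasurable2 F -> bmeasurable (F u).
Proof. by move=> mF d Y g mg; apply: mF. Qed.

Lemma le_box_integral2 n m (F G : ('I_n -> R) -> ('I_m -> R) -> \bar R) :
  (forall u v, 0 <= F u v)%E -> (forall u v, 0 <= G u v)%E ->
  bmeasurable2 F -> bmeasurable2 G ->
  (forall u v, in_box T u -> in_box T v -> (F u v <= G u v)%E) ->
  (box_integral T (fun u => box_integral T (F u)) <=
   box_integral T (fun u => box_integral T (G u)))%E.
Proof.
move=> F0 G0 mF mG FG; apply: le_box_integral.
- by move=> u; exact: box_integral_ge0.
- by move=> u; exact: box_integral_ge0.
- exact: bmeasurable2_box.
- exact: bmeasurable2_box.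
move=> u hu; apply: le_box_integral => //.
- exact: bmeasurable2_fix.
- exact: bmeasurable2_fix.
by move=> v hv; exact: FG.
Qed.

Lemma box_integral2D n m (F G : ('I_n -> R) -> ('I_m -> R) -> \bar R) :
  (forall u v, 0 <= F u v)%E -> (forall u v, 0 <= G u v)%E ->
  bmeasurable2 F -> bmeasurable2 G ->
  (box_integral T (fun u => box_integral T (fun v => F u v + G u v)) =
   box_integral T (fun u => box_integral T (F u)) +
   box_integral T (fun u => box_integral T (G u)))%E.
Proof.
move=> F0 G0 mF mG; rewrite -box_integralD//.
- apply: eq_box_integral => u _; rewrite box_integralD//; exact: bmeasurable2_fix.
- by move=> u; exact: box_integral_ge0.
- by move=> u; exact: box_integral_ge0.
- exact: bmeasurable2_box.
- exact: bmeasurable2_box.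
Qed.

Lemma box_integral2Zl n m (k : R) (F : ('I_n -> R) -> ('I_m -> R) -> \bar R) :
  0 <= k -> (forall u v, 0 <= F u v)%E -> bmeasurable2 F ->
  (box_integral T (fun u => box_integral T (fun v => k%:E * F u v)) =
   k%:E * box_integral T (fun u => box_integral T (F u)))%E.
Proof.
move=> k0 F0 mF; rewrite -box_integralZl//.
- apply: eq_box_integral => u _; rewrite box_integralZl//; exact: bmeasurable2_fix.
- by move=> u; exact: box_integral_ge0.
- exact: bmeasurable2_box.
Qed.

Lemma bmeasurable2_sum n m I (r : seq I)
    (F : I -> ('I_n -> R) -> ('I_m -> R) -> \bar R) :
  (forall i, bmeasurable2 (F i)) ->
  bmeasurable2 (fun u v => \sum_(i <- r) F i u v)%E.
Proof. by move=> mF d Y g h mg mh; apply: emeasurable_sum => i; exact: mF. Qed.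

Lemma box_integral2_sum n m I (r : seq I)
    (F : I -> ('I_n -> R) -> ('I_m -> R) -> \bar R) :
  (forall i u v, 0 <= F i u v)%E -> (forall i, bmeasurable2 (F i)) ->
  (box_integral T (fun u => box_integral T (fun v => \sum_(i <- r) F i u v)) =
   \sum_(i <- r) box_integral T (fun u => box_integral T (F i u)))%E.
Proof.
move=> F0 mF; rewrite -box_integral_sum//.
- apply: eq_box_integral => u _; rewrite box_integral_sum// => i; exact: bmeasurable2_fix.
- by move=> i u; exact: box_integral_ge0.
- by move=> i; exact: bmeasurable2_box.
Qed.

Lemma abs_ipC n (f g : ('I_n -> R) -> R) : rmeasurable f -> rmeasurable g ->
  abs_ip f g = abs_ip g f.
Proof.
move=> mf mg; rewrite /abs_ip box_integral_swap//; last exact: bmeasurable2_abs_ip.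
apply: eq_box_integral => v _; apply: eq_box_integral => u _.
congr EFin; rewrite [`|f u| * _]mulrC; congr (_ * _).
by apply: eq_bigr => i _; rewrite distrC.
Qed.

Lemma abs_ip_leD n (f f1 f2 g : ('I_n -> R) -> R) :
  rmeasurable f -> rmeasurable f1 -> rmeasurable f2 -> rmeasurable g ->
  (forall u, in_box T u -> `|f u| <= `|f1 u| + `|f2 u|) ->
  (abs_ip f g <= abs_ip f1 g + abs_ip f2 g)%E.
Proof.
move=> mf mf1 mf2 mg hf; rewrite /abs_ip -box_integral2D//; try exact: bmeasurable2_abs_ip.
apply: le_box_integral2 => //.
- by move=> u v; apply: adde_ge0.
- exact: bmeasurable2_abs_ip.
- move=> d Y h k mh mk; apply: emeasurable_funD; exact: bmeasurable2_abs_ip.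
move=> u v hu hv; rewrite -EFinD lee_fin -mulrDl -mulrDl.
by rewrite ler_wpM2r ?weight_ge0// ler_wpM2r// hf.
Qed.

(** A bilinear expansion that keeps the cross terms: with one bounded factor they are small as soon
    as the other is small in L^1. *)
Lemma abs_norm2_leD n (f f1 f2 : ('I_n -> R) -> R) :
  rmeasurable f -> rmeasurable f1 -> rmeasurable f2 ->
  (forall u, in_box T u -> `|f u| <= `|f1 u| + `|f2 u|) ->
  (abs_ip f f <= abs_ip f1 f1 + abs_ip f2 f1 + (abs_ip f2 f1 + abs_ip f2 f2))%E.
Proof.
move=> mf mf1 mf2 hf; apply: (le_trans (abs_ip_leD mf mf1 mf2 mf hf)).
apply: leeD.
  by rewrite (abs_ipC mf1)//; exact: abs_ip_leD.
by rewrite (abs_ipC mf2 mf) (abs_ipC mf2 mf1); exact: abs_ip_leD.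
Qed.

Lemma abs_l1_leD n (f f1 f2 : ('I_n -> R) -> R) :
  rmeasurable f -> rmeasurable f1 -> rmeasurable f2 ->
  (forall u, in_box T u -> `|f u| <= `|f1 u| + `|f2 u|) ->
  (abs_l1 f <= abs_l1 f1 + abs_l1 f2)%E.
Proof.
move=> mf mf1 mf2 hf; rewrite /abs_l1 -box_integralD//; try exact: bmeasurable_abs.
apply: le_box_integral => //.
- by move=> u; apply: adde_ge0; rewrite lee_fin.
- exact: bmeasurable_abs.
- move=> d Y h mh; apply: emeasurable_funD; exact: bmeasurable_abs.
Qed.

Definition density_bound : R := 2 * H * T `^ (2 * H - 1).

Lemma density_bound_ge0 : 0 <= density_bound.
Proof. by rewrite /density_bound !mulr_ge0// ?powR_ge0//; case/andP: hH; lra. Qed.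

Lemma box_integral_weight n (u : 'I_n -> R) : in_box T u ->
  (box_integral T (fun v => (weight u v)%:E) <= (density_bound ^+ n)%:E)%E.
Proof.
elim: n u => [|n IH] u hu /=.
  by rewrite /weight big_ord0 expr0.
have h0 : (0 <= u ord0 <= T) by exact: hu.
apply: (@le_trans _ _ (\int[mu]_(s in D)
   ((density_bound ^+ n)%:E * (cov_density H (u ord0 - s))%:E))%E).
  apply: ge0_le_integral => //.
  - by move=> s _; apply: box_integral_ge0 => v; rewrite lee_fin weight_ge0.
  - apply: measurable_funTS; apply: (measurable_box_integral T
      (F := fun s v => (weight u (fcons s v))%:E)).
      by move=> s v; rewrite lee_fin weight_ge0.
    move=> d Y h g mh mg; apply/measurable_EFinP; apply: measurable_weight.
      by move=> i; exact: measurable_cst.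
    exact: (@measurable_finsert _ _ _ _ ord0).
  - apply: measurable_funTS; apply/measurable_EFinP; apply: measurable_funM => //.
    apply: (measurableT_comp (measurable_cov_density H)).
    by apply: measurable_funB.
  move=> s sD; rewrite muleC.
  have -> : box_integral T (fun v : 'I_n -> R => (weight u (fcons s v))%:E) =
     ((cov_density H (u ord0 - s))%:E * box_integral T
        (fun v => (weight (fun i => u (lift ord0 i)) v)%:E))%E.
    rewrite -box_integralZl ?(cov_density_ge0 hH)//; last 2 first.
    - by move=> v; rewrite lee_fin weight_ge0.
    - move=> d Y g mg; apply/measurable_EFinP; apply: measurable_weight => //.
    apply: eq_box_integral => v _; rewrite -EFinM /weight big_ord_recl.
    rewrite /fcons unlift_none; congr (_ * _)%:E.
    by apply: eq_bigr => i _; rewrite liftK.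
  by apply: lee_wpmul2l; rewrite ?lee_fin ?(cov_density_ge0 hH)//; apply: IH => i; exact: hu.
rewrite ge0_integralZl_EFin ?exprn_ge0 ?density_bound_ge0//; last 2 first.
- by move=> s _; rewrite lee_fin (cov_density_ge0 hH).
- apply: measurable_funTS; apply/measurable_EFinP.
  apply: (measurableT_comp (measurable_cov_density H)).
  by apply: measurable_funB.
rewrite exprSr EFinM; apply: lee_wpmul2l.
  by rewrite lee_fin exprn_ge0// density_bound_ge0.
exact: integral_cov_density_le.
Qed.

(** For fixed u, the integral of the weight over v is at most [density_bound ^+ n], uniformly in u;
    the bound on [g] is taken out before. *)
Lemma abs_ip_bounded n (f g : ('I_n -> R) -> R) (M : R) : 0 <= M ->
  rmeasurable f -> rmeasurable g -> (forall v, in_box T v -> `|g v| <= M) ->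
  (abs_ip f g <= (M * density_bound ^+ n)%:E * abs_l1 f)%E.
Proof.
move=> M0 mf mg gM.
have K0 : 0 <= M * density_bound ^+ n.
  by rewrite mulr_ge0// exprn_ge0// density_bound_ge0.
rewrite /abs_l1 -box_integralZl//; last exact: bmeasurable_abs.
apply: le_box_integral.
- by move=> u; exact: box_integral_ge0.
- by move=> u; rewrite -EFinM lee_fin mulr_ge0.
- by apply: bmeasurable2_box => //; exact: bmeasurable2_abs_ip.
- by move=> d Y h mh; apply: measurable_funeM; exact: (bmeasurable_abs mf).
  move=> u hu.
  apply: (@le_trans _ _ (box_integral T (fun v => (`|f u| * M)%:E * (weight u v)%:E)))%E.
    apply: le_box_integral => //.
    * by move=> v; rewrite -EFinM lee_fin mulr_ge0// ?mulr_ge0// weight_ge0.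
    * exact: (bmeasurable2_fix u (bmeasurable2_abs_ip mf mg)).
    * move=> d Y h mh; apply: measurable_funeM; apply/measurable_EFinP.
      by apply: measurable_weight => // i; exact: measurable_cst.
    by move=> v hv; rewrite -EFinM lee_fin ler_wpM2r ?weight_ge0// ler_wpM2l// gM.
  rewrite box_integralZl ?mulr_ge0//; last 2 first.
  + by move=> v; rewrite lee_fin weight_ge0.
  + move=> d Y h mh; apply/measurable_EFinP.
    by apply: measurable_weight => // i; exact: measurable_cst.
  rewrite -EFinM (_ : _ * _ * `|f u| = `|f u| * M * density_bound ^+ n); last by ring.
  rewrite [leRHS]EFinM; apply: lee_wpmul2l; last exact: box_integral_weight.
  by rewrite lee_fin mulr_ge0.
Qed.

Lemma density_lower_gt0 : 0 < cov_density H T.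
Proof.
rewrite /cov_density gtr0_norm// mulr_gt0 ?powR_gt0//.
by case/andP: hH => h1 h2; rewrite mulr_gt0//; lra.
Qed.

Lemma weight_ge n (u v : 'I_n -> R) : in_box T u -> in_box T v ->
  (forall i, v i != u i) -> cov_density H T ^+ n <= weight u v.
Proof.
move=> hu hv uv; rewrite -[n in _ ^+ n]card_ord -prodr_const.
apply: ler_prod => i _; rewrite (ltW density_lower_gt0)/=.
apply: (cov_density_ge hH); first by rewrite subr_eq0 eq_sym uv.
have /andP[u0 uT] := hu i; have /andP[v0 vT] := hv i.
by rewrite ler_norml; apply/andP; split; lra.
Qed.

(** Off the diagonal each density is at least its value at distance T, the largest distance in the
    box. *)
Lemma abs_l1_sq n (f : ('I_n -> R) -> R) : rmeasurable f ->
  ((cov_density H T ^+ n)%:E * (abs_l1 f * abs_l1 f) <= abs_ip f f)%E.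
Proof.
move=> mf; set c := _ ^+ n.
have c0 : 0 <= c by rewrite exprn_ge0// ltW// density_lower_gt0.
pose F (u v : 'I_n -> R) := (c * (`|f u| * `|f v|))%:E.
have mF : bmeasurable2 F.
  move=> d Y g h mg mh; apply/measurable_EFinP; apply: measurable_funM => //.
  by apply: measurable_funM; exact: (rmeasurable_abs mf).
have F0 u v : (0 <= F u v)%E by rewrite lee_fin !mulr_ge0.
apply: (@le_trans _ _ (box_integral T (fun u => box_integral T (F u)))).
  have k0 : (0 <= c%:E * abs_l1 f)%E by rewrite mule_ge0 ?abs_l1_ge0// lee_fin.
  rewrite muleA -[X in (_ * X)%E]/(box_integral T _) -box_integralZe//.
  - rewrite le_eqVlt; apply/orP; left; apply/eqP; apply: eq_box_integral => u _.
    rewrite muleAC -EFinM -box_integralZl ?mulr_ge0//; last exact: bmeasurable_abs.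
    by apply: eq_box_integral => v _; rewrite /F -EFinM mulrA.
  - exact: bmeasurable_abs.
apply: le_box_integral => //.
- by move=> u; exact: box_integral_ge0.
- by move=> u; exact: box_integral_ge0.
- exact: bmeasurable2_box.
- by apply: bmeasurable2_box => //; exact: bmeasurable2_abs_ip.
move=> u hu; apply: (le_box_integral_off (c := u)) => //.
- exact: bmeasurable2_fix.
- exact: (bmeasurable2_fix u (bmeasurable2_abs_ip mf mf)).
move=> v hv vu; rewrite lee_fin /F mulrC ler_wpM2l ?mulr_ge0//.
exact: weight_ge.
Qed.

End abs_inner_product.

(** * Step functions *)

Section step_functions.
Context (R : realType).
Implicit Types (H T : R) (n : nat).

Definition boxed T n (g : step R n) : Prop :=
  forall i, (i < size g)%N -> in_box T (nth (0, fun=> 0) g i).2.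

Lemma boxed_cat T n (g h : step R n) : boxed T g -> boxed T h -> boxed T (g ++ h).
Proof.
move=> bg bh i; rewrite size_cat nth_cat => ih.
by case: ltnP => gi; [exact: bg|apply: bh; rewrite ltn_subLR].
Qed.

Lemma boxed_sub T n (g h : step R n) :
  boxed T g -> boxed T h -> boxed T (step_sub g h).
Proof.
move=> bg bh; apply: boxed_cat => // i; rewrite size_map => ih.
by rewrite (nth_map (0, fun=> 0))//=; exact: bh.
Qed.

Lemma boxed_perm T n s (g : step R n) : boxed T g -> boxed T (step_perm s g).
Proof.
move=> bg i; rewrite size_map => ih k.
by rewrite (nth_map (0, fun=> 0))//=; exact: bg.
Qed.

Lemma step_fun_cat n (g h : step R n) u :
  step_fun (g ++ h) u = step_fun g u + step_fun h u.
Proof. by rewrite /step_fun big_cat. Qed.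

Lemma step_fun_sub n (g h : step R n) u :
  step_fun (step_sub g h) u = step_fun g u - step_fun h u.
Proof.
rewrite step_fun_cat; congr (_ + _); rewrite /step_fun big_map.
by rewrite -sumrN; apply: eq_bigr => c _; rewrite mulNr.
Qed.

Lemma step_fun_perm n s (g : step R n) u :
  step_fun (step_perm s g) u = step_fun g (fun i => u ((s^-1)%g i)).
Proof.
rewrite /step_fun big_map; apply: eq_bigr => c _; congr (_ * _).
by rewrite [RHS](reindex_inj (@perm_inj _ s))/=; apply: eq_bigr => i _; rewrite permK.
Qed.

Lemma rmeasurable_step_fun n (g : step R n) : rmeasurable (step_fun g).
Proof.
move=> d Y h mh; apply: measurable_sum => c; apply: measurable_funM => //.
by apply: measurable_prod => i _; apply: measurableT_comp => //; exact: measurable_indic.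
Qed.

Lemma step_fun_bounded n (g : step R n) :
  exists2 M, 0 <= M & forall u, `|step_fun g u| <= M.
Proof.
exists (\sum_(c <- g) `|c.1|); first exact: sumr_ge0.
move=> u; apply: (le_trans (ler_norm_sum _ _ _)); apply: ler_sum => c _.
rewrite normrM ler_piMr// normr_prod; apply: prodr_ile1 => i _.
by rewrite normr_ge0/= indicE; case: (_ \in _); rewrite ?normr0 ?normr1 ?ler01.
Qed.

Lemma step_ipC H n (g h : step R n) : step_ip H g h = step_ip H h g.
Proof.
rewrite /step_ip exchange_big; apply: eq_bigr => c _; apply: eq_bigr => e _.
rewrite [e.1 * _]mulrC; congr (_ * _); apply: eq_bigr => i _.
by rewrite /fbm_cov distrC [_ `^ _ + _]addrC.
Qed.

Lemma step_ip_subl H n (g h k : step R n) :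
  step_ip H (step_sub g h) k = step_ip H g k - step_ip H h k.
Proof.
rewrite /step_ip big_cat /= big_map; congr (_ + _).
rewrite -sumrN; apply: eq_bigr => c _; rewrite -sumrN; apply: eq_bigr => e _.
by rewrite /= !mulNr.
Qed.

Lemma step_ip_subr H n (g h k : step R n) :
  step_ip H k (step_sub g h) = step_ip H k g - step_ip H k h.
Proof. by rewrite step_ipC step_ip_subl !(step_ipC _ k). Qed.

Lemma step_ip_perm H n s (g h : step R n) :
  step_ip H (step_perm s g) (step_perm s h) = step_ip H g h.
Proof.
rewrite /step_ip big_map; apply: eq_bigr => c _; rewrite big_map.
apply: eq_bigr => e _; congr (_ * _) => /=.
by rewrite [RHS](reindex_inj (@perm_inj _ s)).
Qed.

End step_functions.

(** * Scalar products of step functions as integrals against the density *)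

Section step_ip_domination.
Context (R : realType) (H T : R) (hH : 1 / 2 < H < 1).
Notation mu := (@lebesgue_measure R).
Notation D := ([set` `[0%R, T]] : set R).

Definition ind (a x : R) : R := \1_(`[0, a]%classic : set R) x.

Lemma measurable_ind a : measurable_fun setT (ind a).
Proof. by apply: measurable_indic; exact: measurable_itv. Qed.

Lemma integral_cov_indicator (t s : R) : 0 <= t <= T -> 0 <= s <= T ->
  (\int[mu]_(u in D) \int[mu]_(v in D)
     (ind t u * ind s v * cov_density H (u - v))%:E = (fbm_cov H t s)%:E)%E.
Proof.
move=> /andP[t0 tT] /andP[s0 sT].
have restr a (f : R -> \bar R) : 0 <= a <= T ->
    (\int[mu]_(u in D) ((ind a u)%:E * f u) = \int[mu]_(u in `[0%R, a]) f u)%E.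
  move=> /andP[a0 aT].
  have -> : `[0, a]%classic = D `&` `[0, a]%classic :> set R.
    apply/seteqP; split=> x /=; rewrite !in_itv/=; last by case.
    by move=> /andP[x0 xa]; rewrite x0 xa (le_trans xa).
  rewrite integral_mkcondr; apply: eq_integral => x _.
  rewrite /ind indicE /patch; case: (x \in _); first by rewrite mul1e.
  by rewrite mul0e.
transitivity (\int[mu]_(u in D) ((ind t u)%:E *
    \int[mu]_(v in `[0%R, s]) (cov_density H (u - v))%:E))%E; last first.
  by rewrite restr ?t0// (integral2_cov_density hH).
apply: eq_integral => u _; rewrite -(restr s) ?s0//.
rewrite -ge0_integralZl_EFin ?indic_itv_ge0//; last 2 first.
- by move=> v _; rewrite -EFinM lee_fin mulr_ge0 ?indic_itv_ge0 ?(cov_density_ge0 hH).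
- apply: measurable_funTS; apply: emeasurable_funM; apply/measurable_EFinP.
    exact: measurable_indic.
  apply: (measurableT_comp (measurable_cov_density H)).
  by apply: measurable_funB.
by apply: eq_integral => v _; rewrite -!EFinM mulrA.
Qed.

Lemma box_integral_cov_sum n (I : finType) (k : I -> R) (t s : I -> 'I_n -> R) :
  (forall p, 0 <= k p) -> (forall p, in_box T (t p)) -> (forall p, in_box T (s p)) ->
  box_integral T (fun u => box_integral T (fun v =>
    (\sum_p k p * ((\prod_(i < n) ind (t p i) (u i)) *
       (\prod_(i < n) ind (s p i) (v i)) * weight H u v))%:E)) =
  (\sum_p k p * \prod_(i < n) fbm_cov H (t p i) (s p i))%:E.
Proof.
move=> k0 ht hs.
pose h p i (x y : R) := ind (t p i) x * ind (s p i) y * cov_density H (x - y).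
have h0 p i x y : 0 <= h p i x y.
  apply: mulr_ge0; last exact: cov_density_ge0.
  by apply: mulr_ge0; exact: indic_itv_ge0.
have mh p i : measurable_fun setT (fun z : R * R => h p i z.1 z.2).
  apply: measurable_funM.
    by apply: measurable_funM; [exact: (measurableT_comp (measurable_ind _) measurable_fst)|
      exact: (measurableT_comp (measurable_ind _) measurable_snd)].
  apply: (measurableT_comp (measurable_cov_density H)).
  by apply: measurable_funB.
have mF p : bmeasurable2 (fun u v : 'I_n -> R => (\prod_(i < n) h p i (u i) (v i))%:E).
  move=> d Y g g' mg mg'; apply/measurable_EFinP.
  apply: measurable_prod => i _.
  exact: (measurableT_comp (mh p i) (measurable_fun_pair (mg i) (mg' i))).
have F0 p (u v : 'I_n -> R) : (0 <= (\prod_(i < n) h p i (u i) (v i))%:E)%E.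
  by rewrite lee_fin prodr_ge0.
transitivity (box_integral T (fun u => box_integral T (fun v =>
    \sum_p (k p)%:E * (\prod_(i < n) h p i (u i) (v i))%:E)))%E.
  apply: eq_box_integral => u _; apply: eq_box_integral => v _.
  rewrite -sumEFin; apply: eq_bigr => p _; rewrite -EFinM; congr (_ * _)%:E.
  by rewrite /weight -!big_split.
rewrite box_integral2_sum; last 2 first.
- by move=> p u v; rewrite mule_ge0// lee_fin.
- by move=> p d Y g g' mg mg'; apply: measurable_funeM; exact: mF.
rewrite -sumEFin; apply: eq_bigr => p _.
rewrite box_integral2Zl// EFinM; congr (_ * _)%E.
apply: box_integral2_prod => // i.
by apply: integral_cov_indicator; [exact: ht|exact: hs].
Qed.

Lemma step_ip_le n (g h : step R n) : boxed T g -> boxed T h ->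
  ((step_ip H g h)%:E <= abs_ip H T (step_fun g) (step_fun h))%E.
Proof.
move=> bg bh.
pose z : R * ('I_n -> R) := (0, fun=> 0).
pose I := ('I_(size g) * 'I_(size h))%type.
pose a (p : I) := (nth z g p.1).1 * (nth z h p.2).1.
pose t (p : I) := (nth z g p.1).2; pose s (p : I) := (nth z h p.2).2.
have ht p : in_box T (t p) by exact: bg.
have hs p : in_box T (s p) by exact: bh.
(* The iterated integral is additive on nonnegative integrands only. The positive and negative parts
   of the coefficients are integrated separately, and the inequality is proved with the negative
   part moved to the right. *)
pose kp p := Num.max (a p) 0; pose kn p := Num.max (- a p) 0.
have kpE p : a p = kp p - kn p.
  by rewrite /kp /kn; case: (leP (a p) 0); case: (leP (- a p) 0); lra.
have kp0 p : 0 <= kp p by rewrite le_max lexx orbT.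
have kn0 p : 0 <= kn p by rewrite le_max lexx orbT.
pose r p := \prod_(i < n) fbm_cov H (t p i) (s p i).
have ipE : step_ip H g h = \sum_p kp p * r p - \sum_p kn p * r p.
  rewrite /step_ip (big_nth z) big_mkord.
  under eq_bigr do rewrite (big_nth z) big_mkord.
  rewrite pair_bigA /= -sumrB; apply: eq_bigr => p _.
  by rewrite -mulrBl -kpE.
rewrite ipE EFinB leeBlDl// -(box_integral_cov_sum kp0 ht hs) -(box_integral_cov_sum kn0 ht hs).
pose b (k : I -> R) u v := (\sum_p k p * ((\prod_(i < n) ind (t p i) (u i)) *
       (\prod_(i < n) ind (s p i) (v i)) * weight H u v))%:E.
have b0 k u v : (forall p, 0 <= k p) -> (0 <= b k u v)%E.
  move=> k0; rewrite lee_fin; apply: sumr_ge0 => p _; apply: mulr_ge0 => //.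
  apply: mulr_ge0; last exact: (weight_ge0 hH).
  by apply: mulr_ge0; apply: prodr_ge0 => i _; exact: indic_itv_ge0.
have mb k : bmeasurable2 (b k).
  move=> d Y x y mx my; apply/measurable_EFinP; apply: measurable_sum => p.
  apply: measurable_funM => //; apply: measurable_funM; last exact: measurable_weight.
  apply: measurable_funM; apply: measurable_prod => i _.
    exact: (measurableT_comp (measurable_ind _) (mx i)).
  exact: (measurableT_comp (measurable_ind _) (my i)).
have mst := bmeasurable2_abs_ip H (rmeasurable_step_fun g) (rmeasurable_step_fun h).
rewrite -[X in (_ <= X + _)%E]/(box_integral T (fun u => box_integral T (b kn u))).
rewrite -[X in (X <= _)%E]/(box_integral T (fun u => box_integral T (b kp u))).
rewrite /abs_ip -box_integral2D//; last 2 first.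
- by move=> u v; exact: b0.
- by move=> u v; exact: (abs_ip_integrand_ge0 hH).
apply: le_box_integral2 => //.
- by move=> u v; exact: b0.
- by move=> u v; apply: adde_ge0; [exact: b0|exact: (abs_ip_integrand_ge0 hH)].
- by move=> d Y x y mx my; apply: emeasurable_funD; [exact: mb|exact: mst].
move=> u v _ _; rewrite -EFinD lee_fin -lerBlDl -sumrB.
rewrite (_ : \sum_p _ = step_fun g u * step_fun h v * weight H u v); last first.
  rewrite /step_fun (big_nth z) big_mkord [X in _ * X * _](big_nth z) big_mkord.
  rewrite big_distrlr /= pair_bigA /= mulr_suml; apply: eq_bigr => p _.
  rewrite -mulrBl -kpE /a /t /s /ind; ring.
apply: ler_wpM2r; first exact: (weight_ge0 hH).
by rewrite -normrM ler_norm.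
Qed.

End step_ip_domination.

(** * Nonnegativity of the norms of step functions *)

Section positive_semidefinite.
Context d (Omega : measurableType d) (R : realType) (P : probability Omega R).
Context (H T : R) (B : R -> {RV P >-> R}) (hB : fbm H T B) (hH : 1 / 2 < H < 1).

Lemma fbm_covariance_integral t s : 0 <= t <= T -> 0 <= s <= T ->
  (\int[P]_w (B t w * B s w)%:E = (fbm_cov H t s)%:E)%E.
Proof.
move=> ht hs; rewrite -(fbm_covariance hB)// unlock.
rewrite !(fbm_centered hB)// unlock; apply: eq_integral => w _ /=.
by rewrite [in RHS]/GRing.mul /= !subr0.
Qed.

Lemma fbm_integrable t s : 0 <= t <= T -> 0 <= s <= T ->
  P.-integrable setT (fun w => (B t w * B s w)%:E).
Proof.
move=> ht hs.
have sq r : 0 <= r <= T -> P.-integrable setT (fun w => (B r w * B r w)%:E).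
  move=> hr; apply/integrableP; split.
    by apply/measurable_EFinP; exact: measurable_funM.
  under eq_integral do rewrite gee0_abs ?lee_fn -?expr2 ?lee_fin ?sqr_ge0//.
  by under eq_integral do rewrite expr2; rewrite fbm_covariance_integral ?ltry.
apply: (@le_integrable _ _ _ P setT measurableT _
    (fun w => (B t w * B t w)%:E + (B s w * B s w)%:E)%E).
- by apply/measurable_EFinP; exact: measurable_funM.
- move=> w _; rewrite -EFinD !abse_EFin lee_fin [leRHS]ger0_norm; last first.
    by rewrite -!expr2 addr_ge0 ?sqr_ge0.
  rewrite normrM -!expr2 -(real_normK (num_real (B t w))) -(real_normK (num_real (B s w))).
  set x := `|B t w|; set y := `|B s w|.
  have x0 : 0 <= x by exact: normr_ge0.
  have y0 : 0 <= y by exact: normr_ge0.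
  have := sqr_ge0 (x - y); have : 0 <= x * y by exact: mulr_ge0.
  by rewrite sqrrB mulr2n; lra.
- by apply: integrableD => //; exact: sq.
Qed.

(** The Schur product theorem for Gram matrices. One covariance factor is written as the expectation
    of B_t B_s and taken out as an expectation; at each [w] what remains is a form with one factor
    less and coefficients [c i * B (t i ord0) w], nonnegative by induction. *)
Lemma fbm_cov_psd n N (c : 'I_N -> R) (t : 'I_N -> 'I_n -> R) :
  (forall i, in_box T (t i)) ->
  0 <= \sum_(i < N) \sum_(j < N) c i * c j * \prod_(k < n) fbm_cov H (t i k) (t j k).
Proof.
elim: n c t => [|n IH] c t ht.
  rewrite (_ : \sum_(i < N) _ = (\sum_(i < N) c i) ^+ 2) ?sqr_ge0//.
  rewrite expr2 big_distrlr; apply: eq_bigr => i _; apply: eq_bigr => j _.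
  by rewrite big_ord0 mulr1.
pose I := ('I_N * 'I_N)%type.
pose K (p : I) := c p.1 * c p.2 *
  \prod_(k < n) fbm_cov H (t p.1 (lift ord0 k)) (t p.2 (lift ord0 k)).
pose BB (p : I) w := B (t p.1 ord0) w * B (t p.2 ord0) w.
have -> : \sum_(i < N) \sum_(j < N) c i * c j * \prod_(k < n.+1) fbm_cov H (t i k) (t j k) =
    \sum_p K p * fbm_cov H (t p.1 ord0) (t p.2 ord0).
  rewrite pair_bigA; apply: eq_bigr => p _.
  by rewrite big_ord_recl /= /K; ring.
rewrite -lee_fin -sumEFin.
have -> : (\sum_p (K p * fbm_cov H (t p.1 ord0) (t p.2 ord0))%:E =
   \int[P]_w (\sum_p (K p)%:E * (BB p w)%:E))%E.
  rewrite integral_sum//; last first.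
    by move=> p; apply: integrableZl => //; apply: fbm_integrable; exact: ht.
  apply: eq_bigr => p _; rewrite integralZl//; last by apply: fbm_integrable; exact: ht.
  by rewrite fbm_covariance_integral; [rewrite EFinM|exact: ht|exact: ht].
apply: integral_ge0 => w _.
have := IH (fun i => c i * B (t i ord0) w) (fun i k => t i (lift ord0 k))
  (fun i k => ht i (lift ord0 k)).
rewrite pair_bigA -lee_fin -sumEFin; congr (_ <= _)%E.
apply: eq_bigr => p _; rewrite -EFinM; congr EFin.
by rewrite /K /BB /=; ring.
Qed.

Lemma step_norm2_ge0 n (g : step R n) : boxed T g -> 0 <= step_norm2 H g.
Proof.
move=> bg; rewrite /step_norm2 /step_ip (big_nth (0, fun=> 0)) big_mkord.
under eq_bigr do rewrite (big_nth (0, fun=> 0)) big_mkord.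
exact: (fbm_cov_psd (fun i => (nth (0, fun=> 0) g (nat_of_ord i)).1) (fun i => bg i (ltn_ord i))).
Qed.

End positive_semidefinite.

(** * Hermite functions *)

Section hermite_bound.
Context (R : realType).
Implicit Types (n : nat) (y : R).

Definition gauss y : R := expR (- (y ^+ 2 / 2)).

(* [(hpair n).1] and [(hpair n).2] are the derivatives of order [n] and [n + 1]
   of [gauss]. *)
Fixpoint hpair n : (R -> R) * (R -> R) :=
  match n with
  | 0 => (gauss, fun y => - y * gauss y)
  | m.+1 => ((hpair m).2,
             fun y => - y * (hpair m).2 y - m.+1%:R * (hpair m).1 y)
  end.

Definition dgauss n : R -> R := (hpair n).1.

Lemma dgauss1 y : dgauss 1 y = - y * gauss y. Proof. by []. Qed.

Lemma dgaussSS n y : dgauss n.+2 y = - y * dgauss n.+1 y - n.+1%:R * dgauss n y.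
Proof. by []. Qed.

Lemma is_derive_dgauss n y : is_derive y 1 (dgauss n) (dgauss n.+1 y).
Proof.
suff : is_derive y 1 (dgauss n) (dgauss n.+1 y) /\
       is_derive y 1 (dgauss n.+1) (dgauss n.+2 y) by case.
elim: n => [|n [IH1 IH2]].
  have h0 : is_derive y 1 (dgauss 0) (dgauss 1 y).
    have h : is_derive y 1 (fun y : R => - (y ^+ 2 / 2)) (- y).
      have h2 : is_derive y 1 (fun y : R => y ^+ 2) (2 * y).
        apply: is_derive_eq; rewrite /GRing.scale/=; ring.
      by apply: is_derive_eq; rewrite /GRing.scale/=; field.
    have := is_derive1_comp (f := expR) (is_derive_expR _) h.
    by rewrite mulrC.
  split=> //; rewrite /dgauss/=.
  have h0' : is_derive y 1 gauss (- y * gauss y) by [].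
  apply: is_derive_eq; rewrite /GRing.scale/=; ring.
split=> //; rewrite [dgauss n.+2](_ : _ = fun y => - y * dgauss n.+1 y - n.+1%:R * dgauss n y)//.
apply: is_derive_eq; rewrite /GRing.scale/= (dgaussSS n.+1); ring.
Qed.

Lemma derive1n_gauss n : derive1n n gauss = dgauss n.
Proof.
elim: n => [//|n IH]; rewrite derive1nS IH.
by apply/funext => y; rewrite derive1E; apply: derive_val; exact: is_derive_dgauss.
Qed.

Lemma dgaussN n y : dgauss n (- y) = (-1) ^+ n * dgauss n y.
Proof.
suff : dgauss n (- y) = (-1) ^+ n * dgauss n y /\
       dgauss n.+1 (- y) = (-1) ^+ n.+1 * dgauss n.+1 y by case.
elim: n => [|n [IH1 IH2]].
  by rewrite /dgauss/= /gauss sqrrN; split; ring.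
split=> //; rewrite !dgaussSS IH1 IH2 !exprS; ring.
Qed.

(* With [z = 5 + y^2] and [w = z g], [g] the derivative of order [n], this is
   the energy [w'^2 + q w^2] of the equation [w'' + (y - 4 y / z) w' + q w = 0],
   where [q = n - 1 + 16 / z - 40 / z^2] decreases in [z >= 5]. *)
Definition energy n y : R :=
  (2 * y * dgauss n y + (5 + y ^+ 2) * dgauss n.+1 y) ^+ 2 +
  ((n%:R - 1) * (5 + y ^+ 2) ^+ 2 + 16 * (5 + y ^+ 2) - 40) * dgauss n y ^+ 2.

(** Along the equation the derivative of w'^2 + q w^2 is -2 (y - 4 y / z) w'^2 + q' w^2. Here y - 4
    y / z = y (1 + y^2) / z and q' = -32 y (z - 5) / z^3: the constant 5 in z turns z - 5 into y^2,
    so that both terms are nonpositive for y >= 0. *)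
Lemma is_derive_energy n y : is_derive y 1 (energy n)
  (- (2 * y) * (1 + y ^+ 2) / (5 + y ^+ 2) *
     (2 * y * dgauss n y + (5 + y ^+ 2) * dgauss n.+1 y) ^+ 2
   - 32 * y ^+ 3 / (5 + y ^+ 2) * dgauss n y ^+ 2).
Proof.
have h1 := is_derive_dgauss n y; have h2 := is_derive_dgauss n.+1 y.
have z0 : 5 + y ^+ 2 != 0 by have := sqr_ge0 y => h; apply/eqP; lra.
rewrite /energy; apply: is_derive_eq; rewrite /GRing.scale/= dgaussSS.
by rewrite -[n.+1]addn1 natrD; field.
Qed.

Lemma energy_le n y : 0 <= y -> energy n y <= energy n 0.
Proof.
move=> y0; have dE x : derivable (energy n) x 1 by have [] := is_derive_energy n x.
apply: (@ler0_derive1_le_cc _ (energy n) 0 y) => //.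
- move=> x; rewrite in_itv/= => /andP[/ltW x0 _].
  have h := is_derive_energy n x; rewrite derive1E derive_val.
  have z0 : 0 < 5 + x ^+ 2 by have := sqr_ge0 x; lra.
  rewrite subr_le0; apply: (@le_trans _ _ 0).
    have x1 : 0 <= 1 + x ^+ 2 by have := sqr_ge0 x; lra.
    rewrite !mulNr oppr_le0; apply: mulr_ge0; last exact: sqr_ge0.
    by apply: divr_ge0; [apply: mulr_ge0 => //; exact: mulr_ge0|exact: ltW].
  by rewrite mulr_ge0 ?sqr_ge0// divr_ge0 ?(ltW z0)// mulr_ge0// exprn_ge0.
- by apply: derivable_within_continuous => x _.
- by rewrite in_itv/= lexx y0.
- by rewrite in_itv/= lexx y0.
Qed.

(** The right-hand side is the energy at 0, which bounds the energy at y; there the terms other than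
    (n - 1) w^2 are nonnegative because 16 z >= 80. Parity reduces the claim to y >= 0. *)
Lemma dgauss_weight n y :
  (n%:R - 1) * ((5 + y ^+ 2) * dgauss n y) ^+ 2 <=
  25 * dgauss n.+1 0 ^+ 2 + (25 * n%:R + 15) * dgauss n 0 ^+ 2.
Proof.
wlog y0 : y / 0 <= y.
  move=> h; have [y0|y0] := leP 0 y; first exact: h.
  have := h (- y); rewrite oppr_ge0 (ltW y0) => /(_ isT).
  rewrite dgaussN sqrrN; set g := dgauss n y.
  by rewrite [_ * (_ ^+ n * g)]mulrCA [(_ ^+ n * _) ^+ 2]exprMn sqrr_sign mul1r.
rewrite (_ : 25 * _ + _ = energy n 0); last by rewrite /energy; ring.
apply: le_trans (energy_le n y0).
rewrite /energy exprMn mulrA.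
have h1 : 0 <= (2 * y * dgauss n y + (5 + y ^+ 2) * dgauss n.+1 y) ^+ 2 by apply: sqr_ge0.
have h2 : 0 <= (16 * (5 + y ^+ 2) - 40) * dgauss n y ^+ 2.
  by rewrite mulr_ge0 ?sqr_ge0//; have := sqr_ge0 y; lra.
lra.
Qed.

(** The derivative at 0 is (n-1)!! up to sign for even n and 0 for odd n, and this is ((n-1)!!)^2 <=
    n! / sqrt(n+1), squared. The induction advances by two and rests on (n+1)(n+3) <= (n+2)^2. *)
Lemma dgauss0_le n : dgauss n 0 ^+ 4 * n.+1%:R <= n`!%:R ^+ 2.
Proof.
suff : dgauss n 0 ^+ 4 * n.+1%:R <= n`!%:R ^+ 2 /\
       dgauss n.+1 0 ^+ 4 * n.+2%:R <= n.+1`!%:R ^+ 2 by case.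
elim: n => [|n [IH1 IH2]].
  rewrite dgauss1 oppr0 !mul0r expr0n/= mul0r sqr_ge0; split => //.
  by rewrite /dgauss/= /gauss expr0n/= mul0r oppr0 expR0 !expr1n mulr1.
split=> //; rewrite dgaussSS oppr0 mul0r sub0r factS (factS n) !natrM.
set g := dgauss n 0 in IH1 *; set f := n`!%:R in IH1 *.
have g0 : 0 <= g ^+ 4 by rewrite (exprM _ 2 2) sqr_ge0.
have -> : n.+3%:R = n%:R + 3 :> R by rewrite -addn3 natrD.
have -> : n.+2%:R = n%:R + 2 :> R by rewrite -addn2 natrD.
rewrite -[n.+1]addn1 natrD in IH1 *.
set m := n%:R : R; have m0 : 0 <= m by rewrite ler0n.
have -> : (- ((m + 1) * g)) ^+ 4 * (m + 3) = (m + 1) ^+ 3 * (m + 3) * (g ^+ 4 * (m + 1)) by ring.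
apply: (@le_trans _ _ ((m + 1) ^+ 3 * (m + 3) * f ^+ 2)).
  by apply: ler_wpM2l => //; rewrite mulr_ge0 ?exprn_ge0//; lra.
rewrite -subr_ge0.
have -> : ((m + 2) * ((m + 1) * f)) ^+ 2 - (m + 1) ^+ 3 * (m + 3) * f ^+ 2 =
  ((m + 1) * f) ^+ 2 by ring.
exact: sqr_ge0.
Qed.

End hermite_bound.

(** * Elements of the tensor powers *)

Section ereal_limits.
Context (R : realType).

Lemma ge0_cvge0P (u : nat -> \bar R) : (forall k, 0 <= u k)%E ->
  u @ \oo --> 0%E <-> forall e : R, 0 < e -> \forall k \near \oo, (u k < e%:E)%E.
Proof.
move=> u0; split=> [/fine_cvgP[ufin /cvgr0Pnorm_lt uc] e e0|h].
  have := uc _ e0; apply: filterS2 ufin => k ukfin.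
  by rewrite -[in X in _ -> X](fineK ukfin) lte_fin; apply: le_lt_trans; exact: ler_norm.
apply/fine_cvgP; split.
  apply: filterS (h 1 ltr01) => k uk1; rewrite ge0_fin_numE//.
  by rewrite (lt_trans uk1)// ltry.
apply/cvgr0Pnorm_lt => e e0; apply: filterS (h _ e0) => k uke /=.
have ukfin : u k \is a fin_num by rewrite ge0_fin_numE// (lt_trans uke)// ltry.
by rewrite ger0_norm ?fine_ge0// -lte_fin fineK.
Qed.

End ereal_limits.

Section tensors.
Context d (Omega : measurableType d) (R : realType) (P : probability Omega R).
Context (H T : R) (B : R -> {RV P >-> R}) (hB : fbm H T B).
Context (hH : 1 / 2 < H < 1) (hT : 0 < T).

Let ccov := cov_density H T.
Let bnd := density_bound H T.

Lemma abs_l1_lt n (g : ('I_n -> R) -> R) (e : R) : 0 < e -> rmeasurable g ->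
  (abs_ip H T g g < (ccov ^+ n * e ^+ 2)%:E)%E -> (abs_l1 T g < e%:E)%E.
Proof.
move=> e0 mg; apply: contraTT; rewrite -!leNgt => h.
apply: (le_trans _ (abs_l1_sq hH hT mg)).
have c0 : 0 <= ccov ^+ n by rewrite exprn_ge0// ltW// density_lower_gt0.
rewrite EFinM; apply: lee_wpmul2l; first by rewrite lee_fin.
by rewrite expr2 EFinM; apply: lee_pmul => //; rewrite lee_fin ltW.
Qed.

Variables (n : nat) (f : ('I_n -> R) -> R) (M : R).
Hypotheses (mf : rmeasurable f) (M0 : 0 <= M).
Hypothesis fM : forall u, in_box T u -> `|f u| <= M.

Lemma represents_ip (phi : tensor H T n) (e : R) : represents phi f -> 0 < e ->
  \forall k \near \oo,
    (abs_ip H T (fun u => (f u - step_fun (phi k) u)%R)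
                (fun u => (f u - step_fun (phi k) u)%R) < e%:E)%E.
Proof.
move=> pf; move: e.
apply: (ge0_cvge0P (u := fun k => abs_ip H T (fun u => (f u - step_fun (phi k) u)%R)
  (fun u => (f u - step_fun (phi k) u)%R)) _).1 pf => k.
exact: abs_ip_ge0.
Qed.

Lemma represents_l1 (phi : tensor H T n) (e : R) : represents phi f -> 0 < e ->
  \forall k \near \oo, (abs_l1 T (fun u => (f u - step_fun (phi k) u)%R) < e%:E)%E.
Proof.
move=> pf e0.
have c0 : 0 < ccov ^+ n * e ^+ 2.
  by rewrite mulr_gt0 ?exprn_gt0//; exact: density_lower_gt0.
apply: filterS (represents_ip pf c0) => k; apply: abs_l1_lt => //.
by apply: rmeasurableB => //; exact: rmeasurable_step_fun.
Qed.

Lemma boxed_tensor (phi : tensor H T n) k : boxed T (phi k).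
Proof. by move=> i ik; exact: approx_in_box. Qed.

(** Write the step function as f - g. Both cross terms pair g, small in L^1, with the bounded f and
    contribute e/4 each; g with itself contributes e/2. *)
Lemma step_norm2_le (phi : tensor H T n) (e : R) : represents phi f -> 0 < e ->
  \forall k \near \oo,
    ((step_norm2 H (phi k))%:E <= abs_ip H T f f + e%:E)%E.
Proof.
move=> pf e0.
pose K := M * bnd ^+ n + 1.
have K0 : 0 < K.
  by rewrite ltr_wpDl// mulr_ge0// exprn_ge0// density_bound_ge0.
have e1 : 0 < e / (4 * K) by rewrite divr_gt0// mulr_gt0.
have e2 : 0 < e / 2 by rewrite divr_gt0.
near=> k.
set g := fun u => f u - step_fun (phi k) u.
have mg : rmeasurable g by apply: rmeasurableB => //; exact: rmeasurable_step_fun.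
have ms := rmeasurable_step_fun (phi k).
have gl1 : (abs_l1 T g < (e / (4 * K))%:E)%E.
  by rewrite /g; near: k; exact: represents_l1.
have gip : (abs_ip H T g g < (e / 2)%:E)%E.
  by rewrite /g; near: k; exact: represents_ip.
have bk := @boxed_tensor phi k.
apply: (le_trans (step_ip_le hH bk bk)).
apply: (le_trans (abs_norm2_leD hH ms mf mg _)).
  move=> u _; rewrite (_ : step_fun _ u = f u - g u); last by rewrite /g; ring.
  exact: ler_normB.
have gf : (abs_ip H T g f <= (e / 4)%:E)%E.
  apply: (le_trans (abs_ip_bounded hH M0 mg mf fM)).
  apply: (@le_trans _ _ (K%:E * (e / (4 * K))%:E)%E); last first.
    rewrite -EFinM lee_fin le_eqVlt; apply/orP; left; apply/eqP; field.
    by rewrite gt_eqF.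
  apply: lee_pmul.
  - by rewrite lee_fin mulr_ge0// exprn_ge0// density_bound_ge0.
  - exact: abs_l1_ge0.
  - by rewrite lee_fin lerDl.
  - exact: ltW.
rewrite -addeA; apply: leeD => //.
have -> : e = e / 4 + (e / 4 + e / 2) by field.
rewrite 2!EFinD; apply: leeD => //; apply: leeD => //; exact: ltW.
Unshelve. all: by end_near. Qed.

Lemma tensor_norm2_le (phi : tensor H T n) : represents phi f ->
  ((tensor_norm2 phi)%:E <= abs_ip H T f f)%E.
Proof.
move=> pf; have [->|/eqP fy] := eqVneq (abs_ip H T f f) +oo%E; first exact: leey.
have A0 := abs_ip_ge0 T hH f f.
have Afin : abs_ip H T f f \is a fin_num.
  by rewrite ge0_fin_numE// lt_neqAle leey andbT; apply/eqP.
rewrite -(fineK Afin) lee_fin; apply/ler_addgt0Pr => e e0.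
(* The limit of a divergent sequence is a default value, here 0, for which the bound holds as
   well. *)
have [cv|ncv] := pselect (cvgn (fun k => step_norm2 H (phi k))); last first.
  rewrite /tensor_norm2 (dvgP ncv).
  by apply: addr_ge0; [exact: fine_ge0|exact: ltW].
apply: limr_le => //; apply: filterS (step_norm2_le pf e0) => k.
by rewrite -{1}(fineK Afin) -EFinD lee_fin.
Qed.

Lemma tensor_norm2_ge0 (phi : tensor H T n) : 0 <= tensor_norm2 phi.
Proof.
have [cv|ncv] := pselect (cvgn (fun k => step_norm2 H (phi k))); last first.
  by rewrite /tensor_norm2 (dvgP ncv).
apply: limr_ge => //; apply: nearW => k.
exact: (step_norm2_ge0 hB (@boxed_tensor phi k)).
Qed.

(** Let A = s g - g, A' = s h - h and D = g - h, so that A - A' = s D - D. Then |A|^2 = 2 <A, A'> -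
    |A'|^2 + |A - A'|^2, and the last term is at most 4 |D|^2 because |s D + D|^2 >= 0 and [s]
    preserves the norm. The two nonnegative quantities supplied to [lra] are |A'|^2 and |s D +
    D|^2. *)
Lemma step_norm2_perm_le (s : 'S_n) (g h : step R n) : boxed T g -> boxed T h ->
  step_norm2 H (step_sub (step_perm s g) g) <=
  2 * step_ip H (step_sub (step_perm s g) g) (step_sub (step_perm s h) h) +
  4 * step_norm2 H (step_sub g h).
Proof.
move=> bg bh; have bsg := boxed_perm (s := s) bg; have bsh := boxed_perm (s := s) bh.
have := step_norm2_ge0 hB (boxed_sub (boxed_sub bsg bg) (boxed_sub (boxed_sub bsg bsh) (boxed_sub bg bh))).
have := step_norm2_ge0 hB (boxed_sub (boxed_sub bsg bsh) (boxed_sub bh bg)).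
have e1 := step_ip_perm H s g g; have e2 := step_ip_perm H s g h.
have e3 := step_ip_perm H s h h.
have c1 := step_ipC H (step_perm s g) g; have c2 := step_ipC H (step_perm s g) h.
have c3 := step_ipC H (step_perm s h) g; have c4 := step_ipC H (step_perm s h) h.
have c5 := step_ipC H (step_perm s g) (step_perm s h); have c6 := step_ipC H g h.
rewrite /step_norm2 !step_ip_subl !step_ip_subr; lra.
Qed.

(** The symmetry of [f] makes s phi_k - phi_k small in L^1, which does not bound its norm since the
    sup norms may grow with k. It is therefore paired with the same difference at a fixed index N of
    the Cauchy condition, which is a bounded function. *)
Lemma tensor_symmetric_represents (phi : tensor H T n) :
  (forall (s : 'S_n) u, f (fun i => u (s i)) = f u) ->
  represents phi f -> tensor_symmetric phi.
Proof.
move=> fs pf s; apply/cvgr0Pnorm_le => e e0.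
have e8 : 0 < e / 8 by rewrite divr_gt0.
have [N hN] := approx_cauchy phi e8.
pose h := phi N; pose a k := step_sub (step_perm s (phi k)) (phi k).
have bh : boxed T h by exact: boxed_tensor.
have [L L0 hL] := step_fun_bounded (a N).
pose K := L * bnd ^+ n + 1.
have K0 : 0 < K.
  by rewrite ltr_wpDl// mulr_ge0// exprn_ge0// density_bound_ge0.
have e1 : 0 < e / (8 * K) by rewrite divr_gt0// mulr_gt0.
near=> k.
have bk : boxed T (phi k) by exact: boxed_tensor.
have ba : boxed T (a k) by apply: boxed_sub => //; exact: boxed_perm.
have baN : boxed T (a N) by apply: boxed_sub => //; exact: boxed_perm.
rewrite ger0_norm; last exact: (step_norm2_ge0 hB ba).
apply: (le_trans (step_norm2_perm_le s bk bh)).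
have h1 : step_norm2 H (step_sub (phi k) h) < e / 8.
  by apply: hN => //; near: k; exists N.
set g := fun u => f u - step_fun (phi k) u.
have mg : rmeasurable g by apply: rmeasurableB => //; exact: rmeasurable_step_fun.
have gl1 : (abs_l1 T g < (e / (8 * K))%:E)%E.
  by rewrite /g; near: k; exact: represents_l1.
pose gs u := g (fun i => u ((s^-1)%g i)).
have mgs : rmeasurable gs by move=> d' Y y my; apply: mg.
have gsl1 : abs_l1 T gs = abs_l1 T g.
  by apply: (box_integral_perm T (s^-1)%g (F := fun u => `|g u|%:E)) => //;
    exact: bmeasurable_abs.
have al1 : (abs_l1 T (step_fun (a k)) <= (e / (4 * K))%:E)%E.
  apply: (le_trans (abs_l1_leD (f1 := g) (f2 := gs) _ mg mgs _)).
  - exact: rmeasurable_step_fun.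
  - move=> u _; rewrite /a step_fun_sub step_fun_perm.
    rewrite (_ : _ - _ = g u - gs u); first exact: ler_normB.
    by rewrite /gs /g fs; ring.
  rewrite gsl1; have -> : e / (4 * K) = e / (8 * K) + e / (8 * K).
    by field; rewrite gt_eqF.
  by rewrite EFinD; apply: leeD; exact: ltW.
have h2 : step_ip H (a k) (a N) <= e / 4.
  rewrite -lee_fin; apply: (le_trans (step_ip_le hH ba baN)).
  apply: (le_trans (abs_ip_bounded hH L0 _ _ _)).
  - exact: rmeasurable_step_fun.
  - exact: rmeasurable_step_fun.
  - by move=> u _; exact: hL.
  apply: (@le_trans _ _ (K%:E * (e / (4 * K))%:E)%E); last first.
    rewrite -EFinM lee_fin le_eqVlt; apply/orP; left; apply/eqP; field.
    by rewrite gt_eqF.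
  apply: lee_pmul => //.
  - by rewrite lee_fin mulr_ge0// exprn_ge0// density_bound_ge0.
  - exact: abs_l1_ge0.
  - by rewrite lee_fin lerDl.
by rewrite -/(a k) -/(a N) in h2 *; lra.
Unshelve. all: by end_near. Qed.

(** Bounded pointwise convergence gives L^1 convergence, and between uniformly bounded functions
    this controls [abs_ip]: hence both the Cauchy condition and the representation. *)
Lemma tensor_exists (G : nat -> step R n) :
  (forall k, boxed T (G k)) ->
  (forall k u, in_box T u -> `|step_fun (G k) u| <= M) ->
  (forall u, in_box T u -> (fun k => step_fun (G k) u) @ \oo --> f u) ->
  exists phi : tensor H T n, represents phi f.
Proof.
move=> bG GM Gf.
have mG k := rmeasurable_step_fun (G k).
pose g k u := f u - step_fun (G k) u.
have mg k : rmeasurable (g k) by exact: rmeasurableB.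
have gM k u : in_box T u -> `|g k u| <= 2 * M.
  move=> hu; apply: (le_trans (ler_normB _ _)).
  by have := fM hu; have := GM k _ hu; lra.
pose K := 2 * M * bnd ^+ n.
have K0 : 0 <= K by rewrite mulr_ge0 ?mulr_ge0// exprn_ge0// density_bound_ge0.
have gl1 : (fun k => abs_l1 T (g k)) @ \oo --> 0%E.
  apply: (@box_integral_cvg0 R T n (fun k u => `|g k u|%:E) (2 * M)).
  - exact: ltW.
  - by move=> k u; rewrite lee_fin.
  - by move=> k; exact: bmeasurable_abs.
  - by move=> k u hu; rewrite lee_fin gM.
  move=> u hu; apply: cvg_EFin; first exact: nearW.
  apply/cvgr0Pnorm_lt => e e0.
  have /cvgrPdist_lt/(_ _ e0) := Gf u hu.
  by apply: filterS => k; rewrite /g /= normr_id.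
have gl1e e : 0 < e -> \forall k \near \oo, (abs_l1 T (g k) < e%:E)%E.
  by move: e; apply/ge0_cvge0P => // k; exact: abs_l1_ge0.
have K1 : 0 < K + 1 by rewrite ltr_wpDl.
have cauchy (e : R) : 0 < e -> exists N : nat, forall k l, (N <= k)%N -> (N <= l)%N ->
    step_norm2 H (step_sub (G k) (G l)) < e.
  move=> e0; have e1 : 0 < e / (2 * (K + 1)) by rewrite divr_gt0// mulr_gt0.
  have [N _ hN] := gl1e _ e1; exists N => k l Nk Nl.
  have bkl := boxed_sub (bG k) (bG l).
  rewrite -lte_fin; apply: (le_lt_trans (step_ip_le hH bkl bkl)).
  have ms := rmeasurable_step_fun (step_sub (G k) (G l)).
  apply: (le_lt_trans (abs_ip_bounded hH (M := 2 * M) _ ms ms _)).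
  - by rewrite mulr_ge0.
  - move=> u hu; rewrite step_fun_sub; apply: (le_trans (ler_normB _ _)).
    by have := GM l _ hu; have := GM k _ hu; lra.
  have h1 : (abs_l1 T (step_fun (step_sub (G k) (G l))) <= (e / (K + 1))%:E)%E.
    apply: (le_trans (abs_l1_leD (f1 := g l) (f2 := g k) ms (mg l) (mg k) _)).
      move=> u _; rewrite step_fun_sub (_ : _ - _ = g l u - g k u); first exact: ler_normB.
      by rewrite /g; ring.
    have -> : e / (K + 1) = e / (2 * (K + 1)) + e / (2 * (K + 1)).
      by field; rewrite gt_eqF.
    by rewrite EFinD; apply: leeD; apply: ltW; exact: hN.
  apply: (@le_lt_trans _ _ (K%:E * (e / (K + 1))%:E)%E).
    by apply: lee_wpmul2l => //; rewrite lee_fin.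
  rewrite -EFinM lte_fin mulrCA gtr_pMr// ltr_pdivrMr// mul1r; lra.
exists (Tensor bG cauchy); rewrite /represents /=.
apply/ge0_cvge0P => [k|e e0]; first exact: abs_ip_ge0.
have e1 : 0 < e / (K + 1) by rewrite divr_gt0.
apply: filterS (gl1e _ e1) => k hk.
apply: (le_lt_trans (abs_ip_bounded hH (M := 2 * M) _ (mg k) (mg k) (gM k))).
  by rewrite mulr_ge0.
apply: (@le_lt_trans _ _ (K%:E * (e / (K + 1))%:E)%E).
  by apply: lee_wpmul2l; [rewrite lee_fin|exact: ltW].
rewrite -EFinM lte_fin mulrCA gtr_pMr// ltr_pdivrMr// mul1r; lra.
Qed.

End tensors.

(** * Norms of the symmetrized kernels *)

Section kernel_norm.
Context (R : realType) (H T : R) (hH : 1 / 2 < H < 1) (hT : 0 < T).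
Notation mu := (@lebesgue_measure R).
Notation D := ([set` `[0%R, T]] : set R).
Notation phi := (cov_density H).
Notation bnd := (density_bound H T).

Lemma box_integral2_finsert_le n (i j : 'I_n.+1)
    (F : ('I_n.+1 -> R) -> ('I_n.+1 -> R) -> \bar R) (h : R -> R -> R) :
  (forall u v, 0 <= F u v)%E -> bmeasurable2 F ->
  (forall s t, 0 <= h s t) -> measurable_fun setT (fun z : R * R => h z.1 z.2) ->
  (forall s t, 0 <= s <= T -> 0 <= t <= T -> (box_integral T (fun u =>
    box_integral T (fun v => F (finsert i s u) (finsert j t v))) <= (h s t)%:E)%E) ->
  (box_integral T (fun u => box_integral T (F u)) <=
   \int[mu]_(s in D) \int[mu]_(t in D) (h s t)%:E)%E.
Proof.
move=> F0 mF h0 mh Fh; rewrite (box_integral2_finsert T i j)//.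
pose G s t := box_integral T (fun u =>
    box_integral T (fun v => F (finsert i s u) (finsert j t v))).
have G0 s t : (0 <= G s t)%E.
  by apply: box_integral_ge0 => u; exact: box_integral_ge0.
have mG : measurable_fun setT (fun z : R * R => G z.1 z.2).
  apply: (measurable_box_integral T (F := fun z : R * R => fun u =>
    box_integral T (fun v => F (finsert i z.1 u) (finsert j z.2 v)))).
    by move=> z u; exact: box_integral_ge0.
  move=> d Y k g mk mg; apply: (measurable_box_integral T (F := fun y v =>
    F (finsert i (k y).1 (g y)) (finsert j (k y).2 v))) => //.
  move=> d' Y' k' g' mk' mg'; apply: mF.
    apply: measurable_finsert => [|l].
      exact: (measurableT_comp (measurableT_comp measurable_fst mk) mk').
    exact: (measurableT_comp (f := fun y => g y l) (mg l) mk').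
  apply: measurable_finsert => //.
  exact: (measurableT_comp (measurableT_comp measurable_snd mk) mk').
apply: ge0_le_integral => //.
- by move=> s _; apply: integral_ge0 => t _; exact: G0.
- by apply: measurable_funTS; apply: measurable_integral_param.
- apply: measurable_funTS; apply: measurable_integral_param => //.
  by apply/measurable_EFinP.
move=> s sD; apply: ge0_le_integral => //.
- by move=> t _; exact: G0.
- apply: measurable_funTS.
  exact: (measurableT_comp mG (measurable_fun_pair (measurable_cst s) (@measurable_id _ _ setT))).
- apply: measurable_funTS; apply/measurable_EFinP.
  exact: (measurableT_comp mh (measurable_fun_pair (measurable_cst s) (@measurable_id _ _ setT))).
by move=> t tD; exact: Fh.
Qed.

Lemma fbm_cov_ge0 s t : 0 <= s -> 0 <= t -> 0 <= fbm_cov H s t.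
Proof.
move=> s0 t0; rewrite -lee_fin -(integral2_cov_density hH)//.
by apply: integral_ge0 => u _; apply: integral_ge0 => v _; rewrite lee_fin (cov_density_ge0 hH).
Qed.

Lemma box_integral_cov_pow n s t : 0 <= s <= T -> 0 <= t <= T ->
  box_integral T (fun u : 'I_n -> R => box_integral T (fun v : 'I_n -> R =>
    (\prod_(i < n) (ind s (u i) * ind t (v i) * phi (u i - v i)))%:E)) =
  (fbm_cov H s t ^+ n)%:E.
Proof.
move=> hs ht.
rewrite (box_integral2_prod (h := fun=> fun x y => ind s x * ind t y * phi (x - y))
  (r := fun=> fbm_cov H s t)).
- by rewrite prodr_const card_ord.
- move=> _ x y; apply: mulr_ge0; last exact: cov_density_ge0.
  by apply: mulr_ge0; exact: indic_itv_ge0.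
- move=> _; apply: measurable_funM.
    by apply: measurable_funM; [exact: (measurableT_comp (measurable_ind _) measurable_fst)|
      exact: (measurableT_comp (measurable_ind _) measurable_snd)].
  apply: (measurableT_comp (measurable_cov_density H)).
  by apply: measurable_funB.
- by move=> _; exact: integral_cov_indicator.
Qed.

Lemma bmeasurable2_cov_pow n s t : bmeasurable2 (fun u v : 'I_n -> R =>
    (\prod_(i < n) (ind s (u i) * ind t (v i) * phi (u i - v i)))%:E).
Proof.
move=> d Y g h mg mh; apply/measurable_EFinP; apply: measurable_prod => i _.
apply: measurable_funM.
  by apply: measurable_funM; [exact: (measurableT_comp (measurable_ind _) (mg i))|
    exact: (measurableT_comp (measurable_ind _) (mh i))].
apply: (measurableT_comp (measurable_cov_density H)).
exact: measurable_funB.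
Qed.

Lemma cov_pow_ge0 n s t (u v : 'I_n -> R) :
  0 <= \prod_(i < n) (ind s (u i) * ind t (v i) * phi (u i - v i)).
Proof.
apply: prodr_ge0 => i _; apply: mulr_ge0; last exact: cov_density_ge0.
by apply: mulr_ge0; exact: indic_itv_ge0.
Qed.

Lemma cov_powE n s t (u v : 'I_n -> R) :
  \prod_(i < n) (ind s (u i) * ind t (v i) * phi (u i - v i)) =
  (\prod_(i < n) ind s (u i)) * (\prod_(i < n) ind t (v i)) *
  \prod_(i < n) phi (u i - v i).
Proof. by rewrite 2!big_split. Qed.

Variables (a : R -> R) (ma : measurable_fun setT a) (a0 : forall s, 0 <= a s).

(* On [0,T]^n, this is a(u_i) \prod_(k != i) 1_[0,u_i] (u_k). *)
Definition adapted n (i : 'I_n) (u : 'I_n -> R) : R :=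
  a (u i) * \prod_(k < n) ind (u i) (u k).

Lemma adapted_ge0 n (i : 'I_n) u : 0 <= adapted i u.
Proof. by rewrite mulr_ge0// prodr_ge0// => k _; exact: indic_itv_ge0. Qed.

Lemma rmeasurable_adapted n (i : 'I_n) : rmeasurable (adapted i).
Proof.
move=> d Y g mg; apply: measurable_funM; first exact: measurableT_comp.
by apply: measurable_prod => k _; exact: measurable_indic_itv.
Qed.

Lemma ind_le1 s t : ind s t <= 1 :> R.
Proof. by rewrite /ind indicE; case: (_ \in _). Qed.

Lemma weightE n (u v : 'I_n -> R) : weight H u v = \prod_(i < n) phi (u i - v i).
Proof. by []. Qed.

(** With s = u_i and t = v_i, the n other pairs of coordinates integrate to R(s,t)^n, absorbed in
    [c]; only the density at s - t remains, of integral at most [bnd * T]. *)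
Lemma abs_ip_diag n (i : 'I_n.+1) (c : R) : 0 <= c ->
  (forall s t, 0 <= s <= T -> 0 <= t <= T -> a s * a t * fbm_cov H s t ^+ n <= c) ->
  (abs_ip H T (adapted i) (adapted i) <= (c * bnd * T)%:E)%E.
Proof.
move=> c0 hc; rewrite /abs_ip.
apply: (@le_trans _ _ (\int[mu]_(s in D) \int[mu]_(t in D) (c * phi (s - t))%:E)%E); last first.
  have h s : 0 <= s <= T -> (\int[mu]_(t in D) (c * phi (s - t))%:E <= (c * bnd)%:E)%E.
    move=> hs; rewrite (_ : \int[mu]_(t in D) _ = c%:E * \int[mu]_(t in D) (phi (s - t))%:E)%E.
      by rewrite EFinM; apply: lee_wpmul2l; [rewrite lee_fin|exact: integral_cov_density_le].
    rewrite -ge0_integralZl_EFin//; first by move=> t _; rewrite lee_fin (cov_density_ge0 hH).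
    apply: measurable_funTS; apply/measurable_EFinP.
    by apply: (measurableT_comp (measurable_cov_density H)); apply: measurable_funB.
  apply: (@le_trans _ _ (\int[mu]_(s in D) (cst (c * bnd)%:E s))%E).
    apply: ge0_le_integral => //.
    - by move=> s _; apply: integral_ge0 => t _; rewrite lee_fin mulr_ge0// (cov_density_ge0 hH).
    - apply: measurable_funTS; apply: measurable_integral_param => //.
        apply/measurable_EFinP; apply: measurable_funM => //.
        by apply: (measurableT_comp (measurable_cov_density H)); apply: measurable_funB.
      by move=> s t; rewrite lee_fin mulr_ge0// (cov_density_ge0 hH).
  rewrite (_ : (\int[mu]_(s in D) _)%E = ((c * bnd)%:E * mu D)%E); last exact: integral_cst.
  by rewrite (measure_box1 (ltW hT)) -EFinM.
apply: (@box_integral2_finsert_le _ i i _ (fun s t => c * phi (s - t))).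
- by move=> u v; exact: abs_ip_integrand_ge0.
- by apply: bmeasurable2_abs_ip; exact: rmeasurable_adapted.
- by move=> s t; rewrite mulr_ge0// (cov_density_ge0 hH).
- apply: measurable_funM => //.
  by apply: (measurableT_comp (measurable_cov_density H)); apply: measurable_funB.
move=> s t hs ht.
have as0 : 0 <= a s * a t * phi (s - t) by apply: mulr_ge0; [exact: mulr_ge0|exact: cov_density_ge0].
apply: (@le_trans _ _ ((a s * a t * phi (s - t))%:E * (fbm_cov H s t ^+ n)%:E)%E); last first.
  rewrite -EFinM lee_fin mulrAC; apply: ler_wpM2r; first exact: cov_density_ge0.
  exact: hc.
rewrite -box_integral_cov_pow// -box_integral2Zl//; last 2 first.
- by move=> u v; rewrite lee_fin cov_pow_ge0.
- exact: bmeasurable2_cov_pow.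
have mA := bmeasurable2_abs_ip H (rmeasurable_adapted i) (rmeasurable_adapted i).
apply: le_box_integral2.
- by move=> u v; exact: abs_ip_integrand_ge0.
- by move=> u v; rewrite -EFinM lee_fin mulr_ge0// cov_pow_ge0.
- by move=> d Y g h mg mh; apply: mA; exact: measurable_finsert.
- by move=> d Y g h mg mh; apply: measurable_funeM; exact: bmeasurable2_cov_pow.
move=> u v _ _; rewrite -EFinM lee_fin !ger0_norm ?adapted_ge0//.
rewrite /adapted !finsertE weightE !(bigD1_ord i)//= !finsertE.
under eq_bigr do rewrite finsert_lift.
under [in X in _ * X * _ <= _]eq_bigr do rewrite finsert_lift.
under [in X in _ * _ * X <= _]eq_bigr do rewrite !finsert_lift.
rewrite cov_powE.
set p1 := \prod_(_ < n) _; set p2 := \prod_(_ < n) _; set p3 := \prod_(_ < n) _.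
have p10 : 0 <= p1 by apply: prodr_ge0 => k _; exact: indic_itv_ge0.
have p20 : 0 <= p2 by apply: prodr_ge0 => k _; exact: indic_itv_ge0.
have p30 : 0 <= p3 by apply: prodr_ge0 => k _; exact: cov_density_ge0.
rewrite [leLHS](_ : _ = (ind s s * ind t t) * (a s * a t * phi (s - t) * (p1 * p2 * p3))).
  apply: ler_piMl; first by apply: mulr_ge0 => //; apply: mulr_ge0 => //; exact: mulr_ge0.
  by apply: mulr_ile1; rewrite ?ind_le1 ?indic_itv_ge0.
by ring.
Qed.

(** Removing [i] then [j], or [j] then [i], enumerates the other indices in the same order. *)
Lemma lift_liftC n (i j : 'I_n.+2) (i' j' : 'I_n.+1) (k : 'I_n) :
  i = lift j i' -> j = lift i j' ->
  lift i (lift j' k) = lift j (lift i' k).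
Proof.
move=> /(congr1 val)/= + /(congr1 val)/= => ij ji.
by apply/val_inj => /=; move: ij ji; rewrite /bump; lia.
Qed.

(** The adapted variables s = u_i and t = v_j face y = v_i and x = u_j. The constraints x <= s and y
    <= t are dropped, and integrating the densities at s - y and x - t over x and y costs
    [bnd ^+ 2]. The n other pairs give R(s,t)^n. *)
Lemma abs_ip_off n (i j : 'I_n.+2) (q : R -> R -> R) : i != j ->
  (forall s t, 0 <= q s t) -> measurable_fun setT (fun z : R * R => q z.1 z.2) ->
  (forall s t, 0 <= s <= T -> 0 <= t <= T -> a s * a t * fbm_cov H s t ^+ n <= q s t) ->
  (abs_ip H T (adapted i) (adapted j) <=
   \int[mu]_(s in D) \int[mu]_(t in D) (bnd ^+ 2 * q s t)%:E)%E.
Proof.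
move=> ij q0 mq hq; rewrite /abs_ip.
case: (unliftP i j) ij => [j' jE|->]; last by rewrite eqxx.
case: (unliftP j i) => [i' iE|->]; last by rewrite eqxx.
move=> _; have mA := bmeasurable2_abs_ip H (rmeasurable_adapted i) (rmeasurable_adapted j).
apply: (@box_integral2_finsert_le _ i j _ (fun s t => bnd ^+ 2 * q s t)) => //.
- by move=> u v; exact: abs_ip_integrand_ge0.
- by move=> s t; rewrite mulr_ge0// sqr_ge0.
- exact: measurable_funM.
move=> s t hs ht.
pose c := a s * a t * fbm_cov H s t ^+ n.
have [/andP[s0 _] /andP[t0 _]] := (hs, ht).
have c0 : 0 <= c by rewrite !mulr_ge0 ?exprn_ge0// fbm_cov_ge0.
have mphi (z : R) : measurable_fun setT (fun y : R => phi (z - y)).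
  by apply: (measurableT_comp (measurable_cov_density H)); apply: measurable_funB.
have phi0 z : 0 <= phi z by exact: cov_density_ge0.
have mh : measurable_fun setT (fun z : R * R => c * (phi (t - z.1) * phi (s - z.2))).
  apply: measurable_funM => //; apply: measurable_funM.
    exact: (measurableT_comp (mphi t) measurable_fst).
  exact: (measurableT_comp (mphi s) measurable_snd).
have bnd0 : 0 <= bnd by exact: density_bound_ge0.
have cb0 : 0 <= c * bnd by exact: mulr_ge0.
have cphi x : 0 <= c * phi x by exact: mulr_ge0.
have cpp x y : 0 <= c * (phi x * phi y) by apply: mulr_ge0 => //; exact: mulr_ge0.
apply: (@le_trans _ _ (\int[mu]_(x in D) \int[mu]_(y in D)
    (c * (phi (t - x) * phi (s - y)))%:E)%E); last first.
  apply: (@le_trans _ _ (\int[mu]_(x in D) ((c * bnd)%:E * (phi (t - x))%:E))%E).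
    apply: ge0_le_integral => //.
    - by move=> x _; apply: integral_ge0 => y _; rewrite lee_fin.
    - apply: measurable_funTS; apply: measurable_integral_param => //.
        exact/measurable_EFinP.
      by move=> x y; rewrite lee_fin.
    - apply: measurable_funTS; apply: measurable_funeM; apply/measurable_EFinP.
      exact: mphi.
    move=> x _; rewrite -EFinM mulrAC EFinM.
    rewrite (_ : \int[mu]_(y in D) _ = (c * phi (t - x))%:E * \int[mu]_(y in D) (phi (s - y))%:E)%E.
      by apply: lee_wpmul2l; [rewrite lee_fin cphi|exact: integral_cov_density_le].
    rewrite -ge0_integralZl_EFin ?cphi//.
    - by apply: eq_integral => y _; rewrite -EFinM mulrA.
    - by move=> y _; rewrite lee_fin.
    - by apply: measurable_funTS; apply/measurable_EFinP; exact: mphi.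
  rewrite (ge0_integralZl_EFin _ _ _ _ cb0)//; last 2 first.
  - by move=> y _; rewrite lee_fin.
  - by apply: measurable_funTS; apply/measurable_EFinP; exact: mphi.
  apply: (@le_trans _ _ ((c * bnd)%:E * bnd%:E)%E).
    by apply: lee_wpmul2l; [rewrite lee_fin|exact: integral_cov_density_le].
  rewrite -EFinM lee_fin -mulrA -expr2 mulrC ler_wpM2l ?sqr_ge0//.
  exact: hq.
apply: (@box_integral2_finsert_le _ j' i' _ (fun x y => c * (phi (t - x) * phi (s - y)))) => //.
- by move=> u v; exact: abs_ip_integrand_ge0.
- by move=> d Y g h mg mk; apply: mA; exact: measurable_finsert.
move=> x y hx hy.
have k0 : 0 <= a s * a t * (phi (t - x) * phi (s - y)).
  by apply: mulr_ge0; exact: mulr_ge0.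
apply: (@le_trans _ _ ((a s * a t * (phi (t - x) * phi (s - y)))%:E * (fbm_cov H s t ^+ n)%:E)%E); last first.
  by rewrite -EFinM lee_fin /c mulrAC.
rewrite -box_integral_cov_pow// -box_integral2Zl//; last 2 first.
- by move=> u v; rewrite lee_fin cov_pow_ge0.
- exact: bmeasurable2_cov_pow.
apply: le_box_integral2.
- by move=> u v; exact: abs_ip_integrand_ge0.
- by move=> u v; rewrite -EFinM lee_fin mulr_ge0// cov_pow_ge0.
- by move=> d Y g h mg mk; apply: mA;
    apply: measurable_finsert => //; exact: measurable_finsert.
- by move=> d Y g h mg mk; apply: measurable_funeM; exact: bmeasurable2_cov_pow.
move=> u v _ _; rewrite -EFinM lee_fin !ger0_norm ?adapted_ge0//.
set uu := finsert i s _; set vv := finsert j t _.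
have ui : uu i = s by exact: finsertE.
have uj : uu (lift i j') = x by rewrite /uu finsert_lift finsertE.
have uk k : uu (lift i (lift j' k)) = u k by rewrite /uu !finsert_lift.
have vj : vv (lift i j') = t by rewrite -jE; exact: finsertE.
have vi : vv i = y by rewrite {1}iE /vv finsert_lift finsertE.
have vk k : vv (lift i (lift j' k)) = v k.
  by rewrite (lift_liftC k iE jE) /vv !finsert_lift.
have vj' : vv j = t by exact: finsertE.
rewrite /adapted ui vj' weightE cov_powE.
have prodE (F : 'I_n.+2 -> R) : \prod_k F k =
    F i * (F (lift i j') * \prod_k F (lift i (lift j' k))).
  by rewrite (bigD1_ord i)//= (bigD1_ord j').
rewrite !(prodE (fun k => _)) ui uj vi vj.
rewrite (eq_bigr (fun k => ind s (u k))); last by move=> k _; rewrite uk.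
rewrite (eq_bigr (F1 := fun k => ind t (vv _)) (fun k => ind t (v k))); last by move=> k _; rewrite vk.
rewrite (eq_bigr (F1 := fun k => phi _) (fun k => phi (u k - v k))); last by move=> k _; rewrite uk vk.
set p1 := \prod_(_ < n) _; set p2 := \prod_(_ < n) _; set p3 := \prod_(_ < n) _.
have p10 : 0 <= p1 by apply: prodr_ge0 => k _; exact: indic_itv_ge0.
have p20 : 0 <= p2 by apply: prodr_ge0 => k _; exact: indic_itv_ge0.
have p30 : 0 <= p3 by apply: prodr_ge0 => k _; exact: cov_density_ge0.
have -> : phi (t - x) = phi (x - t) by rewrite /cov_density distrC.
rewrite [leLHS](_ : _ = (ind s s * ind s x * (ind t y * ind t t)) *
    (a s * a t * (phi (x - t) * phi (s - y)) * (p1 * p2 * p3))); last by ring.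
apply: ler_piMl.
  by apply: mulr_ge0; apply: mulr_ge0 => //; exact: mulr_ge0.
have i0 (p r : R) : 0 <= ind p r by exact: indic_itv_ge0.
have i1 (p r : R) : ind p r <= 1 by exact: ind_le1.
by apply: mulr_ile1; rewrite ?mulr_ge0// mulr_ile1.
Qed.

End kernel_norm.

(** * Averages over permutations *)

Lemma sum_perm_image (n : nat) (j : 'I_n.+1) :
  (\sum_(s : 'S_n.+1) (s ord0 == j) = n`!)%N.
Proof.
transitivity (\sum_(s : 'S_n.+1) (s ord0 == (ord0 : 'I_n.+1)))%N.
  (* A transposition reduces to [j = ord0], and the stabilizer of [ord0] is the symmetric group on
     the n other points. *)
  rewrite (reindex_inj (@mulIg _ (tperm ord0 j)))/=.
  apply: eq_bigr => s _; rewrite permM; congr nat_of_bool.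
  by rewrite -[X in _ == X](tpermL ord0 j) (inj_eq perm_inj).
transitivity (\sum_(s : 'S_n.+1 | s ord0 == (ord0 : 'I_n.+1)) 1)%N.
  by rewrite [RHS]big_mkcond; apply: eq_bigr => s _; case: eqP.
have -> : n`! = #|perm_on [set~ (ord0 : 'I_n.+1)]|.
  by rewrite card_perm cardsC1 card_ord.
rewrite sum1dep_card; apply: eq_card => s; rewrite inE [RHS]unfold_in.
apply/idP/idP => [/eqP s0|/fintype.subsetP h].
  by apply/fintype.subsetP => i; rewrite !inE; apply: contra => /eqP ->; rewrite s0.
by apply/negPn/negP => s0; have := h ord0; rewrite !inE s0 => /(_ isT); rewrite eqxx.
Qed.

Section symmetrized_kernel.
Context (R : realType) (H T : R) (hH : 1 / 2 < H < 1) (hT : 0 < T).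
Variables (a : R -> R) (ma : measurable_fun setT a).

Definition adapted_kernel n (u : 'I_n.+1 -> R) : R :=
  a (u ord0) * \prod_(i < n) \1_(`[0, u ord0]%classic : set R) (ftail u i).

Let abs_a s := `|a s|.

(** In the box the indicator of the adapted coordinate at itself is 1, so it may be added to the
    product; each permuted kernel then depends on [s] only through [s ord0]. *)
Lemma norm_symmetrize_le n (u : 'I_n.+1 -> R) : in_box T u ->
  `|symmetrize (@adapted_kernel n) u| <=
  (n.+1`!%:R)^-1 * \sum_(s : 'S_n.+1) adapted abs_a (s ord0) u.
Proof.
move=> hu; rewrite /symmetrize normrM ger0_norm ?invr_ge0//.
rewrite ler_wpM2l ?invr_ge0//; apply: (le_trans (ler_norm_sum _ _ _)).
apply: ler_sum => s _; rewrite /adapted_kernel /adapted normrM ler_wpM2l//.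
rewrite ger0_norm; last by apply: prodr_ge0 => i _; exact: indic_itv_ge0.
rewrite [leRHS](reindex_inj (@perm_inj _ s))/= big_ord_recl/=.
have hs : `[0, u (s ord0)]%classic (u (s ord0)).
  by rewrite /= in_itv/= lexx andbT; have /andP[] := hu (s ord0).
have -> : ind (u (s ord0)) (u (s ord0)) = 1 by rewrite /ind indicE (mem_set hs).
by rewrite mul1r.
Qed.

Lemma rmeasurable_symmetrize n : rmeasurable (symmetrize (@adapted_kernel n)).
Proof.
move=> d Y g mg; apply: measurable_funM => //; apply: measurable_sum => s.
apply: measurable_funM; first exact: (measurableT_comp ma (mg _)).
by apply: measurable_prod => i _; exact: (measurable_indic_itv (mg _) (mg _)).
Qed.

Lemma symmetrize_perm n (f : ('I_n -> R) -> R) (s : 'S_n) u :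
  symmetrize f (fun i => u (s i)) = symmetrize f u.
Proof.
rewrite /symmetrize; congr (_ * _).
rewrite (reindex_inj (@mulIg _ (s^-1)%g))/=; apply: eq_bigr => t _.
by congr f; apply/funext => i; rewrite permM permKV.
Qed.

Lemma abs_ip_symmetrize_le n (c e : R) : 0 <= c -> 0 <= e ->
  (forall i : 'I_n.+1, (abs_ip H T (adapted abs_a i) (adapted abs_a i) <= c%:E)%E) ->
  (forall i j : 'I_n.+1, i != j ->
    (abs_ip H T (adapted abs_a i) (adapted abs_a j) <= e%:E)%E) ->
  (abs_ip H T (symmetrize (@adapted_kernel n)) (symmetrize (@adapted_kernel n))
    <= (c / n.+1%:R + e)%:E)%E.
Proof.
move=> c0 e0 hc he.
pose N : R := n.+1`!%:R; pose S := 'S_n.+1.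
have N0 : 0 < N by rewrite ltr0n fact_gt0.
have mA (i : 'I_n.+1) : rmeasurable (adapted abs_a i).
  by apply: rmeasurable_adapted; exact: measurableT_comp.
have A0 (i : 'I_n.+1) u : 0 <= adapted abs_a i u.
  by apply: adapted_ge0 => s; exact: normr_ge0.
pose F (p : S * S) u v :=
  ((N^-1 * N^-1)%:E * (`|adapted abs_a (p.1 ord0) u| *
     `|adapted abs_a (p.2 ord0) v| * weight H u v)%:E)%E.
have F0 p u v : (0 <= F p u v)%E.
  by rewrite mule_ge0 ?(abs_ip_integrand_ge0 hH)// lee_fin mulr_ge0 ?invr_ge0 1?ltW.
have mF p : bmeasurable2 (F p).
  by move=> d Y g h mg mh; apply: measurable_funeM; exact: bmeasurable2_abs_ip.
have mK := @rmeasurable_symmetrize n.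
apply: (@le_trans _ _ (box_integral T (fun u => box_integral T (fun v =>
    \sum_p F p u v)%E))).
  apply: le_box_integral2.
  - by move=> u v; exact: (abs_ip_integrand_ge0 hH).
  - by move=> u v; apply: sume_ge0.
  - exact: bmeasurable2_abs_ip.
  - exact: bmeasurable2_sum.
  move=> u v hu hv; rewrite /F.
  under eq_bigr do rewrite -EFinM.
  rewrite sumEFin lee_fin.
  rewrite [leRHS](_ : _ = (N^-1 * \sum_(s : S) adapted abs_a (s ord0) u) *
     (N^-1 * \sum_(s : S) adapted abs_a (s ord0) v) * weight H u v).
    apply: ler_wpM2r; first exact: (weight_ge0 hH).
    by apply: ler_pM => //; exact: norm_symmetrize_le.
  rewrite mulrACA big_distrlr/= pair_bigA -[RHS]mulrA mulr_suml mulr_sumr.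
  by apply: eq_bigr => p _ /=; rewrite !ger0_norm.
rewrite box_integral2_sum//.
(* The bound [e] is charged to the diagonal pairs too, so that each permutation contributes exactly
   n! c + (n+1)! e. *)
apply: (@le_trans _ _ (\sum_(p : S * S) ((N^-1 * N^-1) *
    ((p.1 ord0 == p.2 ord0)%:R * c + e))%:E)%E).
  apply: lee_sum => p _.
  rewrite (_ : box_integral _ _ = ((N^-1 * N^-1)%:E * abs_ip H T
     (adapted abs_a (p.1 ord0)) (adapted abs_a (p.2 ord0)))%E); last first.
    rewrite box_integral2Zl//.
    - by rewrite mulr_ge0 ?invr_ge0 1?ltW.
    - by move=> u v; exact: (abs_ip_integrand_ge0 hH).
    - exact: bmeasurable2_abs_ip.
  rewrite [leRHS]EFinM; apply: lee_wpmul2l; first by rewrite lee_fin mulr_ge0 ?invr_ge0 1?ltW.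
  case: eqP => [->|/eqP ne].
    by apply: (le_trans (hc _)); rewrite lee_fin mul1r lerDl.
  by apply: (le_trans (he _ _ ne)); rewrite lee_fin mul0r add0r.
rewrite sumEFin lee_fin -mulr_sumr -(pair_bigA _ (fun s t : S =>
  (s ord0 == t ord0)%:R * c + e))/=.
rewrite (eq_bigr (fun=> n`!%:R * c + N * e)); last first.
  move=> s _; rewrite big_split/= -mulr_suml sumr_const card_Sn -[e *+ _]mulr_natl.
  congr (_ * c + _); rewrite -natr_sum; congr (_%:R).
  by under eq_bigr do rewrite eq_sym; exact: sum_perm_image.
rewrite sumr_const card_Sn -[_ *+ _]mulr_natl -/N.
rewrite le_eqVlt; apply/orP; left; apply/eqP.
rewrite /N factS natrM; field.
by rewrite -(natrD _ 1) !pnatr_eq0 -(lt0n n`!) fact_gt0.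
Qed.

End symmetrized_kernel.

(** * Decay of the covariance off the diagonal *)

Section covariance_decay.
Context (R : realType) (H T : R) (hH : 1 / 2 < H < 1) (hT : 0 < T).
Notation mu := (@lebesgue_measure R).

Let H0 : 0 < H. Proof. by case/andP: hH; lra. Qed.
Let H1 : H < 1. Proof. by case/andP: hH; lra. Qed.

(* [1 - rho] bounded below, with [rho = (1 - r^H) / (1 - r)^H]; [r^H >= r] is
   used for [r >= 1/2], and [(1 - r)^H >= 1 - r] otherwise. *)
Definition decay : R := 1 - 2 `^ (H - 1).

Lemma decay_gt0 : 0 < decay.
Proof.
rewrite /decay subr_gt0 -[ltRHS](powRr0 2).
rewrite /powR pnatr_eq0/= ltr_expR ltr_pM2r ?ln_gt0 ?ltr1n//.
by have := H1; lra.
Qed.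

Lemma powR_le1 (x p : R) : 0 <= x <= 1 -> 0 <= p -> x `^ p <= 1.
Proof.
move=> /andP[x0 x1] p0; have <- : 1 `^ p = 1 :> R by rewrite powR1.
by apply: ge0_ler_powR; rewrite ?nnegrE.
Qed.

Lemma powR_half_le (r : R) : 0 <= r <= 1 / 2 -> r `^ (1 - H) <= 1 - decay.
Proof.
move=> /andP[r0 r1]; rewrite /decay subKr (_ : H - 1 = - (1 - H)); last by ring.
rewrite powRN -powR_inv1 ?powR_ge0// powRAC powR_inv1//.
apply: ge0_ler_powR; rewrite ?nnegrE ?invr_ge0//; last by rewrite -div1r.
by have := H1; lra.
Qed.

(** Whichever of r and 1 - r is at most 1/2 is split as x = x^H x^(1-H), where x^(1-H) <=
    (1/2)^(1-H) = 1 - [decay]. *)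
Lemma decay_ratio (r : R) : 0 < r <= 1 ->
  decay * (r `^ H * (1 - r) `^ H) <= (1 - r) `^ H - (1 - r `^ H).
Proof.
move=> /andP[r0 r1]; have d0 := decay_gt0.
set A := (1 - r) `^ H; set b := r `^ H.
have A0 : 0 <= A by exact: powR_ge0. have b0 : 0 <= b by exact: powR_ge0.
have r1' : 0 <= 1 - r by lra.
have H0' := ltW H0; have H1' : 0 <= 1 - H by have := H1; lra.
have A1 : A <= 1 by apply: powR_le1 => //; lra.
have b1 : b <= 1 by apply: powR_le1 => //; lra.
have xH (x : R) : 0 <= x -> x = x `^ H * x `^ (1 - H).
  move=> x0; rewrite -powRD; first by rewrite addrCA subrr addr0 powRr1.
  by rewrite addrCA subrr addr0 oner_eq0.
have [hr|hr] := leP r (1 / 2).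
  have h1 : 1 - r <= A.
    by rewrite {1}(xH (1 - r))// ler_piMr// powR_le1//; lra.
  have h2 : r <= b * (1 - decay).
    by rewrite {1}(xH r (ltW r0)) ler_wpM2l// powR_half_le//; lra.
  have h3 : decay * (b * A) <= decay * b.
    by apply: ler_wpM2l; [exact: ltW|exact: ler_piMr].
  lra.
have h1 : r <= b.
  by rewrite {1}(xH r (ltW r0)) ler_piMr// powR_le1//; lra.
have h2 : 1 - r <= A * (1 - decay).
  by rewrite {1}(xH (1 - r))// ler_wpM2l// powR_half_le//; lra.
have h3 : decay * (b * A) <= decay * A.
  by apply: ler_wpM2l; [exact: ltW|exact: ler_piMl].
lra.
Qed.

(** The 2 comes from the factor 1/2 in R^H, and T^(2H) from replacing |s - t| / max(s,t) by |s - t|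
    / T. *)
Definition kappa : R := decay / (2 * T `^ (2 * H)).

Lemma kappa_gt0 : 0 < kappa.
Proof. by rewrite divr_gt0 ?decay_gt0// mulr_gt0// powR_gt0. Qed.

Lemma powR2 (x : R) : 0 <= x -> x `^ (2 * H) = (x `^ H) ^+ 2.
Proof. by move=> x0; rewrite mulrC powRrM (powR_mulrn 2)// powR_ge0. Qed.

(** By homogeneity, with r = t / s, S = s^H, b = r^H and A = (1 - r)^H, the covariance is S^2 (2 b +
    (1 - b)^2 - A^2) / 2, and the claim reduces to (1 - b)^2 + [decay] b A^2 <= A^2. *)
Lemma fbm_cov_le_wlog (s t : R) : 0 < t -> t <= s -> s <= T ->
  fbm_cov H s t <= s `^ H * t `^ H * (1 - kappa * `|s - t| `^ (2 * H)).
Proof.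
move=> t0 ts sT; have s0 : 0 < s by exact: lt_le_trans ts.
pose r := t / s.
have r0 : 0 < r by rewrite divr_gt0.
have r1 : r <= 1 by rewrite ler_pdivrMr// mul1r.
have tE : t = s * r by rewrite /r mulrC divfK// gt_eqF.
have r1' : 0 <= 1 - r by rewrite subr_ge0.
have stE : `|s - t| = s * (1 - r).
  by rewrite tE -{1}(mulr1 s) -mulrBr ger0_norm// mulr_ge0// ltW.
have dr : decay * (r `^ H * (1 - r) `^ H) <= (1 - r) `^ H - (1 - r `^ H).
  by apply: decay_ratio; rewrite r0.
have b1 : r `^ H <= 1 by apply: powR_le1; rewrite ?(ltW r0)// ltW.
have s0' := ltW s0; have r0' := ltW r0.
have e1 : t `^ H = s `^ H * r `^ H by rewrite tE powRM.
have e2 : (s * (1 - r)) `^ H = s `^ H * (1 - r) `^ H by rewrite powRM.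
have sr0 : 0 <= s * (1 - r) by exact: mulr_ge0.
rewrite /fbm_cov stE (powR2 s0') (powR2 (ltW t0)) (powR2 sr0) e1 e2.
have := powR_ge0 (1 - r) H; have := powR_ge0 r H.
move: dr b1; set A := (1 - r) `^ H; set b := r `^ H => dr b1 b0 A0.
set S := s `^ H; have S0 : 0 < S by exact: powR_gt0.
have d0 := decay_gt0.
have S1 : S ^+ 2 <= T `^ (2 * H).
  rewrite powR2 ?(ltW hT)//; apply: lerXn2r; rewrite ?nnegrE ?powR_ge0//.
  by apply: ge0_ler_powR; rewrite ?nnegrE ?(ltW H0) ?(ltW hT).
have kS : kappa * (S * A) ^+ 2 <= decay / 2 * A ^+ 2.
  rewrite exprMn mulrA; apply: ler_wpM2r; first exact: sqr_ge0.
  have P0 : 0 < T `^ (2 * H) by exact: powR_gt0.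
  have -> : kappa * S ^+ 2 = decay / 2 * (S ^+ 2 / T `^ (2 * H)).
    by rewrite /kappa; field; rewrite gt_eqF.
  apply: ler_piMr; first by rewrite divr_ge0// ltW.
  by rewrite ler_pdivrMr// mul1r.
(* The sum of [decay_ratio] multiplied by A and of (1 - b)^2 <= A (1 - b). *)
have key : (1 - b) ^+ 2 + decay * b * A ^+ 2 <= A ^+ 2.
  have h1 : decay * (b * A) * A <= (A - (1 - b)) * A by exact: ler_wpM2r.
  have h2 : 0 <= (A - (1 - b)) * (1 - b).
    apply: mulr_ge0; last by rewrite subr_ge0.
    by apply: le_trans dr; apply: mulr_ge0; [exact: ltW|exact: mulr_ge0].
  nra.
apply: (@le_trans _ _ (S * (S * b) * (1 - decay / 2 * A ^+ 2))); last first.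
  apply: ler_wpM2l; last by rewrite lerD2l lerN2.
  by rewrite !mulr_ge0// ltW.
rewrite -subr_ge0.
have -> : S * (S * b) * (1 - decay / 2 * A ^+ 2) -
  2^-1 * (S ^+ 2 + (S * b) ^+ 2 - (S * A) ^+ 2) =
  S ^+ 2 * (2^-1 * (A ^+ 2 - ((1 - b) ^+ 2 + decay * b * A ^+ 2))) by field.
by rewrite mulr_ge0 ?sqr_ge0// mulr_ge0 ?subr_ge0.
Qed.

Lemma fbm_cov_le (s t : R) : 0 < s <= T -> 0 < t <= T ->
  fbm_cov H s t <= s `^ H * t `^ H * (1 - kappa * `|s - t| `^ (2 * H)).
Proof.
move=> /andP[s0 sT] /andP[t0 tT]; have [ts|/ltW st] := leP t s.
  exact: fbm_cov_le_wlog.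
have := fbm_cov_le_wlog s0 st tT.
by rewrite /fbm_cov distrC [_ + s `^ _]addrC [t `^ H * _]mulrC.
Qed.

(** Bounds (1 - x)^m by 1 / (1 + m x). With x of order |s - t|^(2H) this rational decay is
    integrable because 2H > 1. *)
Lemma onem_exp_le (m : nat) (x : R) : 0 <= x <= 1 ->
  (1 - x) ^+ m * (1 + m%:R * x) <= 1.
Proof.
move=> /andP[x0 x1]; elim: m => [|m IH]; first by rewrite expr0 mul0r addr0 mulr1.
apply: le_trans IH; rewrite exprSr -mulrA; apply: ler_wpM2l.
  by rewrite exprn_ge0// subr_ge0.
rewrite -natr1 -subr_ge0.
have -> : 1 + m%:R * x - (1 - x) * (1 + (m%:R + 1) * x) = (m%:R + 1) * x ^+ 2 by ring.
by rewrite mulr_ge0 ?sqr_ge0// addr_ge0.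
Qed.

Lemma powR_1D_le (X : R) : 0 <= X -> (1 + X) `^ (2 * H) <= 4 * (1 + X `^ (2 * H)).
Proof.
move=> X0; have H20 : 0 <= 2 * H by rewrite mulr_ge0// ltW.
have two : 2 `^ (2 * H) <= 4 :> R.
  rewrite powR2//.
  have h : 2 `^ H <= 2 :> R.
    rewrite -[leRHS]powRr1//; apply: ler_powR; [by rewrite ler1n|exact: ltW].
  have h0 : 0 <= 2 `^ H :> R by exact: powR_ge0.
  have -> : 4 = 2 ^+ 2 :> R by ring.
  by apply: lerXn2r; rewrite ?nnegrE.
have XH : 0 <= X `^ (2 * H) by exact: powR_ge0.
have [X1|/ltW X1] := leP X 1.
  apply: (@le_trans _ _ (2 `^ (2 * H))).
    by apply: ge0_ler_powR; rewrite ?nnegrE//; lra.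
  lra.
apply: (@le_trans _ _ ((2 * X) `^ (2 * H))).
  by apply: ge0_ler_powR; rewrite ?nnegrE//; lra.
rewrite powRM//; apply: (@le_trans _ _ (4 * X `^ (2 * H))); first exact: ler_wpM2r.
lra.
Qed.

(** Chosen so that m kappa |z|^(2H) = (rate m |z|)^(2H); its growth m^(1/(2H)) is the source of the
    term 1/(2H) in the exponent. *)
Definition rate (m : nat) : R := (m%:R * kappa) `^ ((2 * H)^-1).

(** Unlike 1 / (1 + X^(2H)), the function (1 + X)^(-2H) has an elementary primitive; the factor 4 is
    the price of the replacement. *)
Definition decay_kernel (m : nat) (s t : R) : R :=
  4 * (1 + rate m * `|s - t|) `^ (- (2 * H)).

Lemma rate_gt0 m : (0 < m)%N -> 0 < rate m.
Proof. by move=> m0; rewrite powR_gt0// mulr_gt0 ?kappa_gt0// ltr0n. Qed.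

Lemma fbm_cov_exp_le (m : nat) (s t : R) : 0 < s <= T -> 0 < t <= T ->
  fbm_cov H s t ^+ m <= (s `^ H * t `^ H) ^+ m * decay_kernel m s t.
Proof.
move=> hs ht; have /andP[s0 sT] := hs; have /andP[t0 tT] := ht.
set y := kappa * `|s - t| `^ (2 * H).
have z0 : 0 <= `|s - t| `^ (2 * H) by exact: powR_ge0.
have y0 : 0 <= y by rewrite mulr_ge0// ltW// kappa_gt0.
have p0 : 0 < s `^ H * t `^ H by rewrite mulr_gt0// powR_gt0.
have c0 : 0 <= fbm_cov H s t by apply: (fbm_cov_ge0 hH); exact: ltW.
have cle := fbm_cov_le hs ht; rewrite -/y in cle.
have y1 : y <= 1.
  have := le_trans c0 cle; rewrite pmulr_rge0//; lra.
apply: (@le_trans _ _ ((s `^ H * t `^ H * (1 - y)) ^+ m)).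
  by apply: lerXn2r; rewrite ?nnegrE// (le_trans c0).
rewrite exprMn; apply: ler_wpM2l; first by rewrite exprn_ge0// ltW.
have my : 0 < 1 + m%:R * y by rewrite ltr_wpDr// mulr_ge0.
apply: (@le_trans _ _ (1 + m%:R * y)^-1).
  by rewrite -[leRHS]div1r ler_pdivlMr// onem_exp_le// y0.
have X0 : 0 <= rate m * `|s - t| by rewrite mulr_ge0// powR_ge0.
have -> : m%:R * y = (rate m * `|s - t|) `^ (2 * H).
  have mk0 : 0 <= m%:R * kappa by rewrite mulr_ge0// ltW// kappa_gt0.
  have H20 : 2 * H != 0 by rewrite mulf_neq0// gt_eqF.
  by rewrite powRM ?powR_ge0// /rate -powRrM mulVf// powRr1// mulrA.
have X1 : 0 < 1 + rate m * `|s - t| by rewrite ltr_wpDr.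
rewrite /decay_kernel powRN ler_pdivlMr ?powR_gt0// mulrC.
by rewrite ler_pdivrMr ?ltr_wpDr ?powR_ge0// powR_1D_le.
Qed.

Lemma decay_kernel_ge0 m s t : 0 <= decay_kernel m s t.
Proof. by rewrite mulr_ge0// powR_ge0. Qed.

Lemma measurable_decay_kernel m :
  measurable_fun setT (fun z : R * R => decay_kernel m z.1 z.2).
Proof.
apply: measurable_funM => //.
apply: (measurableT_comp (f := fun x : R => x `^ (- (2 * H)))
  (g := fun z : R * R => 1 + rate m * `|z.1 - z.2|)) => //.
apply: measurable_funD => //; apply: measurable_funM => //.
by apply: measurableT_comp => //; exact: measurable_funB.
Qed.

(** The odd primitive of (2H - 1) l (1 + l |z|)^(-2H); its values stay in [-1, 1], whatever l is. *)
Let sgdecay (l z : R) : R := Num.sg z * (1 - (1 + l * `|z|) `^ (1 - 2 * H)).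

Lemma continuous_decay_power (l p z : R) : 0 < l ->
  {for z, continuous (fun y : R => (1 + l * `|y|) `^ p)}.
Proof.
move=> l0; have := @continuous_comp R R R (fun y : R => 1 + l * `|y|) (fun y : R => y `^ p) z.
apply.
  apply: cvgD; first exact: cvg_cst.
  by apply: cvgM; [exact: cvg_cst|exact: norm_continuous].
apply/differentiable_continuous/derivable1_diffP/derivable_powR.
by rewrite in_itv/= andbT ltr_wpDr// mulr_ge0// ltW.
Qed.

Lemma is_derive_sgdecay (l z : R) : 0 < l -> z != 0 ->
  is_derive z 1 (sgdecay l) ((2 * H - 1) * l * (1 + l * `|z|) `^ (- (2 * H))).
Proof.
move=> l0 z0.
apply: (@near_eq_is_derive _ _ _
    (fun y => Num.sg z * (1 - (1 + l * (Num.sg z * y)) `^ (1 - 2 * H)))).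
  near=> y; rewrite /sgdecay.
  have -> : `|y| = Num.sg z * y by near: y; exact: near_norm.
  by congr (_ * _); apply/esym; near: y; exact: near_sg.
have X0 : 0 < 1 + l * (Num.sg z * z).
  by rewrite -normrEsg ltr_wpDr// mulr_ge0// ltW.
have h : is_derive z 1 (fun y : R => 1 + l * (Num.sg z * y)) (l * Num.sg z).
  by apply: is_derive_eq; rewrite /GRing.scale/=; ring.
have h2 := is_derive1_comp (f := fun y : R => y `^ (1 - 2 * H))
  (g := fun y : R => 1 + l * (Num.sg z * y)) (is_derive1_powR (1 - 2 * H) X0) h.
have h3 : is_derive z 1 (fun y : R => (1 + l * (Num.sg z * y)) `^ (1 - 2 * H)) _ := h2.
rewrite -normrEsg in h3.
have sg2 : Num.sg z * Num.sg z = 1 by rewrite -expr2 sqr_sg z0.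
rewrite (_ : 1 - 2 * H - 1 = - (2 * H)) in h3; last by ring.
apply: is_derive_eq; rewrite /GRing.scale/= -[RHS]mul1r -[X in _ = X * _]sg2; ring.
Unshelve. all: by end_near. Qed.

Lemma continuous_sgdecay (l z : R) : 0 < l -> {for z, continuous (sgdecay l)}.
Proof.
move=> l0; have [->|z0] := eqVneq z 0; last first.
  apply/differentiable_continuous/derivable1_diffP.
  by have [] := is_derive_sgdecay l0 z0.
have h := @continuous_decay_power l (1 - 2 * H) 0 l0.
apply/cvgrPdist_lt => e e0; move/cvgrPdist_lt : h => /(_ _ e0).
apply: filterS => x; rewrite /sgdecay normr0 mulr0 addr0 powR1 sgr0 mul0r sub0r normrN.
by rewrite normrM; apply: le_lt_trans; rewrite ler_piMl//; case: sgrP; rewrite ?normr0 ?normr1 ?normrN1.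
Qed.

Lemma sgdecay_le1 (l z : R) : 0 < l -> `|sgdecay l z| <= 1.
Proof.
move=> l0; rewrite normrM.
have X1 : 1 <= 1 + l * `|z| by rewrite lerDl mulr_ge0// ltW.
have p1 : 0 <= (1 + l * `|z|) `^ (1 - 2 * H) <= 1.
  rewrite powR_ge0/= -[leRHS](powRr0 (1 + l * `|z|)); apply: ler_powR => //.
  by case/andP: hH; lra.
apply: mulr_ile1 => //; first by case: sgrP; rewrite ?normr0 ?normr1 ?normrN1.
by rewrite ler_norml; case/andP: p1 => h1 h2; apply/andP; split; lra.
Qed.

Lemma integral_decay_kernel m s : (0 < m)%N -> 0 <= s <= T ->
  (\int[mu]_(t in `[0%R, T]) (decay_kernel m s t)%:E <=
   (8 / ((2 * H - 1) * rate m))%:E)%E.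
Proof.
move=> m0 /andP[s0 sT]; have l0 := rate_gt0 m0; set l := rate m in l0 *.
have p0 : 0 < 2 * H - 1 by case/andP: hH; lra.
have c0 : 0 < (2 * H - 1) * l by rewrite mulr_gt0.
pose c := 4 / ((2 * H - 1) * l).
have cp : 0 < c by rewrite divr_gt0.
pose F t := c * sgdecay l (t - s).
have -> : (\int[mu]_(t in `[0%R, T]) (decay_kernel m s t)%:E = (F T - F 0)%:E)%E.
  apply: (@ge0_FTC_off _ _ _ _ _ s).
  - exact: ltW.
  - exact: (measurableT_comp (measurable_decay_kernel m)
      (measurable_fun_pair (measurable_cst s) (@measurable_id _ _ setT))).
  - by move=> t; exact: decay_kernel_ge0.
  - move=> t _; apply: cvgM; first exact: cvg_cst.
    apply: (continuous_comp_reflect (F := fun y => (1 + l * `|y|) `^ (- (2 * H)))).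
    exact: continuous_decay_power.
  - move=> t _; apply: cvgM; first exact: cvg_cst.
    apply: (continuous_comp_shift (F := sgdecay l)); exact: continuous_sgdecay.
  move=> t _ ts; have ts0 : t - s != 0 by rewrite subr_eq0.
  have h := is_derive_comp_shift (is_derive_sgdecay l0 ts0).
  apply: is_derive_eq; rewrite /GRing.scale/= /decay_kernel -/l distrC /c.
  by field; rewrite !gt_eqF.
rewrite lee_fin /F -mulrBr.
(* The primitive varies by at most 2 over the interval. *)
have -> : 8 / ((2 * H - 1) * l) = c * 2 by rewrite /c; field; rewrite !gt_eqF.
apply: ler_wpM2l; first exact: ltW.
have := sgdecay_le1 (T - s) l0; have := sgdecay_le1 (0 - s) l0.
by rewrite !ler_norml => /andP[h1 _] /andP[_ h2]; lra.
Qed.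

End covariance_decay.

(** * The coefficients of the Dirac delta *)

Section delta_coefficients.
Context (R : realType) (H x : R) (H0 : 0 < H) (x0 : x != 0).
Implicit Types (n : nat) (s : R).

Lemma hermiteE n (y : R) :
  hermite n y = (-1) ^+ n / n`!%:R * expR (y ^+ 2 / 2) * dgauss n y.
Proof. by rewrite /hermite -(derive1n_gauss R). Qed.

(** At variance 0 the inverse of the square root is 0 by convention; for z <> 0 this is also the
    limit at the origin. *)
Lemma delta_coef0 n (z : R) : delta_coef H z n 0 = 0.
Proof.
rewrite /delta_coef /heat_kernel (@powR0 _ (2 * H)); last by rewrite mulf_neq0// gt_eqF.
by rewrite mulr0 sqrtr0 invr0 !mul0r mulr0 mul0r.
Qed.

(** The exponential of the heat kernel cancels the one in the Hermite polynomial, and a derivative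
    of the Gaussian remains. *)
Lemma delta_coefE n (z s : R) : 0 < s ->
  delta_coef H z n s = (-1) ^+ n / (n`!%:R * Num.sqrt (2 * pi)) *
    (s `^ H) ^- n.+1 * dgauss n (z / s `^ H).
Proof.
move=> s0; rewrite /delta_coef hermiteE.
set S := s `^ H; have S0 : 0 < S by exact: powR_gt0.
have -> : s `^ (- (n%:R * H)) = S ^- n.
  by rewrite powRN mulrC powRrM powR_mulrn// ltW.
have -> : s `^ (2 * H) = S ^+ 2 by rewrite mulrC powRrM powR_mulrn// ltW.
rewrite /heat_kernel.
have -> : Num.sqrt (2 * pi * S ^+ 2) = Num.sqrt (2 * pi) * S.
  by rewrite sqrtrM ?sqrtr_sqr ?gtr0_norm// mulr_ge0// pi_ge0.
have -> : (z / S) ^+ 2 / 2 = z ^+ 2 / (2 * S ^+ 2) by field; rewrite gt_eqF.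
set E := z ^+ 2 / _; rewrite expRN.
have E0 : expR E != 0 by rewrite gt_eqF// expR_gt0.
have P0 : Num.sqrt (2 * pi) != 0 :> R by rewrite gt_eqF// sqrtr_gt0 mulr_gt0// pi_gt0.
have f0 : n`!%:R != 0 :> R by rewrite pnatr_eq0 -lt0n fact_gt0.
have Sn0 : S ^+ n != 0 by rewrite expf_neq0// gt_eqF.
rewrite exprS; field; rewrite Sn0 P0 f0 E0 /=.
by rewrite gt_eqF.
Qed.

Lemma norm_delta_coef n (z s : R) : 0 < s ->
  `|delta_coef H z n s| = (n`!%:R * Num.sqrt (2 * pi))^-1 *
    (s `^ H) ^- n.+1 * `|dgauss n (z / s `^ H)|.
Proof.
move=> s0; rewrite delta_coefE// !normrM; congr (_ * _ * _).
- by rewrite normrX normrN1 expr1n mul1r ger0_norm.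
- by rewrite ger0_norm// invr_ge0 exprn_ge0// powR_ge0.
Qed.

Lemma sqrt2pi_ge1 : 1 <= Num.sqrt (2 * pi) :> R.
Proof. by rewrite -[leLHS]sqrtr1 ler_wsqrtr//; have := pi_ge2 R; lra. Qed.

Lemma dgauss_sq_le n (y : R) : (1 < n)%N ->
  ((5 + y ^+ 2) * dgauss n y) ^+ 2 <= 140 * n`!%:R / Num.sqrt n.+1%:R.
Proof.
move=> n1; set w := _ ^+ 2.
have hw := dgauss_weight n y; rewrite -/w in hw.
set r := Num.sqrt n.+1%:R; have r0 : 0 < r by rewrite sqrtr_gt0 ltr0n.
have r2 : r ^+ 2 = n.+1%:R by rewrite sqr_sqrtr.
have hg (k : nat) (c : R) : 0 < c -> c ^+ 2 <= k.+1%:R -> dgauss k 0 ^+ 2 <= k`!%:R / c.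
  move=> c0 ck; rewrite ler_pdivlMr//.
  have : (dgauss k 0 ^+ 2 * c) ^+ 2 <= k`!%:R ^+ 2.
    apply: le_trans (dgauss0_le R k); rewrite exprMn -exprM.
    by apply: ler_wpM2l => //; rewrite exprn_even_ge0.
  have q0 : 0 <= dgauss k 0 ^+ 2 * c by apply: mulr_ge0; [exact: sqr_ge0|exact: ltW].
  by rewrite ler_pXn2r ?nnegrE.
have h1 := hg n r r0; rewrite r2 lexx in h1; have {}h1 := h1 isT.
have h2 := hg n.+1 r r0; rewrite r2 ler_nat leqnSn in h2; have {}h2 := h2 isT.
rewrite factS natrM in h2.
set f := n`!%:R in h1 h2 *; have f0 : 0 <= f by rewrite ler0n.
have nr : 2 <= n%:R :> R by rewrite ler_nat.
set N := n%:R in hw nr *.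
rewrite -natr1 -/N in h2.
have fr0 : 0 <= f / r by rewrite divr_ge0// ltW.
have h2' : dgauss n.+1 0 ^+ 2 <= (N + 1) * (f / r) by rewrite mulrA.
rewrite -mulrA; set q := f / r in fr0 h1 h2' *.
(* The energy at 0 is at most (25 (N + 1) + 25 N + 15) q = (50 N + 40) q, and 50 N + 40 <= 140 (N -
   1) exactly when N >= 2. *)
have : (N - 1) * w <= (N - 1) * (140 * q); last by rewrite ler_pM2l//; lra.
apply: (le_trans hw).
apply: (@le_trans _ _ (25 * ((N + 1) * q) + (25 * N + 15) * q)).
  apply: lerD; first by apply: ler_wpM2l.
  by apply: ler_wpM2l => //; lra.
nra.
Qed.

(** After multiplication by s^(mH) a factor s^(-2H) = y^2 / x^2 is left, and y^2 is absorbed by the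
    weight in [dgauss_sq_le]. *)
Lemma delta_coef_sq_le (m : nat) s : (0 < m)%N -> 0 < s ->
  (`|delta_coef H x m.+1 s| * (s `^ H) ^+ m) ^+ 2 <=
  140 / x ^+ 4 / (m.+1`!%:R * Num.sqrt m.+2%:R).
Proof.
move=> m0 s0; rewrite norm_delta_coef//.
set S := s `^ H; have S0 : 0 < S by exact: powR_gt0.
have := @dgauss_sq_le m.+1 (x / S) m0.
set g := dgauss m.+1 _; set f := m.+1`!%:R; set r := Num.sqrt m.+2%:R => hg.
have f0 : 0 < f by rewrite ltr0n fact_gt0.
have r0 : 0 < r by rewrite sqrtr_gt0 ltr0n.
set P := Num.sqrt (2 * pi); have P1 : 1 <= P by exact: sqrt2pi_ge1.
have P0 : 0 < P by exact: lt_le_trans P1.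
have x2 : 0 < x ^+ 2 by rewrite exprn_even_gt0.
have g1 : (x ^+ 2 / S ^+ 2 * g) ^+ 2 <= 140 * f / r.
  apply: le_trans hg; rewrite exprMn [leRHS]exprMn; apply: ler_wpM2r; first exact: sqr_ge0.
  have h0 : 0 <= x ^+ 2 / S ^+ 2 by rewrite divr_ge0// ?sqr_ge0.
  apply: lerXn2r; rewrite ?nnegrE ?expr_div_n.
  - by [].
  - by rewrite addr_ge0.
  - by rewrite lerDr.
have -> : ((f * P)^-1 * S ^- m.+2 * `|g| * S ^+ m) ^+ 2 =
    (x ^+ 2 / S ^+ 2 * g) ^+ 2 * (f * P * x ^+ 2) ^- 2.
  rewrite (exprS S m.+1) (exprS S m).
  have q0 : S ^+ m != 0 by rewrite expf_neq0// gt_eqF.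
  move: (S ^+ m) q0 => q q0.
  rewrite mulrAC exprMn real_normK ?num_real//; field.
  by rewrite x0 q0 !gt_eqF.
apply: (@le_trans _ _ (140 * f / r * (f * P * x ^+ 2) ^- 2)).
  by apply: ler_wpM2r => //; rewrite invr_ge0 sqr_ge0.
rewrite (_ : 140 / x ^+ 4 / (f * r) = 140 * f / r * (f * x ^+ 2) ^- 2); last first.
  by field; rewrite ?x0 ?gt_eqF.
apply: ler_wpM2l; first by rewrite divr_ge0 ?mulr_ge0// ltW.
have a1 : 0 < f * x ^+ 2 by exact: mulr_gt0.
have a2 : 0 < f * P * x ^+ 2 by rewrite mulr_gt0// mulr_gt0.
rewrite lef_pV2 ?posrE ?exprn_gt0//.
apply: lerXn2r; rewrite ?nnegrE ?(ltW a1) ?(ltW a2)//.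
by apply: ler_wpM2r; [exact: ltW|rewrite ler_pMr].
Qed.

Lemma gauss_decay k : exists2 C : R, 0 <= C & forall y, `|y| ^+ k * gauss y <= C.
Proof.
have g1 (y : R) : gauss y <= 1.
  by rewrite /gauss -[leRHS]expR0 ler_expR oppr_le0 divr_ge0// sqr_ge0.
have g0 (y : R) : 0 <= gauss y by exact: expR_ge0.
case: k => [|k].
  by exists 1 => // y; rewrite expr0 mul1r.
(* With this [c], exp(y^2 / 2) is the (k+1)-th power of exp(y^2 / c), which is at least y^2 / c. *)
pose c : R := (2 * k.+1%:R).
have c0 : 0 < c by rewrite mulr_gt0// ltr0n.
exists (1 + c ^+ k.+1); first by rewrite addr_ge0// exprn_ge0// ltW.
move=> y.
have h1 : (y ^+ 2) ^+ k.+1 * gauss y <= c ^+ k.+1.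
  have h : (y ^+ 2 / c) ^+ k.+1 <= expR (y ^+ 2 / 2).
    have -> : y ^+ 2 / 2 = k.+1%:R * (y ^+ 2 / c) :> R.
      by rewrite /c; field; rewrite -(natrD _ 1) pnatr_eq0.
    rewrite expRM_natl; apply: lerXn2r; rewrite ?nnegrE ?expR_ge0//.
      by rewrite divr_ge0 ?sqr_ge0// ltW.
    by apply: le_trans (expR_ge1Dx _); rewrite lerDr.
  rewrite /gauss expRN ler_pdivrMr ?expR_gt0//.
  move: h; rewrite expr_div_n ler_pdivrMr ?exprn_gt0//.
  by rewrite mulrC.
apply: (@le_trans _ _ ((1 + (y ^+ 2) ^+ k.+1) * gauss y)).
  apply: ler_wpM2r => //.
  have [y1|/ltW y1] := leP `|y| 1.
    apply: (@le_trans _ _ 1); first exact: exprn_ile1.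
    by rewrite lerDl exprn_ge0// sqr_ge0.
  apply: (@le_trans _ _ ((y ^+ 2) ^+ k.+1)); last by rewrite lerDr.
  apply: lerXn2r; rewrite ?nnegrE ?sqr_ge0//.
  by rewrite -(real_normK (num_real y)) expr2 ler_peMl.
by rewrite mulrDl mul1r lerD.
Qed.

Lemma dgauss_decay n k :
  exists2 C : R, 0 <= C & forall y, `|y| ^+ k * `|dgauss n y| <= C.
Proof.
suff : (forall k, exists2 C : R, 0 <= C & forall y, `|y| ^+ k * `|dgauss n y| <= C) /\
  (forall k, exists2 C : R, 0 <= C & forall y, `|y| ^+ k * `|dgauss n.+1 y| <= C).
  by case=> + _; exact.
elim: n {k} => [|n [IH1 IH2]].
  split=> k; [have [C C0 hC] := gauss_decay k|have [C C0 hC] := gauss_decay k.+1];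
    exists C => // y.
    by rewrite (_ : `|dgauss 0 y| = gauss y)// ger0_norm// expR_ge0.
  by rewrite dgauss1 normrM normrN mulrA -exprSr (_ : `|gauss y| = gauss y)// ger0_norm// expR_ge0.
split=> // k; have [C1 C10 hC1] := IH2 k.+1; have [C2 C20 hC2] := IH1 k.
exists (C1 + n.+1%:R * C2); first by rewrite addr_ge0// mulr_ge0.
move=> y; rewrite dgaussSS.
apply: (@le_trans _ _ (`|y| ^+ k * (`|y| * `|dgauss n.+1 y| + n.+1%:R * `|dgauss n y|))).
  apply: ler_wpM2l; first exact: exprn_ge0.
  apply: (le_trans (ler_normB _ _)).
  by rewrite !normrM normrN [`|_%:R|]ger0_norm.
rewrite mulrDr mulrA -exprSr; apply: lerD => //.
by rewrite mulrCA; apply: ler_wpM2l.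
Qed.

(** Decay of order n + 3 in y = x / s^H outweighs the factor s^(-(n+1)H) and leaves s^(2H); the
    kernels are therefore bounded. *)
Lemma delta_coef_decay n : exists2 C : R, 0 <= C &
  forall s, 0 <= s -> `|delta_coef H x n s| <= C * (s `^ H) ^+ 2.
Proof.
have [C C0 hC] := dgauss_decay n n.+3.
exists (C / `|x| ^+ n.+3); first by rewrite divr_ge0// exprn_ge0.
move=> s; rewrite le_eqVlt => /predU1P[<-|s0].
  by rewrite delta_coef0 normr0 mulr_ge0 ?sqr_ge0// divr_ge0// exprn_ge0.
rewrite norm_delta_coef//; set S := s `^ H; have S0 : 0 < S by exact: powR_gt0.
have := hC (x / S); set g := dgauss n _ => hg.
have x1 : 0 < `|x| by rewrite normr_gt0.
have g1 : `|g| <= C * (S ^+ n.+3 / `|x| ^+ n.+3).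
  move: hg; rewrite normrM normfV (gtr0_norm S0) expr_div_n => hg.
  by rewrite -ler_pdivrMr ?divr_gt0 ?exprn_gt0// invf_div mulrC.
have f1 : (n`!%:R * Num.sqrt (2 * pi))^-1 <= 1 :> R.
  have h : 1 <= n`!%:R * Num.sqrt (2 * pi) :> R.
    by rewrite -[leLHS]mulr1; apply: ler_pM => //; rewrite ?sqrt2pi_ge1// ler1n fact_gt0.
  by rewrite invf_le1// (lt_le_trans ltr01).
have Sn : 0 <= S ^- n.+1 by rewrite invr_ge0 exprn_ge0// ltW.
apply: (@le_trans _ _ (1 * S ^- n.+1 * (C * (S ^+ n.+3 / `|x| ^+ n.+3)))).
  apply: ler_pM => //.
    by rewrite mulr_ge0// invr_ge0 mulr_ge0// sqrtr_ge0.
  exact: ler_wpM2r.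
rewrite le_eqVlt; apply/orP; left; apply/eqP.
rewrite (exprS S n.+2) (exprS S n.+1); field.
by rewrite !expf_neq0 ?gt_eqF.
Qed.

Lemma continuous_delta_coef n (z s : R) : 0 < s ->
  {for s, continuous (delta_coef H z n)}.
Proof.
move=> s0; pose c : R := (-1) ^+ n / (n`!%:R * Num.sqrt (2 * pi)).
have cS : {for s, continuous (fun t : R => t `^ H)}.
  apply/differentiable_continuous/derivable1_diffP/derivable_powR.
  by rewrite in_itv/= andbT.
have S0 : 0 < s `^ H by exact: powR_gt0.
have cg (y : R) : {for y, continuous (@dgauss R n)}.
  apply/differentiable_continuous/derivable1_diffP.
  by have [] := is_derive_dgauss n y.
have cf : {for s, continuous (fun t : R => c * (t `^ H) ^- n.+1 * dgauss n (z / t `^ H))}.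
  apply: cvgM.
    apply: cvgM; first exact: cvg_cst.
    apply: cvgV; first by rewrite expf_neq0// gt_eqF.
    have := @continuous_comp R R R (fun t : R => t `^ H) (fun y : R => y ^+ n.+1) s cS.
    by apply; exact: exprn_continuous.
  have := @continuous_comp R R R (fun t : R => z / t `^ H) (@dgauss R n) s.
  apply; last exact: cg.
  apply: cvgM; first exact: cvg_cst.
  by apply: cvgV => //; rewrite gt_eqF.
rewrite /prop_for /continuous_at delta_coefE//; apply: cvg_trans cf.
apply: near_eq_cvg; near=> t; rewrite delta_coefE//.
by near: t; exact: lt_nbhsr.
Unshelve. all: by end_near. Qed.

Lemma measurable_delta_coef n (z : R) : measurable_fun setT (delta_coef H z n).
Proof.
have -> : setT = (`]-oo, 0[ `|` [set 0]) `|` `]0, +oo[ :> set R.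
  apply/seteqP; split=> // s _ /=; rewrite !in_itv/= andbT.
  by case: (ltgtP s 0) => s0; [left; left|right|left; right].
apply/measurable_funU; [by apply: measurableU|exact: measurable_itv|split].
  apply/measurable_funU => //; split; last exact: measurable_fun_set1.
  (* Real powers of negative numbers are 1 by convention, so the coefficient is constant on the
     negative half-line. *)
  apply: (eq_measurable_fun (cst (delta_coef H z n (- 1)))) => // s.
  rewrite inE/= in_itv/= => s0.
  by rewrite /delta_coef !(lt0_powR1 _ s0) !lt0_powR1// ltrN10.
apply: open_continuous_measurable_fun; first exact: interval_open.
move=> s; rewrite inE/= in_itv/= andbT; exact: continuous_delta_coef.
Qed.

End delta_coefficients.

(** * The series of the norms *)

Section kernel_estimate.
Context (R : realType) (H T : R) (hH : 1 / 2 < H < 1) (hT : 0 < T).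
Context (x : R) (x0 : x != 0).
Notation mu := (@lebesgue_measure R).
Notation D := ([set` `[0%R, T]] : set R).

Let H0 : 0 < H. Proof. by case/andP: hH; lra. Qed.

Definition coef_bound (m : nat) : R :=
  140 / x ^+ 4 / (m.+1`!%:R * Num.sqrt m.+2%:R).

Lemma coef_bound_ge0 m : 0 <= coef_bound m.
Proof.
apply: divr_ge0; first by rewrite divr_ge0// exprn_even_ge0.
by apply: mulr_ge0; [exact: ler0n|exact: sqrtr_ge0].
Qed.

(** The product of the two bounded quantities is at most the mean of their squares. *)
Lemma coef_product_le m (s t : R) : (0 < m)%N -> 0 < s -> 0 < t ->
  `|delta_coef H x m.+1 s| * `|delta_coef H x m.+1 t| *
    (s `^ H * t `^ H) ^+ m <= coef_bound m.
Proof.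
move=> m0 s0 t0.
have hs := delta_coef_sq_le H x0 m0 s0.
have ht := delta_coef_sq_le H x0 m0 t0.
rewrite -/(coef_bound m) in hs ht.
rewrite exprMn mulrACA.
set p := _ * _ in hs *; set q := _ * (t `^ H) ^+ m in ht *.
by have := sqr_ge0 (p - q); rewrite sqrrB mulr2n; lra.
Qed.

Lemma fbm_cov_le_prod (s t : R) : 0 < s <= T -> 0 < t <= T ->
  fbm_cov H s t <= s `^ H * t `^ H.
Proof.
move=> hs ht; apply: (le_trans (fbm_cov_le hH hT hs ht)).
have /andP[s0 _] := hs; have /andP[t0 _] := ht.
apply: ler_piMr; first by rewrite mulr_ge0// powR_ge0.
by rewrite gerBl mulr_ge0// ?powR_ge0// ltW// (kappa_gt0 hH hT).
Qed.

Definition diag_const : R := T `^ (2 * H) * density_bound H T * T.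
Definition off_const : R := density_bound H T ^+ 2 * (8 * T / (2 * H - 1)).

Lemma diag_const_ge0 : 0 <= diag_const.
Proof.
apply: mulr_ge0; last exact: ltW.
by apply: mulr_ge0; [exact: powR_ge0|exact: density_bound_ge0].
Qed.

Lemma off_const_ge0 : 0 <= off_const.
Proof.
apply: mulr_ge0; first exact: sqr_ge0.
by apply: divr_ge0; [rewrite mulr_ge0// ltW|case/andP: hH; lra].
Qed.

(** The order is N = m + 2, the coefficient has index m + 1, and the power of the covariance left in
    the pairs of distinct functions is m. In the pairs of equal functions it is m + 1, and the extra
    factor is bounded by T^(2H). *)
Lemma kernel_norm_le m : (0 < m)%N ->
  (abs_ip H T (symmetrize (@adapted_kernel R (delta_coef H x m.+1) m.+1))
     (symmetrize (@adapted_kernel R (delta_coef H x m.+1) m.+1)) <=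
   (coef_bound m * (diag_const / m.+2%:R + off_const / rate H T m))%:E)%E.
Proof.
move=> m0; set w := coef_bound m; have w0 : 0 <= w by exact: coef_bound_ge0.
have l0 : 0 < rate H T m by exact: rate_gt0.
pose a s := `|delta_coef H x m.+1 s|.
have ma : measurable_fun setT (delta_coef H x m.+1) by exact: measurable_delta_coef.
have maa : measurable_fun setT a by exact: measurableT_comp.
have a0 s : 0 <= a s by exact: normr_ge0.
have az : a 0 = 0 by rewrite /a delta_coef0// normr0.
(* The estimates of the covariance need s, t > 0; on the axes the coefficients vanish. *)
have case0 (P : R -> R -> Prop) : (forall s t, 0 < s <= T -> 0 < t <= T -> P s t) ->
    (forall s t, a s * a t = 0 -> P s t) ->
    forall s t, 0 <= s <= T -> 0 <= t <= T -> P s t.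
  move=> h1 h2 s t /andP[s0 sT] /andP[t0 tT].
  move: s0 t0; rewrite le_eqVlt => /predU1P[<- _|s0].
    by apply: h2; rewrite az mul0r.
  rewrite le_eqVlt => /predU1P[<-|t0]; first by apply: h2; rewrite az mulr0.
  by apply: h1; rewrite ?s0 ?t0.
rewrite mulrDr.
have -> : w * (diag_const / m.+2%:R) =
   (w * T `^ (2 * H)) * density_bound H T * T / m.+2%:R.
  by rewrite /diag_const !mulrA.
have c0 : 0 <= w * T `^ (2 * H) by rewrite mulr_ge0// powR_ge0.
apply: (abs_ip_symmetrize_le hH ma).
- by apply: mulr_ge0; [apply: mulr_ge0 => //; exact: density_bound_ge0|exact: ltW].
- by rewrite mulr_ge0// divr_ge0 ?off_const_ge0// ltW.
- move=> i; apply: (abs_ip_diag hH hT maa a0 i c0).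
  apply: case0 => s t; last by move=> ->; rewrite mul0r.
  move=> hs ht; have /andP[s0 sT] := hs; have /andP[t0 tT] := ht.
  have r0 : 0 <= fbm_cov H s t by apply: (fbm_cov_ge0 hH); exact: ltW.
  have r1 := fbm_cov_le_prod hs ht.
  have st : s `^ H * t `^ H <= T `^ (2 * H).
    rewrite (powR2 _ (ltW hT)) expr2; apply: ler_pM; rewrite ?powR_ge0//;
      by apply: ge0_ler_powR; rewrite ?nnegrE ?(ltW H0) ?(ltW hT) ?(ltW s0) ?(ltW t0).
  rewrite exprSr mulrA; apply: ler_pM => //.
  + by apply: mulr_ge0; [exact: mulr_ge0|exact: exprn_ge0].
  + apply: (le_trans _ (coef_product_le m0 s0 t0)); apply: ler_wpM2l; first exact: mulr_ge0.
    by apply: lerXn2r; rewrite ?nnegrE// (le_trans r0).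
  + exact: le_trans st.
move=> i j ij.
apply: (le_trans (abs_ip_off hH hT maa a0 (q := fun s t => w * decay_kernel H T m s t) ij _ _ _)).
- by move=> s t; rewrite mulr_ge0// decay_kernel_ge0.
- by apply: measurable_funM => //; exact: measurable_decay_kernel.
- apply: case0 => s t; last by move=> ->; rewrite mul0r mulr_ge0// decay_kernel_ge0.
  move=> hs ht; have /andP[s0 sT] := hs; have /andP[t0 tT] := ht.
  apply: (@le_trans _ _ (a s * a t * ((s `^ H * t `^ H) ^+ m * decay_kernel H T m s t))).
    by apply: ler_wpM2l; [exact: mulr_ge0|exact: fbm_cov_exp_le].
  rewrite mulrA; apply: ler_wpM2r; first exact: decay_kernel_ge0.
  exact: coef_product_le.
pose k := density_bound H T ^+ 2 * w.
have k0 : 0 <= k by rewrite mulr_ge0// sqr_ge0.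
pose e := 8 / ((2 * H - 1) * rate H T m).
have mdk s : measurable_fun setT (fun t => decay_kernel H T m s t).
  exact: (measurableT_comp (measurable_decay_kernel H T m)
      (measurable_fun_pair (measurable_cst s) (@measurable_id _ _ setT))).
have inner s : (0 <= s <= T) ->
  (\int[mu]_(t in D) (density_bound H T ^+ 2 * (w * decay_kernel H T m s t))%:E <=
   (k * e)%:E)%E.
  move=> hs.
  rewrite (_ : \int[mu]_(t in D) _ = k%:E * \int[mu]_(t in D) (decay_kernel H T m s t)%:E)%E.
    by rewrite [leRHS]EFinM; apply: lee_wpmul2l; [rewrite lee_fin|exact: integral_decay_kernel].
  rewrite -ge0_integralZl_EFin//.
  - by apply: eq_integral => t _; rewrite -EFinM mulrA.
  - by move=> t _; rewrite lee_fin decay_kernel_ge0.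
  - by apply: measurable_funTS; apply/measurable_EFinP; exact: mdk.
apply: (@le_trans _ _ (\int[mu]_(s in D) (cst (k * e)%:E s))%E).
  apply: ge0_le_integral => //.
  - move=> s _; apply: integral_ge0 => t _; rewrite lee_fin.
    by rewrite mulr_ge0 ?sqr_ge0// mulr_ge0// decay_kernel_ge0.
  - apply: measurable_funTS; apply: measurable_integral_param => //.
      apply/measurable_EFinP; apply: measurable_funM => //; apply: measurable_funM => //.
      exact: measurable_decay_kernel.
    by move=> s t; rewrite lee_fin mulr_ge0 ?sqr_ge0// mulr_ge0// decay_kernel_ge0.
rewrite (_ : (\int[mu]_(s in D) _)%E = ((k * e)%:E * mu D)%E); last exact: integral_cst.
rewrite (measure_box1 (ltW hT)) -EFinM lee_fin le_eqVlt; apply/orP; left; apply/eqP.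
have p0 : 0 < 2 * H - 1 by case/andP: hH; lra.
by rewrite /k /e /off_const; field; rewrite !gt_eqF.
Qed.

End kernel_estimate.

Section power_series.
Context (R : realType).

(** The mean value theorem for y^(1-p); it makes the comparison series telescope. *)
Lemma powR_telescope (p y : R) : 1 < p -> 0 < y ->
  (p - 1) * (y + 1) `^ (- p) <= y `^ (1 - p) - (y + 1) `^ (1 - p).
Proof.
move=> p1 y0.
have yy : y < y + 1 by rewrite ltrDl.
have pos z : y <= z -> 0 < z by exact: lt_le_trans.
have [c cy] : exists2 c, c \in `]y, (y + 1)[%R &
    (y + 1) `^ (1 - p) - y `^ (1 - p) = (1 - p) * c `^ (1 - p - 1) * (y + 1 - y).
  apply: (@MVT R (fun z => z `^ (1 - p)) (fun z => (1 - p) * z `^ (1 - p - 1)) _ _ yy).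
    move=> z; rewrite in_itv/= => /andP[/ltW/pos z0 _].
    exact: is_derive1_powR.
  apply: derivable_within_continuous => z; rewrite in_itv/= => /andP[/pos z0 _].
  by apply: derivable_powR; rewrite in_itv/= andbT.
rewrite in_itv/= in cy; case/andP: cy => yc cy.
rewrite (_ : 1 - p - 1 = - p); last by ring.
rewrite (_ : y + 1 - y = 1); last by ring.
move=> e; rewrite -[leRHS]opprB e mulr1 -mulNr opprB.
apply: ler_wpM2l; first by rewrite subr_ge0 ltW.
have c0 : 0 < c by exact/pos/ltW.
rewrite !powRN lef_pV2 ?posrE ?powR_gt0//; last by rewrite addr_gt0.
by apply: ge0_ler_powR; rewrite ?nnegrE ?(ltW c0) ?(ltW cy)//; lra.
Qed.

Lemma series_powR_lty (u : nat -> R) (C p : R) : 1 < p -> 0 <= C ->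
  (forall n, 0 <= u n) ->
  (forall n, (2 < n)%N -> u n <= C * (1 + n%:R) `^ (- p)) ->
  (\sum_(0 <= n <oo) (u n)%:E < +oo)%E.
Proof.
move=> p1 C0 u0 hu.
have p10 : 0 < p - 1 by rewrite subr_gt0.
pose K := C / (p - 1); have K0 : 0 <= K by rewrite divr_ge0// ltW.
pose b := \sum_(0 <= i < 3) u i + K.
(* The subtracted term bounds the tail and is what the telescoping inequality decreases at each
   step. *)
have part k : \sum_(0 <= i < k + 3) u i <= b - K * (k + 3)%:R `^ (1 - p).
  elim: k => [|k IH].
    rewrite add0n /b -addrA lerDl subr_ge0 ler_piMr//.
    rewrite -[leRHS](powRr0 (3 : R)); apply: ler_powR; [by rewrite ler1n|lra].
  rewrite addSn big_nat_recr//=.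
  have y0 : 0 < (k + 3)%:R :> R by rewrite ltr0n addn3.
  have h1 := powR_telescope p1 y0.
  have h2 : u (k + 3)%N <= C * (1 + (k + 3)%:R) `^ (- p) by apply: hu; rewrite addn3.
  have h3 : C * (1 + (k + 3)%:R) `^ (- p) =
      K * ((p - 1) * ((k + 3)%:R + 1) `^ (- p)).
    by rewrite /K [1 + _]addrC; field; rewrite gt_eqF.
  have h4 := ler_wpM2l K0 h1.
  rewrite -[(k + 3).+1]addn1 natrD; lra.
have bnd k : \sum_(0 <= i < k) u i <= b.
  apply: (@le_trans _ _ (\sum_(0 <= i < k + 3) u i)).
    rewrite (@big_cat_nat _ _ _ k 0 (k + 3)) ?leq_addr//= lerDl.
    exact: sumr_ge0.
  by apply: (le_trans (part k)); rewrite gerBl mulr_ge0// powR_ge0.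
apply: (@le_lt_trans _ _ b%:E); last exact: ltry.
apply: lime_le.
  by apply: is_cvg_nneseries => n _ _; rewrite lee_fin.
by apply: nearW => k; rewrite sumEFin lee_fin.
Qed.

End power_series.

Section term_bound.
Context (R : realType) (H T : R) (hH : 1 / 2 < H < 1) (hT : 0 < T).
Context (x : R) (x0 : x != 0).

Let H0 : 0 < H. Proof. by case/andP: hH; lra. Qed.

(** With N = m + 2, the factorial times [coef_bound] is a constant times sqrt N, which leaves A /
    sqrt N and B sqrt N / m^c for c = 1/(2H). Both are compared with (1 + N)^(1/2 - c), using 1 + N
    <= 4 N and 1 + N <= 4 m. *)
Lemma sobolev_term_le (alpha : R) : exists2 C : R, 0 <= C &
  forall m, (0 < m)%N ->
  (1 + m.+2%:R) `^ (- alpha) * m.+2`!%:R *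
    (coef_bound x m * (diag_const H T / m.+2%:R + off_const H T / rate H T m)) <=
  C * (1 + m.+2%:R) `^ (- (alpha - 1 / 2 + 1 / (2 * H))).
Proof.
pose A := diag_const H T; have A0 : 0 <= A by exact: diag_const_ge0.
pose c := (2 * H)^-1; have c0 : 0 < c by rewrite invr_gt0 mulr_gt0.
(* This makes N^(-1/2), from the pairs of equal functions, at most of the order N^(1/2 - c) of the
   others. *)
have c1 : c <= 1.
  rewrite invf_le1 ?mulr_gt0//; case/andP: hH; lra.
pose kc := kappa H T `^ c; have kc0 : 0 < kc by rewrite powR_gt0// kappa_gt0.
pose B := off_const H T / kc; have B0 : 0 <= B by rewrite divr_ge0 ?off_const_ge0// ltW.
pose X := 140 / x ^+ 4; have X0 : 0 <= X by rewrite divr_ge0// exprn_even_ge0.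
exists (X * (2 * A + 4 * B)); first by rewrite mulr_ge0// addr_ge0// mulr_ge0.
move=> m m0.
pose y : R := 1 + m.+2%:R; rewrite -/y.
have y1 : 1 <= y by rewrite lerDl.
have y0 : 0 < y by exact: lt_le_trans y1.
pose q := Num.sqrt (m.+2%:R : R).
have q0 : 0 < q by rewrite sqrtr_gt0 ltr0n.
have qq : q * q = m.+2%:R by rewrite -expr2 sqr_sqrtr.
have f0 : 0 < m.+1`!%:R :> R by rewrite ltr0n fact_gt0.
have rE : rate H T m = m%:R `^ c * kc.
  by rewrite /rate -/c powRM// ltW// kappa_gt0.
have m1 : 0 < m%:R :> R by rewrite ltr0n.
have mc0 : 0 < m%:R `^ c :> R by exact: powR_gt0.
rewrite -mulrA.
have -> : (m.+2)`!%:R * (coef_bound x m * (diag_const H T / m.+2%:R + off_const H T / rate H T m)) =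
    X * (A / q + B * q / m%:R `^ c).
  rewrite /coef_bound -/X -/q rE factS natrM -qq /B -/A.
  by field; rewrite !gt_eqF.
have y12 : y `^ 2^-1 = Num.sqrt y by rewrite powR12_sqrt// ltW.
set sy := Num.sqrt y in y12.
have sy0 : 0 < sy by rewrite sqrtr_gt0.
have syy : sy * sy = y by rewrite -expr2 sqr_sqrtr// ltW.
pose Y := y `^ (2^-1 - c).
have -> : y `^ (- (alpha - 1 / 2 + 1 / (2 * H))) = y `^ (- alpha) * Y.
  rewrite -powRD; last by apply/implyP => _; rewrite gt_eqF.
  by congr (_ `^ _); rewrite /c; field; rewrite gt_eqF.
have Y1 : sy^-1 <= Y.
  rewrite -y12 -powRN; apply: ler_powR => //; lra.
have Y2 : Y = sy / y `^ c.
  by rewrite /Y powRB ?y12//; apply/implyP => _; rewrite gt_eqF.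
have yc0 : 0 < y `^ c by exact: powR_gt0.
have hq : sy <= 2 * q.
  have h : sy ^+ 2 <= (2 * q) ^+ 2.
    rewrite expr2 syy exprMn (expr2 q) qq /y.
    rewrite -[m.+2]addn2 natrD; lra.
  by move: h; rewrite ler_pXn2r ?nnegrE ?(ltW sy0)// mulr_ge0// ltW.
have hq' : q <= sy.
  have h : q ^+ 2 <= sy ^+ 2 by rewrite !expr2 syy qq /y lerDr.
  by move: h; rewrite ler_pXn2r ?nnegrE ?(ltW sy0) ?(ltW q0).
have hm : y `^ c <= 4 * m%:R `^ c.
  apply: (@le_trans _ _ ((4 * m%:R) `^ c)).
    apply: ge0_ler_powR; rewrite ?nnegrE ?(ltW y0) ?(ltW c0) ?mulr_ge0//.
    have : 1 <= m%:R :> R by rewrite ler1n.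
    by rewrite /y -[m.+2]addn2 natrD; lra.
  rewrite powRM ?(ltW m1)//; apply: ler_wpM2r; first exact: ltW.
  by rewrite -[leRHS]powRr1//; apply: ler_powR => //; rewrite ler1n.
have Y0 : 0 < Y by exact: powR_gt0.
have t1 : A / q <= 2 * A * Y.
  rewrite [leRHS]mulrAC mulrC; apply: ler_wpM2r => //.
  apply: (@le_trans _ _ (2 * sy^-1)); last by rewrite ler_pM2l.
  by rewrite -[leLHS]mul1r ler_pdivrMr// mulrAC ler_pdivlMr// mul1r.
have t2 : B * q / m%:R `^ c <= 4 * B * Y.
  rewrite -mulrA [leRHS]mulrAC mulrC; apply: ler_wpM2r => //.
  rewrite Y2 ler_pdivrMr//.
  have -> : 4 * (sy / y `^ c) * m%:R `^ c = sy * (4 * m%:R `^ c / y `^ c) by ring.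
  rewrite -[leLHS]mulr1; apply: ler_pM => //; first exact: ltW.
  by rewrite ler_pdivlMr// mul1r.
rewrite [leRHS]mulrCA; apply: ler_wpM2l; first exact: powR_ge0.
rewrite -[leRHS]mulrA; apply: ler_wpM2l => //; rewrite mulrDl; exact: lerD.
Qed.

End term_bound.

(** * Approximation by step functions on grids *)

Section grid.
Context (R : realType) (a : R -> R).

(** The sum over 1 <= k <= m of a(kh) 1_](k-1)h,kh] (u_0) times the product of the 1_[0,kh] (u_i),
    the first indicator being a difference of two indicators of intervals starting at 0. *)
Fixpoint grid (h : R) n (m : nat) : step R n.+1 :=
  if m is m'.+1 then
    grid h n m' ++
    [:: (a (m%:R * h), fun=> m%:R * h);
        (- a (m%:R * h), fcons (m'%:R * h) (fun=> m%:R * h))]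
  else [::].

Lemma step_fun_gridS h n m u : step_fun (grid h n m.+1) u =
  step_fun (grid h n m) u + a (m.+1%:R * h) *
   (ind (m.+1%:R * h) (u ord0) - ind (m%:R * h) (u ord0)) *
   \prod_(i < n) ind (m.+1%:R * h) (ftail u i).
Proof.
rewrite /= step_fun_cat; congr (_ + _).
rewrite /step_fun !big_cons big_nil addr0/= !big_ord_recl/= /fcons unlift_none.
under [in X in _ + X = _]eq_bigr do rewrite liftK.
by rewrite mulNr -mulrBr -mulrBl mulrA.
Qed.

Lemma boxed_grid T h n m : 0 <= h -> m%:R * h <= T -> boxed T (grid h n m).
Proof.
move=> h0; elim: m => [|m ih] mT; first by move=> i.
have mh : m%:R * h <= m.+1%:R * h by rewrite ler_wpM2r// ler_nat.
have m0 k : 0 <= k%:R * h by rewrite mulr_ge0.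
apply: boxed_cat; first by apply: ih; exact: (le_trans mh).
case=> [|[|//]] _ i /=; first by rewrite m0.
by rewrite /fcons; case: unlift => [_|]; rewrite m0//= (le_trans mh).
Qed.

Lemma ind1 (s t : R) : 0 <= t -> t <= s -> ind s t = 1.
Proof.
by move=> t0 ts; rewrite /ind indicE mem_set//= in_itv/= t0.
Qed.

Lemma ind0 (s t : R) : s < t -> ind s t = 0.
Proof.
move=> st; rewrite /ind indicE memNset//= in_itv/= => /andP[_].
by rewrite leNgt st.
Qed.

Lemma step_fun_grid0 h n m (u : 'I_n.+1 -> R) : 0 <= h ->
  u ord0 = 0 \/ m%:R * h < u ord0 -> step_fun (grid h n m) u = 0.
Proof.
move=> h0; elim: m => [_|m ih hm]; first by rewrite /step_fun big_nil.
have m0 k : 0 <= k%:R * h by rewrite mulr_ge0.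
have mh : m%:R * h <= m.+1%:R * h by rewrite ler_wpM2r// ler_nat.
rewrite step_fun_gridS ih; last by case: hm => [|hm]; [left|right; exact: le_lt_trans hm].
case: hm => [->|hm]; first by rewrite !ind1// subrr mulr0 mul0r addr0.
by rewrite !ind0// ?(le_lt_trans mh)// subrr mulr0 mul0r addr0.
Qed.

(** The witness is the right end of the cell containing [u ord0]. *)
Lemma step_fun_grid h n m (u : 'I_n.+1 -> R) : 0 <= h -> 0 < u ord0 <= m%:R * h ->
  exists s, [/\ u ord0 <= s, s <= u ord0 + h, s <= m%:R * h &
    step_fun (grid h n m) u = a s * \prod_(i < n) ind s (ftail u i)].
Proof.
move=> h0; elim: m => [|m ih] /andP[u0 um].
  by move: um; rewrite mul0r leNgt u0.
have mh : m.+1%:R * h = m%:R * h + h by rewrite mulrSr mulrDl mul1r.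
have [um'|mu] := leP (u ord0) (m%:R * h).
  have [s [s1 s2 s3 s4]] := ih (introT andP (conj u0 um')); exists s; split=> //.
    by rewrite mh ler_wpDr.
  rewrite step_fun_gridS s4 !ind1 ?(ltW u0)// ?mh ?ler_wpDr//.
  by rewrite subrr mulr0 mul0r addr0.
exists (m.+1%:R * h); split=> //; first by rewrite mh lerD2r ltW.
rewrite step_fun_gridS step_fun_grid0//; last by right.
by rewrite (ind0 mu) ind1 ?(ltW u0)// subr0 mulr1 add0r.
Qed.

Variables (T : R) (n : nat) (M : R).
Hypotheses (hT : 0 < T) (a0 : a 0 = 0) (aM : forall s, 0 <= s <= T -> `|a s| <= M).
Hypothesis ca : forall s, 0 < s -> {for s, continuous a}.

Let h k : R := T / k.+1%:R.
Let g k := grid (h k) n k.+1.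

Let h0 k : 0 <= h k. Proof. by rewrite divr_ge0// ltW. Qed.

Let hE k : k.+1%:R * h k = T. Proof. by rewrite mulrCA divff ?mulr1. Qed.

Lemma boxed_grid_T k : boxed T (g k).
Proof. by apply: boxed_grid; rewrite ?hE. Qed.

Lemma adapted_kernel_bound (b : R -> R) s (u : 'I_n -> R) : `|b s| <= M ->
  `|b s * \prod_(i < n) ind s (u i)| <= M.
Proof.
move=> bM; rewrite normrM (le_trans _ bM)// ler_piMr// normr_prod.
apply: prodr_ile1 => i _.
by rewrite normr_ge0/= /ind indicE; case: (_ \in _); rewrite ?normr0 ?normr1 ?ler01.
Qed.

Let M0 : 0 <= M.
Proof. by apply: (le_trans (normr_ge0 (a 0))); rewrite aM// lexx ltW. Qed.

Lemma step_fun_grid_bound k u : in_box T u -> `|step_fun (g k) u| <= M.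
Proof.
move=> hu; have /andP[] := hu ord0; rewrite le_eqVlt => /predU1P[u0 _|u0 uT].
  by rewrite step_fun_grid0// ?normr0//; left.
have [|s [s1 s2 s3 ->]] := @step_fun_grid (h k) n k.+1 u (h0 k).
  by rewrite hE u0.
by apply: adapted_kernel_bound; rewrite aM// -(hE k) s3 (le_trans _ s1)// ltW.
Qed.

Lemma step_fun_grid_cvg u : in_box T u ->
  (fun k => step_fun (g k) u) @ \oo --> adapted_kernel a u.
Proof.
move=> hu; have /andP[] := hu ord0; rewrite le_eqVlt => /predU1P[u0 _|u0 uT].
  rewrite /adapted_kernel -u0 a0 mul0r.
  rewrite (_ : (fun k => _) = fun=> 0); first exact: cvg_cst.
  by apply/funext => k; rewrite step_fun_grid0//; left.
have hu0 k : 0 < u ord0 <= k.+1%:R * h k by rewrite hE u0.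
have /boolp.choice[s hs] k := @step_fun_grid (h k) n k.+1 u (h0 k) (hu0 k).
have sc : s @ \oo --> u ord0.
  apply: (@squeeze_cvgr _ _ _ _ (fun=> u ord0) (fun k => u ord0 + h k)).
  - by apply: nearW => k; have [-> -> _ _] := hs k.
  - exact: cvg_cst.
  rewrite -[X in _ --> X]addr0; apply: cvgD; first exact: cvg_cst.
  rewrite -[X in _ --> X](mulr0 T); apply: cvgMr; exact: cvg_harmonic.
rewrite (_ : (fun k => _) = fun k => a (s k) * \prod_(i < n) ind (s k) (ftail u i)); last first.
  by apply/funext => k; have [_ _ _ ->] := hs k.
apply: cvgM; first by apply: (cvg_comp _ _ sc); exact: ca.
apply: cvg_near_cst.
(* The points s_k approach u_0 from above: the indicators with u_i <= u_0 are 1 for every k, even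
   when u_i = u_0, and those with u_i > u_0 vanish eventually. *)
have : \forall k \near \oo, forall i, ind (s k) (ftail u i) = ind (u ord0) (ftail u i).
  apply: filter_forall => i; have [ui|ui] := leP (ftail u i) (u ord0).
    apply: nearW => k; have [s1 _ _ _] := hs k.
    by have /andP[ui0 _] := hu (lift ord0 i); rewrite !ind1// (le_trans ui).
  by apply: filterS (cvgr_lt _ sc _ ui) => k sk; rewrite !ind0.
by apply: filterS => k hk; apply: eq_bigr => i _; exact: hk.
Qed.

Definition step_sym p (w : step R p) : step R p :=
  [seq ((p`!%:R)^-1 * c.1, c.2) |
    c <- flatten [seq step_perm sg w | sg : 'S_p]].

Lemma step_fun_sym p (w : step R p) u :
  step_fun (step_sym w) u = symmetrize (step_fun w) u.
Proof.
rewrite /step_fun big_map big_flatten big_map big_enum/= /symmetrize.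
under eq_bigr do under eq_bigr do rewrite -mulrA.
under eq_bigr do rewrite -mulr_sumr -/(step_fun _ _) step_fun_perm.
by rewrite -mulr_sumr (reindex_inj (@invg_inj _))/=; under eq_bigr do rewrite invgK.
Qed.

Lemma boxed_sym p (w : step R p) : boxed T w -> boxed T (step_sym w).
Proof.
move=> bw i; rewrite size_map => ih; rewrite (nth_map (0, fun=> 0))//=.
have bl (l : seq 'S_p) : boxed T (flatten [seq step_perm sg w | sg <- l]).
  by elim: l => [|sg l IH]; [move=> j|apply: boxed_cat => //; exact: boxed_perm].
exact: bl.
Qed.

Lemma symmetrize_cvg p (w : nat -> ('I_p -> R) -> R) f u :
  (forall v, in_box T v -> (fun k => w k v) @ \oo --> f v) -> in_box T u ->
  (fun k => symmetrize (w k) u) @ \oo --> symmetrize f u.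
Proof.
move=> wf hu; apply: cvgMr; apply: cvg_big => [|s _]; first exact: add_continuous.
by apply: wf => i; exact: hu.
Qed.

Lemma symmetrize_bound p (f : ('I_p -> R) -> R) u :
  (forall v, in_box T v -> `|f v| <= M) -> in_box T u -> `|symmetrize f u| <= M.
Proof.
move=> fM hu; rewrite normrM ger0_norm ?invr_ge0// ler_pdivrMl ?ltr0n ?fact_gt0//.
apply: (le_trans (ler_norm_sum _ _ _)); apply: (@le_trans _ _ (\sum_(s : 'S_p) M)).
  by apply: ler_sum => s _; apply: fM => i; exact: hu.
by rewrite sumr_const card_Sn mulr_natl.
Qed.

End grid.

(** * The Skorohod integral for x <> 0: existence and regularity *)

Section existence.
Context d (Omega : measurableType d) (R : realType) (P : probability Omega R).
Context (H T : R) (hH : 1 / 2 < H < 1) (hT : 0 < T).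
Context (x : R) (x0 : x != 0).

Let H0 : 0 < H. Proof. by case/andP: hH; lra. Qed.

Lemma delta_coef_bounded n : exists2 M : R, 0 <= M &
  forall s, 0 <= s <= T -> `|delta_coef H x n s| <= M.
Proof.
have [C C0 hC] := delta_coef_decay H0 x0 n.
exists (C * (T `^ H) ^+ 2); first by rewrite mulr_ge0// sqr_ge0.
move=> s /andP[s0 sT]; apply: (le_trans (hC _ s0)); rewrite ler_wpM2l//.
by rewrite lerXn2r ?nnegrE ?powR_ge0// ge0_ler_powR ?nnegrE ?(ltW H0) ?(ltW hT).
Qed.

Lemma skorohod_kernel_bounded n : exists2 M : R, 0 <= M &
  forall u, in_box T u -> `|skorohod_kernel (delta_kernel H x) (n:=n) u| <= M.
Proof.
case: n => [|n]; first by exists 0 => // u _; rewrite /= normr0.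
have [M M0 hM] := delta_coef_bounded n; exists M => // u hu.
apply: symmetrize_bound hu => v hv; apply: adapted_kernel_bound; exact: hM.
Qed.

Lemma rmeasurable_skorohod_kernel n :
  rmeasurable (skorohod_kernel (delta_kernel H x) (n:=n)).
Proof.
case: n => [|n]; first by move=> d' Y g mg; exact: measurable_cst.
by apply: rmeasurable_symmetrize; exact: measurable_delta_coef.
Qed.

Lemma skorohod_kernel_perm n (s : 'S_n) u :
  skorohod_kernel (delta_kernel H x) (n:=n) (fun i => u (s i)) =
  skorohod_kernel (delta_kernel H x) (n:=n) u.
Proof. by case: n s u => // n s u; exact: symmetrize_perm. Qed.

Lemma skorohod_kernel_represented n :
  exists phi : tensor H T n, represents phi (skorohod_kernel (delta_kernel H x) (n:=n)).
Proof.
case: n => [|n].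
  apply: (@tensor_exists R H T hH hT 0 (fun=> 0) 0 _ _ _ (fun=> [::])) => //.
  - by move=> u _; rewrite normr0 lexx.
  - by move=> k u _; rewrite /step_fun big_nil normr0 lexx.
  - move=> u _; rewrite (_ : (fun k => _) = fun=> 0); first exact: cvg_cst.
    by apply/funext => k; rewrite /step_fun big_nil.
have [M M0 hM] := delta_coef_bounded n.
have c0 := delta_coef0 H0 n x.
have cc s : 0 < s -> {for s, continuous (delta_coef H x n)}.
  exact: continuous_delta_coef.
apply: (@tensor_exists R H T hH hT n.+1 _ M _ _ _
  (fun k => step_sym (grid (delta_coef H x n) (T / k.+1%:R) n k.+1))) => //.
- exact: rmeasurable_skorohod_kernel.
- move=> u hu; apply: symmetrize_bound hu => v hv.
  by apply: adapted_kernel_bound; exact: hM.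
- by move=> k; apply: boxed_sym; exact: boxed_grid_T.
- move=> k u hu; rewrite step_fun_sym; apply: symmetrize_bound hu => v.
  exact: step_fun_grid_bound.
- move=> u hu; rewrite (eq_fun (fun k => step_fun_sym _ u)).
  by apply: symmetrize_cvg hu => v; exact: step_fun_grid_cvg.
Qed.

Lemma skorohod_delta_nonempty (I : forall n, tensor H T n -> {RV P >-> R}) :
  skorohod_delta I x !=set0.
Proof.
pose f n := projT1 (cid (skorohod_kernel_represented n)).
exists (fun n => I n (f n)), f; split=> n; last exact: aeW.
exact: (projT2 (cid (skorohod_kernel_represented n))).
Qed.

Lemma skorohod_delta_sobolev (B : R -> {RV P >-> R})
    (I : forall n, tensor H T n -> {RV P >-> R}) (alpha : R) :
  fbm H T B -> 3 / 2 - 1 / (2 * H) < alpha ->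
  skorohod_delta I x `<=` sobolev_watanabe I (- alpha).
Proof.
move=> hB ha F [f [hf hF]]; exists f.
have mK := rmeasurable_skorohod_kernel.
split=> // [n|].
  exact: (tensor_symmetric_represents hB hH hT (mK n) (skorohod_kernel_perm (n:=n))).
have [C C0 hC] := sobolev_term_le hH hT x alpha.
apply: (@series_powR_lty R _ C (alpha - 1 / 2 + 1 / (2 * H))) => //.
- by lra.
- move=> n; rewrite mulr_ge0 ?(tensor_norm2_ge0 hB)// mulr_ge0 ?powR_ge0//.
(* The estimate starts at order 3, where the Hermite function has index 2; the terms of orders 0, 1
   and 2 only have to be finite. *)
case=> [|[|[|m]]]// _; apply: le_trans (hC m.+1 _) => //.
rewrite ler_wpM2l ?mulr_ge0 ?powR_ge0//.
have [M M0 hM] := skorohod_kernel_bounded m.+3.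
rewrite -lee_fin; apply: (le_trans (tensor_norm2_le hH hT (mK _) M0 hM (hf _))).
exact: kernel_norm_le.
Qed.

End existence.

(** * The kernel of order one at the origin *)

Section origin.
Context (R : realType) (H T : R) (hH : 1 / 2 < H < 1) (hT : 0 < T).
Notation mu := (@lebesgue_measure R).
Notation D := ([set` `[0%R, T]] : set R).

Let H0 : 0 < H. Proof. by case/andP: hH; lra. Qed.
Let H1 : H < 1. Proof. by case/andP: hH; lra. Qed.
Let p0 : 0 < 2 * H - 1. Proof. by case/andP: hH; lra. Qed.

(** For 0 < t < s <= d both values of [b] are at least A / s^H and the density is at least its value
    at s. The integral over such t is then at least a constant times 1/s, whose integral over [e, d]
    is the logarithm. *)
Lemma energy_ge_ln (b : R -> R) (A e d : R) : measurable_fun setT b ->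
  (forall s, 0 <= b s) -> 0 < A -> 0 < e < d -> d <= T ->
  (forall t, 0 < t <= d -> A / t `^ H <= b t) ->
  ((A ^+ 2 * (H * (2 * H - 1)) * (ln d - ln e))%:E <=
   \int[mu]_(s in D) \int[mu]_(t in D) (b s * b t * cov_density H (s - t))%:E)%E.
Proof.
move=> mb b0 A0 /andP[e0 ed] dT hb.
pose C := A ^+ 2 * (H * (2 * H - 1)).
have C0 : 0 < C by rewrite mulr_gt0 ?exprn_gt0// mulr_gt0.
have d0 : 0 < d by exact: lt_trans ed.
pose f (s : R) := C * `|s| `^ (-1).
have f0 s : 0 <= f s by rewrite mulr_ge0 ?(ltW C0)// powR_ge0.
have fE s : 0 < s -> f s = C / s.
  by move=> s0; rewrite /f gtr0_norm// powRN powRr1// ltW.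
have m2 : measurable_fun setT (fun z : R * R =>
    (b z.1 * b z.2 * cov_density H (z.1 - z.2))%:E).
  apply/measurable_EFinP; apply: measurable_funM.
    by apply: measurable_funM; apply: measurableT_comp.
  apply: (measurableT_comp (measurable_cov_density H)).
  exact: measurable_funB.
have g0 s t : (0 <= (b s * b t * cov_density H (s - t))%:E)%E.
  by rewrite lee_fin; apply: mulr_ge0; [exact: mulr_ge0|exact: cov_density_ge0].
have mG : measurable_fun setT
    (fun s => \int[mu]_(t in D) (b s * b t * cov_density H (s - t))%:E)%E.
  exact: measurable_integral_param.
have -> : ((C * (ln d - ln e))%:E = \int[mu]_(s in `[e, d]) (f s)%:E)%E.
  rewrite mulrBr; symmetry; apply: (@ge0_FTC_open R f (fun s => C * ln s) e d ed f0).
  - move=> s; rewrite in_itv/= => /andP[es _]; have s0 := lt_trans e0 es.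
    apply: continuousM; first exact: cst_continuous.
    by apply: continuous_norm_powR_neq0; rewrite gt_eqF.
  - move=> s; rewrite in_itv/= => /andP[es _]; have s0 := lt_le_trans e0 es.
    by apply: continuousM; [exact: cst_continuous|exact: continuous_ln].
  move=> s; rewrite in_itv/= => /andP[es _]; have s0 := lt_trans e0 es.
  have hl := is_derive1_ln s0; apply: is_derive_eq.
  by rewrite fE.
apply: (@le_trans _ _ (\int[mu]_(s in `[e, d]) \int[mu]_(t in D)
    (b s * b t * cov_density H (s - t))%:E)%E); last first.
  apply: ge0_subset_integral => //.
  - exact: measurable_funTS.
  - by move=> s _; apply: integral_ge0.
  - by move=> s; rewrite /= !in_itv/= => /andP[es sd]; rewrite (le_trans (ltW e0))// (le_trans sd).
have mf : measurable_fun setT f.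
  apply: measurable_funM; first exact: measurable_cst.
  by apply: (measurableT_comp (f := fun x : R => x `^ (-1))).
apply: ge0_le_integral => //.
- by move=> s _; rewrite lee_fin.
- by apply: measurable_funTS; exact/measurable_EFinP.
- exact: measurable_funTS.
move=> s; rewrite /= in_itv/= => /andP[es sd]; have s0 := lt_le_trans e0 es.
have mGs : measurable_fun setT (fun t => (b s * b t * cov_density H (s - t))%:E).
  exact: (measurableT_comp m2 (measurable_fun_pair (measurable_cst s) (@measurable_id _ _ setT))).
apply: (@le_trans _ _ (\int[mu]_(t in `]0%R, s[)
    (b s * b t * cov_density H (s - t))%:E)%E); last first.
  apply: ge0_subset_integral => //; first exact: measurable_funTS.
  move=> t; rewrite /= !in_itv/= => /andP[t0 ts].
  by rewrite (ltW t0) (le_trans (ltW ts))// (le_trans sd).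
apply: (@le_trans _ _ (\int[mu]_(t in `]0%R, s[) (cst (C / s ^+ 2)%:E t))%E).
  rewrite (_ : (\int[mu]_(t in _) _)%E =
    ((C / s ^+ 2)%:E * mu `]0%R, s[%classic)%E); last exact: integral_cst.
  rewrite (_ : mu _ = s%:E); last by rewrite lebesgue_measure_itv/= lte_fin s0 oppr0 adde0.
  rewrite -EFinM lee_fin fE// le_eqVlt; apply/orP; left; apply/eqP.
  by field; rewrite gt_eqF.
apply: ge0_le_integral => //.
- by move=> t _; rewrite lee_fin divr_ge0 ?(ltW C0)// sqr_ge0.
- exact: measurable_funTS.
move=> t; rewrite /= in_itv/= => /andP[t0 ts]; rewrite lee_fin.
have hs := hb s (introT andP (conj s0 sd)).
have ht : A / s `^ H <= b t.
  apply: (le_trans _ (hb t _)); last by rewrite t0 (le_trans (ltW ts)).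
  rewrite ler_pM2l// lef_pV2 ?posrE ?powR_gt0//.
  by apply: ge0_ler_powR; rewrite ?nnegrE ltW.
have hc : cov_density H s <= cov_density H (s - t).
  apply: cov_density_ge => //; first by rewrite subr_eq0 gt_eqF.
  by rewrite ger0_norm ?subr_ge0 ?(ltW ts)// lerBlDr lerDl ltW.
have -> : C / s ^+ 2 = (A / s `^ H) * (A / s `^ H) * cov_density H s.
  rewrite /cov_density gtr0_norm// powRB; last by apply/implyP => _; rewrite gt_eqF.
  rewrite powR_mulrn ?(ltW s0)// (powR2 _ (ltW s0)) /C; field.
  by rewrite !gt_eqF// powR_gt0.
have Ah : 0 <= A / s `^ H by rewrite divr_ge0 ?powR_ge0// ltW.
apply: ler_pM => //; [exact: mulr_ge0|exact: cov_density_ge0|exact: ler_pM].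
Qed.

Lemma skorohod_kernel1 (x s : R) : 0 < s ->
  skorohod_kernel (delta_kernel H x) (n:=1) (fcons s (fun=> 0)) =
  heat_kernel (s `^ (2 * H)) x.
Proof.
move=> s0; rewrite /= /symmetrize invr1 mul1r.
rewrite (eq_bigr (fun=> heat_kernel (s `^ (2 * H)) x)).
  by rewrite sumr_const card_Sn.
move=> sg _; rewrite /delta_kernel big_ord0 mulr1 (ord1 (sg _)) /fcons unlift_none.
rewrite /delta_coef mul0r oppr0 powRr0 mul1r hermiteE /= expr0 fact0 divr1 mul1r.
by rewrite -expRD addrN expR0 mulr1.
Qed.

Lemma heat_kernel_origin (s : R) : 0 < s ->
  heat_kernel (s `^ (2 * H)) 0 = (Num.sqrt (2 * pi))^-1 / s `^ H.
Proof.
move=> s0; rewrite /heat_kernel expr0n/= mul0r oppr0 expR0 mulr1 (powR2 _ (ltW s0)).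
rewrite sqrtrM ?sqrtr_sqr ?ger0_norm ?powR_ge0//; last by rewrite mulr_ge0// pi_ge0.
by rewrite invfM.
Qed.

(** Some step function would be at distance less than 1 from the kernel. As it is bounded, the
    difference still dominates a multiple of s^(-H) near 0, and its energy can be shown to be at
    least 1. *)
Lemma skorohod_kernel_origin_divergent (phi : tensor H T 1) :
  ~ represents phi (skorohod_kernel (delta_kernel H 0) (n:=1)).
Proof.
move=> /(represents_ip hH)/(_ ltr01)[k _ /(_ k (leqnn k)) hk].
pose K (u : 'I_1 -> R) :=
  skorohod_kernel (delta_kernel H 0) (n:=1) u - step_fun (phi k) u.
have {hk} : (abs_ip H T K K < 1%:E)%E by exact: hk.
have [L L0 hL] := step_fun_bounded (phi k).
pose c : R := (Num.sqrt (2 * pi))^-1.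
have c0 : 0 < c by rewrite invr_gt0 sqrtr_gt0 mulr_gt0// pi_gt0.
pose A := c / 2; have A0 : 0 < A by rewrite divr_gt0.
pose r := A / (L + 1); have r0 : 0 < r by rewrite divr_gt0// ltr_wpDl.
(* For t <= d the bound L of the step function is at most A / t^H, half of the kernel c / t^H; the
   other half remains in the difference. *)
pose d := Num.min T (r `^ H^-1).
have d0 : 0 < d by rewrite lt_min hT powR_gt0.
pose b s := `|K (fcons s (fun=> 0))|.
have mb : measurable_fun setT b.
  have mg (i : 'I_1) : measurable_fun setT (fun s : R => fcons s (fun=> 0) i).
    by rewrite (ord1 i) /fcons unlift_none; exact: measurable_id.
  apply: (measurableT_comp (f := fun z : R => `|z|)) => //.
  apply: measurable_funB.
    exact: (rmeasurable_symmetrize (measurable_delta_coef H 0 0) mg).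
  exact: (rmeasurable_step_fun _ mg).
have hb t : 0 < t <= d -> A / t `^ H <= b t.
  move=> /andP[t0 td]; rewrite /b /K skorohod_kernel1// heat_kernel_origin//.
  have tH0 : 0 < t `^ H by exact: powR_gt0.
  have tr : t `^ H <= r.
    have -> : r = (r `^ H^-1) `^ H by rewrite -powRrM mulVf ?gt_eqF// powRr1// ltW.
    apply: ge0_ler_powR; rewrite ?nnegrE ?powR_ge0 ?(ltW H0) ?(ltW t0)//.
    by apply: (le_trans td); rewrite ge_min lexx orbT.
  have hLA : L <= A / t `^ H.
    rewrite ler_pdivlMr//; apply: (le_trans (ler_wpM2l L0 tr)).
    by rewrite /r mulrCA ler_piMr ?(ltW A0)// ler_pdivrMr ?mul1r ?lerDl// ltr_wpDl.
  rewrite -/c; apply: (le_trans _ (lerB_dist _ _)).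
  rewrite ger0_norm; last by rewrite divr_ge0 ?(ltW c0) ?(ltW tH0).
  have -> : c / t `^ H = A / t `^ H + A / t `^ H by rewrite -mulrDl /A; congr (_ / _); field.
  by have := hL (fcons t (fun=> 0)); lra.
pose C := A ^+ 2 * (H * (2 * H - 1)).
have C0 : 0 < C by rewrite mulr_gt0 ?exprn_gt0// mulr_gt0.
(* Solves C (ln d - ln e) = 1, so that the logarithmic lower bound equals 1. *)
pose e := d * expR (- C^-1).
have e0 : 0 < e by rewrite mulr_gt0// expR_gt0.
have ed : e < d by rewrite gtr_pMr// -expR0 ltr_expR oppr_lt0 invr_gt0.
apply/negP; rewrite -leNgt.
have -> : abs_ip H T K K = (\int[mu]_(s in D) \int[mu]_(t in D)
    (b s * b t * cov_density H (s - t))%:E)%E.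
  rewrite /abs_ip /=; apply: eq_integral => s _; apply: eq_integral => t _.
  by rewrite /weight big_ord1 /fcons unlift_none.
have e0d : 0 < e < d by rewrite e0.
have dT : d <= T by rewrite ge_min lexx.
have b0 s : 0 <= b s by exact: normr_ge0.
apply: (le_trans _ (energy_ge_ln mb b0 A0 e0d dT hb)).
rewrite lee_fin -/C /e lnM ?posrE ?expR_gt0// expRK opprD addrA subrr sub0r opprK.
by rewrite divff ?gt_eqF.
Qed.

End origin.

Theorem proposition6 (R : realType) (d : measure_display)
    (Omega : measurableType d) (P : probability Omega R) (H T : R)
    (hT : 0 < T) (hH : 1 / 2 < H < 1)
    (B : R -> {RV P >-> R}) (hB : fbm H T B)
    (I : forall n, tensor H T n -> {RV P >-> R})
    (hI : multiple_integral B I) (x : R) :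
  (x != 0 -> skorohod_delta I x !=set0) /\
  (forall alpha : R, 3 / 2 - 1 / (2 * H) < alpha ->
     skorohod_delta I x `<=` sobolev_watanabe I (- alpha)).
Proof.
split=> [x0|alpha ha].
  exact: (skorohod_delta_nonempty hH hT x0 I).
(* At x = 0 the component of order one cannot be represented, so [skorohod_delta I 0] is empty and
   the inclusion is vacuous. *)
have [->|x0] := eqVneq x 0; last exact: (skorohod_delta_sobolev hH hT x0 hB ha).
by move=> F [f [/(_ 1) hf _]]; case: (skorohod_kernel_origin_divergent hH hT hf).
Qed.
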